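(* In the generalized functional linear model setting of the context, suppose Assumptions A1–A5 (listed in the context) hold, and that as $n\to\infty$, $h=o(1)$ and $\log(h^{-1})=O(\log n)$. Then, as $n\to\infty$, $$\|\widehat\theta_{n,\lambda}-\theta_0-S_{n,\lambda}(\theta_0)\|=O_P(a_n),$$ where $$a_n=n^{-1/2}h^{-\frac{4ma+6m-1}{4m}}\,r_n(\log n)^2(\log\log n)^{1/2}+C_\ell h^{-1/2}r_n^2,\qquad C_\ell=\sup_{x\in L^2(\mathbb I)}E\Big\{\sup_{u\in\mathbb R}|\ell'''_a(Y;u)|\,\Big|\,X=x\Big\}.$$
   Context: Setting. $\mathbb I=[0,1]$; $m\ge 1$ is an integer; $H^m(\mathbb I)=\{\beta:\mathbb I\to\mathbb R \mid \beta^{(j)},\ j=0,\dots,m-1,$ absolutely continuous, $\beta^{(m)}\in L^2(\mathbb I)\}$; $\mathcal H=\mathbb R\times H^m(\mathbb I)$. $(Y_i,X_i)$, $i=1,\dots,n$, are i.i.d. copies of $(Y,X)$, with $Y\in\mathcal Y\subset\mathbb R$ and $X=X(t)$ a real-valued random process on $\mathbb I$ with paths in $L^2(\mathbb I)$. The true parameter is $\theta_0=(\alpha_0,\beta_0)\in\mathcal H$, with $E\{Y|X\}=F(\alpha_0+\int_0^1X(t)\beta_0(t)dt)$ for a known link function $F$. $\ell(y;a)$, $y\in\mathcal Y$, $a\in\mathbb R$, is a criterion function with first, second, third derivatives in $a$ denoted $\dot\ell_a,\ddot\ell_a,\ell'''_a$. $\lambda=\lambda_n>0$ is deterministic, $J(\beta,\tilde\beta)=\int_0^1\beta^{(m)}\tilde\beta^{(m)}dt$,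 $\ell_{n,\lambda}(\theta)=\frac1n\sum_{i=1}^n\ell(Y_i;\alpha+\int_0^1X_i\beta\,dt)-\frac\lambda2J(\beta,\beta)$ for $\theta=(\alpha,\beta)$, and $\widehat\theta_{n,\lambda}=(\widehat\alpha_{n,\lambda},\widehat\beta_{n,\lambda})$ maximizes $\ell_{n,\lambda}$ over $\mathcal H$. Notation. $B(X)=-E\{\ddot\ell_a(Y;\alpha_0+\int_0^1X\beta_0)\mid X\}$, $C(s,t)=E\{B(X)X(s)X(t)\}$, $V(\beta,\tilde\beta)=\int_0^1\int_0^1C(s,t)\beta(t)\tilde\beta(s)dsdt$, $(C\beta)(t)=\int_0^1C(s,t)\beta(s)ds$. On $H^m(\mathbb I)$: $\langle\beta,\tilde\beta\rangle_1=V(\beta,\tilde\beta)+\lambda J(\beta,\tilde\beta)$. On $\mathcal H$: $\langle\theta,\tilde\theta\rangle=E\{B(X)(\alpha+\int_0^1X\beta)(\tilde\alpha+\int_0^1X\tilde\beta)\}+\lambda J(\beta,\tilde\beta)$, with norm $\|\cdot\|$. For $x\in L^2(\mathbb I)$, $\tau(x)\in H^m(\mathbb I)$ is defined by $\langle\tau(x),\beta\rangle_1=\int_0^1x\beta\,dt$ for all $\beta\in H^m(\mathbb I)$, and $R_x=(E\{B(X)\}^{-1},\tau(x))$, so that $\langle R_x,\theta\rangle=\alpha+\int_0^1x\beta\,dt$. $W_\lambda:H^m(\mathbb I)\to H^m(\mathbb I)$ is defined by $\langle W_\lambda\beta,\tilde\beta\rangle_1=\lambda J(\beta,\tilde\beta)$,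 and $P_\lambda\theta=(0,W_\lambda\beta)$. $S_{n,\lambda}(\theta)=\frac1n\sum_{i=1}^n\dot\ell_a(Y_i;\langle R_{X_i},\theta\rangle)R_{X_i}-P_\lambda\theta\in\mathcal H$. With $k,a$ from A3: $h=\lambda^{1/(2k)}$ and $r_n=(nh)^{-1/2}+h^k$. Assumptions. A1: (a) $\ell(y;\cdot)$ is three times continuously differentiable and strictly concave; there are constants $C_0,C_1>0$ with $E\{\exp(\sup_{a\in\mathbb R}|\ddot\ell_a(Y;a)|/C_0)|X\}\le C_1$ and $E\{\exp(\sup_{a\in\mathbb R}|\ell'''_a(Y;a)|/C_0)|X\}\le C_1$ a.s. (b) There is $C_2>0$ with $C_2^{-1}\le B(X)\le C_2$ a.s., and $E\{B(X)X(t)\}=0$ for all $t\in\mathbb I$. (c) $\epsilon=\dot\ell_a(Y;\alpha_0+\int_0^1X\beta_0)$ satisfies $E\{\epsilon|X\}=0$, $E\{\epsilon^2|X\}=B(X)$ a.s. A2: $C(s,t)$ is continuous on $\mathbb I\times\mathbb I$, and $\beta\in L^2(\mathbb I)$, $C\beta=0$ imply $\beta=0$. A3: There are $\varphi_\nu\in H^m(\mathbb I)$, $\nu\ge1$, with $\|\varphi_\nu\|_{L^2}\le C_\varphi\nu^a$ for constants $a\ge0$, $C_\varphi>0$, and $V(\varphi_\nu,\varphi_\mu)=\delta_{\nu\mu}$, $J(\varphi_\nu,\varphi_\mu)=\rho_\nu\delta_{\nu\mu}$ for all $\nu,\mu\ge1$, where $\rho_\nu\ge0$ is nondecreasing with $\rho_\nu\asymp\nu^{2k}$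 for a constant $k>a+1/2$; every $\beta\in H^m(\mathbb I)$ has the expansion $\beta=\sum_{\nu}V(\beta,\varphi_\nu)\varphi_\nu$ converging in $\langle\cdot,\cdot\rangle_1$. A4: There is $s\in(0,1)$ with $E\{\exp(s\|X\|_{L^2})\}<\infty$, and $M_0>0$ with $E\{|\int_0^1X\beta|^4\}\le M_0[E\{|\int_0^1X\beta|^2\}]^2$ for all $\beta\in H^m(\mathbb I)$. A5: $\|\widehat\theta_{n,\lambda}-\theta_0\|=O_P(r_n)$. *)

(* Defs.v *)
From HB Require Import structures.
From mathcomp Require Import all_boot all_order all_algebra.
From mathcomp Require Import all_classical all_reals all_analysis.
From mathcomp Require Import measurable_realfun.

Set Implicit Arguments.
Unset Strict Implicit.
Unset Printing Implicit Defensive.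

Import Order.TTheory GRing.Theory Num.Theory.
Import numFieldNormedType.Exports.

Local Open Scope classical_set_scope.
Local Open Scope ring_scope.

(* Functions on the unit interval are represented by functions R -> R of which
   only the values on `[0, 1] are ever used. *)

Local Notation I01 R := (`[(0%R : R), (1%R : R)]%classic : set R) (only parsing).

Section UnitInterval.
Context {R : realType}.
Implicit Types (f g x b : R -> R).

Definition intI f : R := \int[lebesgue_measure]_(t in I01 R) f t.

Definition L2I f : Prop :=
  measurable_fun (I01 R) f /\
  (\int[lebesgue_measure]_(t in I01 R) ((f t) ^+ 2)%:E < +oo)%E.

Definition dotI f g : R := intI (fun t => f t * g t).

Definition normL2 f : R := Num.sqrt (dotI f f).

(* Derivative of f as a function on `[0, 1]: one-sided at the end points. *)
Definition quotI f (t s : R) : R := (f s - f t) / (s - t).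

Definition derivableI f (t : R) : Prop :=
  cvg (quotI f t s @[s --> within (I01 R) t^']).

Definition derivI f (t : R) : R :=
  lim (quotI f t s @[s --> within (I01 R) t^']).

Definition derivnI (n : nat) f : R -> R := iter n derivI f.

(* Absolute continuity on `[0, 1]; the intervals ](p i).1, (p i).2[ form a
   finite family of pairwise disjoint subintervals. *)
Definition abs_contI f : Prop :=
  forall e : R, 0 < e -> exists2 dl : R, 0 < dl &
    forall (N : nat) (p : 'I_N -> R * R),
      (forall i, [/\ 0 <= (p i).1, (p i).1 <= (p i).2 & (p i).2 <= 1]) ->
      (forall i j, i != j -> (p i).2 <= (p j).1 \/ (p j).2 <= (p i).1) ->
      \sum_(i < N) ((p i).2 - (p i).1) < dl ->
      \sum_(i < N) `|f (p i).2 - f (p i).1| < e.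

Definition Hm (m : nat) b : Prop :=
  [/\ forall j, (j.+1 < m)%N ->
        forall t, t \in `[0%R, 1%R] -> derivableI (derivnI j b) t,
      forall j, (j < m)%N -> abs_contI (derivnI j b)
    & L2I (derivnI m b)].

Definition Jform (m : nat) b b' : R := dotI (derivnI m b) (derivnI m b').

Definition lin x (theta : R * (R -> R)) : R := theta.1 + dotI x theta.2.

End UnitInterval.

(* The sample paths, seen as elements of L^2 of the unit interval: the
   sigma-algebra is the one generated by the functionals x |-> \int_0^1 x b,
   b in L^2, which induces the Borel sigma-algebra of the separable Hilbert
   space L^2. *)
Definition L2cylinders (R : realType) : set (set (R -> R)) :=
  [set A | exists b D, [/\ L2I b, measurable (D : set R) &
                           A = [set x | D (dotI x b)]]].

Definition L2path (R : realType) := g_sigma_algebraType (@L2cylinders R).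

Section Probability.
Context {R : realType} {d : measure_display} {Omega : measurableType d}.
Variable P : probability Omega R.

(* g is a version of x |-> E{Z | X = x}, that is, g(X) is a version of
   E{Z | X}. *)
Definition cond_exp (X : Omega -> L2path R) (Z : Omega -> \bar R)
    (g : L2path R -> \bar R) : Prop :=
  [/\ P.-integrable setT Z \/
        (measurable_fun setT Z /\ forall w, (0 <= Z w)%E),
      measurable_fun setT g
    & forall A : set (L2path R), measurable A ->
        (\int[P]_(w in X @^-1` A) Z w = \int[P]_(w in X @^-1` A) g (X w))%E].

Definition mutually_independent d' (T : measurableType d')
    (Z : nat -> Omega -> T) : Prop :=
  forall (J : seq nat) (A : nat -> set T), uniq J ->
    (forall j, measurable (A j)) ->
    P (\bigcap_(j in [set` J]) (Z j @^-1` A j)) =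
    (\prod_(j <- J) P (Z j @^-1` A j))%E.

Definition identically_distributed d' (T : measurableType d')
    (Z : nat -> Omega -> T) (Z0 : Omega -> T) : Prop :=
  forall (i : nat) (A : set T), measurable A ->
    P (Z i @^-1` A) = P (Z0 @^-1` A).

(* Z_n = O_P(a_n), stated with the outer probability mu_ext P, which is P itself
   on measurable sets, so that no measurability of Z_n is needed. The rate a_n
   may be +oo. *)
Definition bounded_in_prob (Z : nat -> Omega -> R) (a : nat -> \bar R) : Prop :=
  forall e : R, 0 < e -> exists2 M : R, 0 < M &
    \forall n \near \oo,
      (mu_ext P [set w | M%:E * a n < `|Z n w|%:E] <= e%:E)%E.

Definition L2process (X : Omega -> L2path R) : Prop :=
  measurable_fun ([set: Omega] `*` I01 R) (fun p : Omega * R => X p.1 p.2)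
  /\ forall w, L2I (X w).

End Probability.

Section Forms.
Context {R : realType} {d : measure_display} {Omega : measurableType d}.
Variables (P : probability Omega R) (X : Omega -> L2path R) (B : L2path R -> R).
Variable m : nat.
Implicit Types (b : R -> R) (theta : R * (R -> R)).

Definition Cov (s t : R) : R :=
  fine ('E_P[fun w => (B (X w) * X w s * X w t)%R])%E.

Definition Vform b b' : R :=
  intI (fun t => intI (fun s => Cov s t * b t * b' s)).

Definition Cop b (t : R) : R := intI (fun s => Cov s t * b s).

Definition ip1 (lam : R) b b' : R := Vform b b' + lam * Jform m b b'.

Definition ipH (lam : R) theta theta' : R :=
  fine ('E_P[fun w => (B (X w) * lin (X w) theta * lin (X w) theta')%R])%E
  + lam * Jform m theta.2 theta'.2.

Definition normH (lam : R) theta : R := Num.sqrt (ipH lam theta theta).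

Definition is_tau (lam : R) (tau : (R -> R) -> (R -> R)) : Prop :=
  forall x, L2I x ->
    Hm m (tau x) /\ forall b, Hm m b -> ip1 lam (tau x) b = dotI x b.

Definition is_W (lam : R) (W : (R -> R) -> (R -> R)) : Prop :=
  forall b, Hm m b ->
    Hm m (W b) /\
    forall b', Hm m b' -> ip1 lam (W b) b' = lam * Jform m b b'.

Definition Rep (tau : (R -> R) -> (R -> R)) (x : R -> R) : R * (R -> R) :=
  ((fine ('E_P[fun w => B (X w)])%E)^-1, tau x).

Definition Pen (W : (R -> R) -> (R -> R)) theta : R * (R -> R) :=
  (0, W theta.2).

(* The sample is (Ys i, Xs i) for i = 0, ..., n - 1. *)
Variables (ell : R -> R -> R).
Variables (Ys : nat -> Omega -> R) (Xs : nat -> Omega -> L2path R).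

Definition criterion (lam : R) (n : nat) (w : Omega) theta : R :=
  n%:R^-1 * (\sum_(i < n) ell (Ys i w) (lin (Xs i w) theta))
  - lam / 2 * Jform m theta.2 theta.2.

Definition Score (lam : R) (tau W : (R -> R) -> (R -> R)) (n : nat)
    (w : Omega) theta : R * (R -> R) :=
  n%:R^-1 *: (\sum_(i < n)
    (ell (Ys i w))^`()%classic (ipH lam (Rep tau (Xs i w)) theta)
      *: (Rep tau (Xs i w) : R^o * (R -> R^o)))
  - Pen W theta.

End Forms.

Section Assumptions.
Context {R : realType} {d : measure_display} {Omega : measurableType d}.
Variables (P : probability Omega R) (m : nat).
Variables (Yset : set R) (ell : R -> R -> R).
Variables (Y : Omega -> R) (X : Omega -> L2path R).
Variables (theta0 : R * (R -> R)) (B : L2path R -> R).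

Definition supderiv (j : nat) (y : R) : \bar R :=
  ereal_sup [set (`| (ell y)^`(j)%classic u |)%:E | u in [set: R]].

(* B(X) = - E{ell''(Y; alpha0 + \int X beta0) | X}, derivatives of ell being
   taken in its second argument. *)
Definition is_B : Prop :=
  cond_exp P X (fun w => ((ell (Y w))^`(2)%classic (lin (X w) theta0))%:E)
    (fun x => (- B x)%:E).

Definition eps (w : Omega) : R := (ell (Y w))^`()%classic (lin (X w) theta0).

Definition assumption_A1 : Prop :=
  [/\ forall y, Yset y ->
        [/\ forall j, (j < 3)%N -> forall u : R, derivable ((ell y)^`(j)%classic) u 1,
            continuous ((ell y)^`(3)%classic)
          & forall u v t : R, u != v -> 0 < t -> t < 1 ->
              t * ell y u + (1 - t) * ell y v < ell y (t * u + (1 - t) * v)],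
      exists C0 C1 : R, [/\ 0 < C0, 0 < C1
        & forall j, (j == 2)%N || (j == 3)%N ->
            exists2 g : L2path R -> \bar R,
              cond_exp P X
                (fun w => expeR (supderiv j (Y w) * (C0^-1)%:E)%E) g
              & {ae P, forall w, (g (X w) <= C1%:E)%E}],
      exists2 C2 : R, 0 < C2
        & {ae P, forall w, C2^-1 <= B (X w) /\ B (X w) <= C2},
      forall t, t \in `[0%R, 1%R] -> ('E_P[fun w => (B (X w) * X w t)%R] = 0)%E
    & cond_exp P X (fun w => (eps w)%:E) (fun _ => 0%E) /\
      cond_exp P X (fun w => ((eps w) ^+ 2)%:E) (fun x => (B x)%:E)].

(* The first item says that the expectations C(s, t) exist. *)
Definition assumption_A2 : Prop :=
  [/\ forall s t, s \in `[0%R, 1%R] -> t \in `[0%R, 1%R] ->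
        P.-integrable setT (fun w => (B (X w) * X w s * X w t)%:E),
      {within I01 R `*` I01 R,
        continuous (fun p : R * R => Cov P X B p.1 p.2)}
    & forall b : R -> R, L2I b ->
        {ae (@lebesgue_measure R), forall t, t \in `[0%R, 1%R] ->
           Cop P X B b t = 0} ->
        {ae (@lebesgue_measure R), forall t, t \in `[0%R, 1%R] -> b t = 0}].

(* The indices nu >= 1 are those that matter. As J vanishes on polynomials of
   degree < m, rho_nu \asymp nu^(2k) can only be required for large nu. *)
Definition assumption_A3 (lam : nat -> R) (k a : R) : Prop :=
  [/\ 0 <= a, a + 2^-1 < k &
   exists (phi : nat -> R -> R) (rho : nat -> R) (Cphi : R),
     0 < Cphi /\
     [/\ forall nu, (1 <= nu)%N ->
           Hm m (phi nu) /\ normL2 (phi nu) <= Cphi * nu%:R `^ a,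
         forall nu mu, (1 <= nu)%N -> (1 <= mu)%N ->
           Vform P X B (phi nu) (phi mu) = (nu == mu)%:R /\
           Jform m (phi nu) (phi mu) = rho nu * (nu == mu)%:R,
         (forall nu, (1 <= nu)%N -> 0 <= rho nu) /\
         (forall nu mu, (1 <= nu)%N -> (nu <= mu)%N -> rho nu <= rho mu),
         exists c1 c2 : R, [/\ 0 < c1, 0 < c2
           & \forall nu \near \oo, c1 * nu%:R `^ (2 * k) <= rho nu /\
                                   rho nu <= c2 * nu%:R `^ (2 * k)]
       & forall n b, Hm m b ->
           let rest N : R -> R := fun t =>
             b t - \sum_(1 <= nu < N.+1) Vform P X B b (phi nu) * phi nu t in
           ip1 P X B m (lam n) (rest N) (rest N) @[N --> \oo] --> (0 : R)]].

Definition assumption_A4 : Prop :=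
  (exists s : R, [/\ 0 < s, s < 1 &
     ('E_P[fun w => (expR (s * normL2 (X w)))%R] < +oo)%E]) /\
  (exists2 M0 : R, 0 < M0 & forall b, Hm m b ->
     ('E_P[fun w => (`|dotI (X w) b| ^+ 4)%R] <=
      M0%:E * ('E_P[fun w => (`|dotI (X w) b| ^+ 2)%R]) ^+ 2)%E).

End Assumptions.

Section Rates.
Context {R : realType}.

Definition bandwidth (lam : nat -> R) (k : R) (n : nat) : R :=
  lam n `^ (2 * k)^-1.

Definition rate_r (lam : nat -> R) (k : R) (n : nat) : R :=
  let h := bandwidth lam k n in (n%:R * h) `^ (- 2^-1) + h `^ k.

Definition rate_a (m : nat) (lam : nat -> R) (k a : R) (Cl : \bar R)
    (n : nat) : \bar R :=
  let h := bandwidth lam k n in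
  let r := rate_r lam k n in
  ((n%:R `^ (- 2^-1)
    * h `^ (- ((4 * m%:R * a + 6 * m%:R - 1) / (4 * m%:R)))
    * r * (ln n%:R) ^+ 2 * Num.sqrt (ln (ln n%:R)))%R%:E
   + Cl * (h `^ (- 2^-1) * r ^+ 2)%R%:E)%E.

(* sup over x in L^2 of a version g of E{ sup_u |ell'''(Y; u)| | X = x } *)
Definition C_ell (g : L2path R -> \bar R) : \bar R :=
  ereal_sup [set g x | x in [set x : L2path R | L2I x]].

End Rates.

(* Main.v *)
Require Import Defs.
From HB Require Import structures.
From mathcomp Require Import all_boot all_order all_algebra.
From mathcomp Require Import all_classical all_reals all_analysis.
From mathcomp Require Import measurable_realfun.
From mathcomp Require Import ring lra.

Set Implicit Arguments.
Unset Strict Implicit.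
Unset Printing Implicit Defensive.

Import Order.TTheory GRing.Theory Num.Theory.
Import numFieldNormedType.Exports.

Local Open Scope classical_set_scope.
Local Open Scope ring_scope.

(* With g = thetahat - theta0 and D = g - S_n(theta0), the first-order condition
   at thetahat in the direction D and the reproducing property give
     |D|^2 = E[B <X,g> <X,D>] + (1/n) sum ell''(Y_i; theta0) <X_i,g> <X_i,D>
             + (1/n) sum rho_i <X_i,D>,
   where <x,theta> stands for lin x theta and the Taylor remainders satisfy
   |rho_i| <= G(Y_i) |<X_i,g>| min(2, |<X_i,g>|) with G = 1 + sup |ell''| +
   sup |ell'''| (and rho = 0 if C_ell = 0). The first two terms are the
   deviation of an average of quadratic forms from its mean. Expanding g and D
   in the basis (1, phi_1, phi_2, ...), which is orthogonal for the penalized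
   inner product with squared norms gam, such a deviation is at most
   T_N^(1/2) |g| |D| with T_N the weighted sum of the squared deviations of the
   empirical moments of order N, and E T_N <= C n^-1 (sum 1/gam)^2 <= C n^-1 h^-2.
   The same bound, applied to the weight G min(1, r s_N^(1/2)) with
   s_N = sum xi^2/gam, controls the remainder, whose mean is of order
   r h^(-1/2) |g| |D|. Letting N -> oo,
     |D| = O_P(n^(-1/2) h^-1 + r h^(-1/2)) |g|, with |g| = O_P(r). *)

(** * Absolutely continuous functions *)

Section AbsCont.
Context {R : realType}.
Implicit Types (f : R -> R) (a b c : R).
Local Notation TV := total_variation.
Local Notation mu := (@lebesgue_measure R).

(** The obstacle is that g and D depend on the whole sample, so averages along them cannot be
    handled one direction at a time. T_N is a squared Hilbert-Schmidt norm: it controls all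
    directions simultaneously, including random ones, and its expectation involves only variances of
    averages of independent variables. Keeping N finite means that only finite sums are ever
    integrated.

    In the remainder, min(2, |<X_i,g>|) is random through g as well, hence its replacement by a
    function of the data point alone. The 2 comes from comparing two values of ell'', the other
    branch from ell'''. The resulting term is paid for by C_ell h^(-1/2) r^2 when C_ell > 0; when
    C_ell = 0, sup |ell'''(Y; .)| vanishes almost surely.

    Derivatives on [0, 1] are pointwise limits with a default value, so J is bilinear on H^m only
    because an absolutely continuous function is derivable almost everywhere. This theorem of
    Lebesgue is proved by Vitali coverings, since the exceptional sets are not known to be
    measurable in advance. *)

Lemma abs_contI_TV_small f (dl : R) :
  (forall (N : nat) (p : 'I_N -> R * R),
      (forall i, [/\ 0 <= (p i).1, (p i).1 <= (p i).2 & (p i).2 <= 1]) ->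
      (forall i j, i != j -> (p i).2 <= (p j).1 \/ (p j).2 <= (p i).1) ->
      \sum_(i < N) ((p i).2 - (p i).1) < dl ->
      \sum_(i < N) `|f (p i).2 - f (p i).1| < 1) ->
  forall a b, 0 <= a -> b <= 1 -> b - a < dl -> (TV a b f <= 1)%E.
Proof.
move=> H a b a0 b1 abd; apply: ge_ereal_sup => _ [_ [s sab <-] <-].
rewrite lee_fin; apply: ltW.
pose q (i : nat) := nth b (a :: s) i.
have qs : q (size s) = b by exact: itv_partition_nth_size.
have qmono i j : (i <= j)%N -> (j < (size s).+1)%N -> q i <= q j.
  move=> ij js; have [sab1 _] := sab.
  have : sorted <=%R (a :: s).
    by rewrite /=; apply: sub_path sab1 => x y /ltW.
  move=> /(sorted_leq_nth le_trans le_refl b).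
  by apply => //; rewrite inE /= (leq_ltn_trans ij).
have qge i : (i < (size s).+1)%N -> 0 <= q i.
  by move=> ?; rewrite (le_trans a0)//; exact: itv_partition_nth_ge sab.
have qle i : (i < (size s).+1)%N -> q i <= 1.
  by move=> ?; rewrite (le_trans _ b1)//; exact: itv_partition_nth_le sab.
rewrite /variation big_mkord.
apply: (H _ (fun i : 'I_(size s) => (q i, q i.+1))) => /=.
- move=> i; split.
  + by apply: qge; rewrite ltnS ltnW.
  + by apply: qmono => //; rewrite ltnS.
  + by apply: qle; rewrite ltnS.
- move=> i j; rewrite neq_ltn => /orP[ij|ji].
    by left; apply: qmono => //; rewrite ltnS ltnW.
  by right; apply: qmono => //; rewrite ltnS ltnW.
- have -> : \sum_(i < size s) (q i.+1 - q i) = b - a.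
    by rewrite -(big_mkord xpredT (fun i => q i.+1 - q i)) telescope_sumr// qs.
  exact: abd.
Qed.

Lemma abs_contI_TV f : abs_contI f -> (TV 0 1 f < +oo)%E.
Proof.
move=> /(_ 1 ltr01)[dl dl0 /abs_contI_TV_small H].
have e0 : 0 < dl / 2 by rewrite divr_gt0.
suff K k (x : R) : 0 <= x -> x <= 1 -> x <= k%:R * (dl / 2) -> (TV 0 x f < +oo)%E.
  have := archi_boundP (ltW (divr_gt0 ltr01 e0)).
  set k := Num.Def.archi_bound _ => /ltW hk; apply: (K k) => //.
  by rewrite -ler_pdivrMr.
elim: k x => [|k IH] x x0 x1.
  rewrite mul0r => xle0; have -> : x = 0 by apply/eqP; rewrite eq_le xle0 x0.
  by rewrite total_variationxx.
(* The step back from x has length at most dl / 2 < dl, so the variation along it is at most 1, and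
   y falls under the induction hypothesis. *)
move=> xk; pose y := Num.max 0 (x - dl / 2).
have y0 : 0 <= y by rewrite le_max lexx.
have yx : y <= x by rewrite ge_max x0 /= lerBlDr lerDl ltW.
rewrite (total_variationD f y0 yx) lte_add_pinfty//.
  apply: IH => //; first by rewrite (le_trans yx).
  rewrite ge_max mulr_ge0 ?ler0n ?(ltW e0)//= lerBlDr.
  by move: xk; rewrite -natr1 mulrDl mul1r.
apply: le_lt_trans (ltry 1); apply: H => //.
have : x - dl / 2 <= y by rewrite le_max lexx orbT.
lra.
Qed.

Lemma abs_contI_cont f : abs_contI f ->
  forall e : R, 0 < e -> exists2 dl : R, 0 < dl & forall x y : R,
    x \in `[0%R, 1%R] -> y \in `[0%R, 1%R] -> `|x - y| < dl -> `|f x - f y| < e.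
Proof.
move=> fac e /fac[dl dl0 H]; exists dl => // x y.
wlog xy : x y / x <= y.
  move=> W; case: (leP x y) => [/W//|/ltW /W + xI yI].
  by rewrite distrC (distrC (f x)); apply.
rewrite !in_itv /= => /andP[x0 x1] /andP[y0 y1] xyd.
have := H 1%N (fun=> (x, y)); rewrite !big_ord1 /= distrC; apply => //.
  by move=> i j; rewrite !ord1.
by move: xyd; rewrite distrC ger0_norm// subr_ge0.
Qed.

Lemma abs_contI_continuous f : abs_contI f ->
  forall x : R, 0 < x -> x < 1 -> f y @[y --> x] --> f x.
Proof.
move=> /abs_contI_cont fc x x0 x1; apply/cvgrPdist_lt => e /fc[dl dl0 H].
near=> y; apply: H; rewrite ?in_itv /= ?(ltW x0) ?(ltW x1) //.
  apply/andP; split; apply: ltW; near: y.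
    exact: lt_nbhsr.
  exact: lt_nbhsl.
Unshelve. all: by end_near. Qed.

(* Removing a family of disjoint subintervals from [a, b] leaves intervals along
   which f increases by (f b - f a) minus its increments over the family; T is
   at least the sum of the absolute values of all these increments. *)
Lemma variation_disjoint_family f (T : R -> R -> R) a b :
  (forall x y z, a <= x -> x <= y -> y <= z -> z <= b -> T x z = T x y + T y z) ->
  (forall x y, a <= x -> x <= y -> y <= b -> `|f y - f x| <= T x y) ->
  forall s : seq (R * R), a <= b ->
  (forall p, p \in s -> [/\ a <= p.1, p.1 <= p.2 & p.2 <= b]) ->
  pairwise (fun p q => (p.2 <= q.1) || (q.2 <= p.1)) s ->
  f b - f a <= T a b + 2 * \sum_(p <- s) (f p.2 - f p.1).
Proof.
move=> TD Tge s; move: {2}(size s).+1 (leqnn (size s).+1) => n.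
elim: n s a b TD Tge => [//|n IH] [|[u v] s] a b TD Tge.
- by move=> *; rewrite big_nil mulr0 addr0 (le_trans (ler_norm _))// Tge.
rewrite /= !ltnS => sn ab sI /andP[/allP sx spw].
(* The first interval [u, v] separates the others: those ending at or before u lie in [a, u], the
   rest, by disjointness, in [v, b]. Both sublists can be much shorter, hence the induction on a
   bound for the length. *)
have [/= au uv vb] := sI (u, v) (mem_head _ _).
rewrite big_cons/= (bigID (fun p => p.2 <= u))/=.
rewrite -big_filter -[X in _ + (_ + X)]big_filter.
set s1 := [seq p <- s | p.2 <= u]; set s2 := [seq p <- s | ~~ (p.2 <= u)].
have L : f u - f a <= T a u + 2 * \sum_(p <- s1) (f p.2 - f p.1).
  apply: IH => //.
  - by move=> x y z *; apply: TD => //; rewrite (le_trans _ vb)// (le_trans _ uv).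
  - by move=> x y *; apply: Tge => //; rewrite (le_trans _ vb)// (le_trans _ uv).
  - by rewrite (leq_ltn_trans _ sn)// size_filter count_size.
  - move=> p; rewrite mem_filter => /andP[pu ps].
    by have [] := sI p; rewrite ?inE ?ps ?orbT.
  - exact: pairwise_filter.
have M : f b - f v <= T v b + 2 * \sum_(p <- s2) (f p.2 - f p.1).
  apply: IH => //.
  - by move=> x y z *; apply: TD => //; rewrite (le_trans au)// (le_trans uv).
  - by move=> x y *; apply: Tge => //; rewrite (le_trans au)// (le_trans uv).
  - by rewrite (leq_ltn_trans _ sn)// size_filter count_size.
  - move=> p; rewrite mem_filter => /andP[pu ps].
    have [_ p12 pb] := sI p ltac:(by rewrite ?inE ?ps ?orbT).
    by have /= := sx p ps; rewrite (negbTE pu) orbF.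
  - exact: pairwise_filter.
(* Read as f v - f u <= T u v + 2 (f v - f u), the share of the middle interval. *)
have := Tge u v au uv vb; rewrite ler_norml => /andP[T1 _].
rewrite (TD a u b)// ?(le_trans uv)// (TD u v b)//.
by move: L M T1; lra.
Qed.

Lemma rat_between a b : a < b -> exists q : rat, a < ratr q /\ ratr q < b.
Proof.
by move=> /rat_in_itvoo[q]; rewrite in_itv/= => /andP[? ?]; exists q.
Qed.

(* If f has slopes below -c arbitrarily close to each point of E, Vitali's
   theorem covers E by disjoint intervals along which f decreases at rate c. *)
Lemma vitali_slope f (T : R -> R -> R) a b c (E : set R) : a < b -> 0 < c ->
  (forall x y z, a <= x -> x <= y -> y <= z -> z <= b -> T x z = T x y + T y z) ->
  (forall x y, a <= x -> x <= y -> y <= b -> `|f y - f x| <= T x y) ->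
  (forall x : R, a < x -> x < b -> f y @[y --> x] --> f x) ->
  (forall x, E x -> a < x /\ x < b) ->
  (forall x, E x -> forall e : R, 0 < e -> exists s : R, [/\ s != x, `|s - x| < e
      & (f s - f x) / (s - x) < - c]) ->
  ((2 * c)%:E * mu E <= (T a b - (f b - f a))%:E)%E.
Proof.
move=> ab c0 TD Tge fc EI Eslope.
(* Candidate intervals are indexed by nat through pairs of rationals. A number coding no pair gives
   (0, 0), which [ok] rejects; [xc] and [rr] then fall back to a ball of radius 1, so that every
   radius is positive. *)
pose uv (n : nat) : R * R :=
  if unpickle n is Some (p, q) then (ratr p, ratr q) : R * R else (0, 0).
pose ok n := (uv n).1 < (uv n).2.
pose xc n := if ok n then ((uv n).1 + (uv n).2) / 2 else 0.
pose rr n := if ok n then ((uv n).2 - (uv n).1) / 2 else 1.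
pose B n : set R := ball (xc n) (rr n).
have rr0 n : 0 < rr n.
  by rewrite /rr; case: ifPn => [|//]; rewrite /ok => h; rewrite divr_gt0// subr_gt0.
have B0 n : 0 < (radius (B n))%:num by rewrite /B radius_ball_num// ltW.
have Bb n : is_ball (B n) by exact: is_ball_ball.
pose V : set nat := [set n | [/\ ok n, a < (uv n).1, (uv n).2 < b
   & f (uv n).2 - f (uv n).1 < - c * ((uv n).2 - (uv n).1)]].
have VC : vitali_cover E B V.
  split => // x Ex e e0.
  (* A slope below - c means that psi decreases strictly between s and x. By continuity this
     survives moving both end points slightly outwards to rationals. *)
  pose psi t := f t + c * t.
  have psic t : a < t -> t < b -> psi y @[y --> t] --> psi t.
    by move=> ta tb; apply: cvgD; [exact: fc|apply: cvgMr; exact: cvg_id].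
  have [ax xb] := EI x Ex.
  have e1 : 0 < Num.min e (Num.min (x - a) (b - x)).
    by rewrite !lt_min e0 !subr_gt0 ax xb.
  have [s [sx]] := Eslope x Ex _ e1.
  rewrite !lt_min => /and3P[sxe sxa sxb] slope.
  have [p [q [pq psipq pa qb [pxq qpe]]]] : exists p q : R, [/\ p < q, psi q < psi p,
      a < p, q < b & p <= x <= q /\ q - p < e].
    move: slope sxe sxa sxb; have [sltx|xlts|sE] := ltgtP s x; last by rewrite sE eqxx in sx.
      rewrite ltr_ndivrMr ?subr_lt0// ltr0_norm ?subr_lt0// /psi => *.
      exists s, x; split=> //; [lra|lra|split; [by rewrite ltW ?lexx|lra]].
    rewrite ltr_pdivrMr ?subr_gt0// gtr0_norm ?subr_gt0// /psi => *.
    exists x, s; split=> //; [lra|lra|split; [by rewrite lexx ltW|lra]].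
  pose mid := (psi p + psi q) / 2.
  have /cvgrPdist_lt /(_ ((psi p - psi q) / 2)) := psic p pa (lt_trans pq qb).
  rewrite divr_gt0 ?subr_gt0// => /(_ isT) /nbhs_ballP[d1 d10 D1].
  have /cvgrPdist_lt /(_ ((psi p - psi q) / 2)) := psic q (lt_trans pa pq) qb.
  rewrite divr_gt0 ?subr_gt0// => /(_ isT) /nbhs_ballP[d2 d20 D2].
  have [pu [pu1 pu2]] : exists r : rat,
      Num.max (p - d1) (Num.max a (p - (e - (q - p)) / 2)) < ratr r /\ ratr r < p.
    apply: rat_between; rewrite !gt_max pa /= ltrBlDr ltrDl d10 /=.
    rewrite ltrBlDr ltrDl divr_gt0 ?subr_gt0//.
  have [qv [qv1 qv2]] : exists r : rat,
      q < ratr r /\ ratr r < Num.min (q + d2) (Num.min b (q + (e - (q - p)) / 2)).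
    apply: rat_between; rewrite !lt_min qb /= ltrDl d20 /=.
    rewrite ltrDl divr_gt0 ?subr_gt0//.
  move: pu1; rewrite !gt_max => /and3P[pu1 apu pue].
  move: qv2; rewrite !lt_min => /and3P[qv2 qvb qve].
  have uvE : uv (pickle (pu, qv)) = (ratr pu, ratr qv) by rewrite /uv pickleK.
  have okn : ok (pickle (pu, qv)).
    by rewrite /ok uvE/= (lt_trans pu2)// (lt_trans pq).
  exists (pickle (pu, qv)).
  case/andP: pxq => px xq.
  split.
  - split=> //; rewrite uvE//=.
    have := D1 (ratr pu); rewrite /ball/= ltr_distl => /(_ ltac:(lra)).
    have := D2 (ratr qv); rewrite /ball/= ltr_distl => /(_ ltac:(lra)).
    by rewrite !ltr_distl /psi; lra.
  - rewrite /B /ball/= /xc /rr okn uvE/= ltr_distl; lra.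
  - rewrite /B radius_ball_num; last exact: ltW.
    rewrite /rr okn uvE/=; lra.
have [D [cD DV tD muED]] := vitali_theorem B0 VC.
have clB n : D n -> closure (B n) = `[(uv n).1, (uv n).2]%classic.
  move=> /DV[okn _ _ _].
  rewrite /B closure_ballE closed_ball_itv//.
  have -> : xc n - rr n = (uv n).1 by rewrite /xc /rr okn; lra.
  by have -> : xc n + rr n = (uv n).2 by rewrite /xc /rr okn; lra.
pose F n := if n \in D then closure (B n) else set0.
have mF n : measurable (F n).
  by rewrite /F; case: ifPn => // /set_mem /clB ->.
have muF : (mu E <= \sum_(0 <= n <oo) mu (F n))%E.
  have := le_outer_measure ((wlength idfun)^*)%mu E
     ((E `\` \bigcup_(k in D) closure (B k)) `|` \bigcup_n F n) => /= HH.
  apply: le_trans (HH _) _.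
    move=> x Ex; case: (pselect ((\bigcup_(k in D) closure (B k)) x)) => [[k Dk kx]|h].
      by right; exists k => //; rewrite /F mem_set.
    by left.
  apply: le_trans (outer_measureU2 _ _ _) _ => /=.
  rewrite [X in (X + _ <= _)%E](_ : _ = 0%E) ?add0e; last exact: muED.
  exact: outer_measure_sigma_subadditive.
(* Finitely many of the disjoint intervals form a family for [variation_disjoint_family], and along
   each of them the increment is at most - c times the length. *)
have fin N : ((2 * c)%:E * \sum_(0 <= n < N) mu (F n) <= (T a b - (f b - f a))%:E)%E.
  rewrite [X in (_ * X)%E](_ : _ = (\sum_(n <- [seq n <- index_iota 0 N | n \in D])
            ((uv n).2 - (uv n).1))%:E); last first.
    rewrite big_filter -sumEFin [RHS]big_mkcond/=; apply: eq_bigr => n _.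
    rewrite /F; case: ifPn => [|_]; last by rewrite measure0.
    move=> /set_mem Dn; rewrite clB//.
    have [okn _ _ _] := DV _ Dn.
    by rewrite lebesgue_measure_itv/= lte_fin; move: okn; rewrite /ok => ->.
  set s := [seq n <- _ | _].
  have us : uniq s by rewrite filter_uniq// iota_uniq.
  have Ds n : n \in s -> D n by rewrite mem_filter => /andP[/set_mem].
  have := @variation_disjoint_family f T a b TD Tge (map uv s) (ltW ab).
  rewrite big_map => H; rewrite -EFinM lee_fin.
  have {}H : f b - f a <= T a b + 2 * \sum_(j <- s) (f (uv j).2 - f (uv j).1).
    apply: H.
      move=> _ /mapP[n /Ds Dn ->]; have [okn au vb _] := DV _ Dn.
      by split; apply: ltW.
    rewrite pairwise_map; apply: (@sub_in_pairwise _ (mem s) (fun n k => n != k)).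
    - move=> n k /Ds Dn /Ds Dk nk.
      have /(_ _ _ Dn Dk nk)/= := (trivIsetP (D := D) (F := closure \o B)).1 tD.
      rewrite (clB _ Dn) (clB _ Dk) => nk0.
      have [on _ _ _] := DV _ Dn; have [ok' _ _ _] := DV _ Dk.
      rewrite leNgt; case: ltP => //= h1; rewrite leNgt; apply/negP => h2.
      suff : set0 (Num.max (uv n).1 (uv k).1) by [].
      rewrite -nk0; split; rewrite /= in_itv/= le_max lexx ?orbT/= ge_max.
        by rewrite (ltW on) ltW.
      by rewrite (ltW ok') ltW.
    - by apply/allP.
    - by rewrite -uniq_pairwise.
  have : \sum_(j <- s) (f (uv j).2 - f (uv j).1) <=
         - c * \sum_(n <- s) ((uv n).2 - (uv n).1).
    rewrite big_distrr/= !big_seq; apply: ler_sum => n /Ds Dn.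
    by have [_ _ _ /ltW] := DV _ Dn.
  by move: H; set S1 := \sum_(_ <- _) _; set S2 := \sum_(_ <- _) _; lra.
have c20 : 0 < 2 * c by rewrite mulr_gt0.
rewrite muleC -lee_pdivlMr//; apply: le_trans muF _.
apply: lime_le.
  by apply: is_cvg_nneseries => n _ _.
by near=> N; rewrite lee_pdivlMr// muleC.
Unshelve. all: by end_near. Qed.


Lemma abs_contI_lin r f g : abs_contI f -> abs_contI g ->
  abs_contI (fun t => r * f t + g t).
Proof.
move=> fac gac e e0.
have r0 : 0 < `|r| + 1 by rewrite ltr_wpDl.
have [d1 d10 H1] := fac (e / 2 / (`|r| + 1)) ltac:(by rewrite !divr_gt0).
have [d2 d20 H2] := gac (e / 2) ltac:(by rewrite divr_gt0).
exists (Num.min d1 d2); first by rewrite lt_min d10.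
move=> N p pI pd; rewrite lt_min => /andP[/(H1 _ _ pI pd) h1 /(H2 _ _ pI pd) h2].
apply: (@le_lt_trans _ _ (\sum_(i < N) (`|r| * `|f (p i).2 - f (p i).1| +
    `|g (p i).2 - g (p i).1|))).
  apply: ler_sum => i _; rewrite -normrM; apply: le_trans (ler_normD _ _).
  by rewrite le_eqVlt; apply/orP; left; apply/eqP; congr `| _ |; ring.
rewrite big_split/= -big_distrr/=.
move: h1; rewrite ltr_pdivlMr//; move: h2.
have : 0 <= \sum_(i < N) `|f (p i).2 - f (p i).1| by rewrite sumr_ge0.
set S1 := \sum_(_ < _) _; set S2 := \sum_(_ < _) _; rewrite mulrDr mulr1; lra.
Qed.

Section AcTV.
Variables (f : R -> R) (fac : abs_contI f).
Let T x y := fine (TV x y f).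

Let TVfin x y : 0 <= x -> x <= y -> y <= 1 -> TV x y f \is a fin_num.
Proof.
move=> x0 xy y1; rewrite ge0_fin_numE ?total_variation_ge0//.
apply: le_lt_trans (abs_contI_TV fac).
rewrite (total_variationD f x0 (le_trans xy y1)) (total_variationD f xy y1).
rewrite addeCA leeDl// adde_ge0// total_variation_ge0//.
Qed.

Lemma acTVD x y z : 0 <= x -> x <= y -> y <= z -> z <= 1 -> T x z = T x y + T y z.
Proof.
move=> x0 xy yz z1; rewrite /T (total_variationD f xy yz) fineD//; apply: TVfin => //.
  by rewrite (le_trans yz).
by rewrite (le_trans x0).
Qed.

Lemma acTV_ge x y : 0 <= x -> x <= y -> y <= 1 -> `|f y - f x| <= T x y.
Proof.
by move=> x0 xy y1; rewrite -lee_fin fineK ?TVfin// total_variation_ge.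
Qed.

Let low (t c : R) := forall e : R, 0 < e -> exists s : R,
  [/\ s != t, `|s - t| < e & (f s - f t) / (s - t) < - c].
Let high (t c : R) := forall e : R, 0 < e -> exists s : R,
  [/\ s != t, `|s - t| < e & c < (f s - f t) / (s - t)].

Lemma ac_low (E : set R) a b c : 0 <= a -> a < b -> b <= 1 -> 0 < c ->
  (forall t, E t -> [/\ a < t, t < b & low t c]) ->
  ((2 * c)%:E * mu E <= (T a b - (f b - f a))%:E)%E.
Proof.
move=> a0 ab b1 c0 H; apply: vitali_slope => //.
- by move=> x y z ax xy yz zb; apply: acTVD => //; lra.
- by move=> x y ax xy yb; apply: acTV_ge => //; lra.
- by move=> x ax xb; apply: abs_contI_continuous => //; lra.
- by move=> x /H[].
- by move=> x /H[].
Qed.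

Lemma ac_high (E : set R) a b c : 0 <= a -> a < b -> b <= 1 -> 0 < c ->
  (forall t, E t -> [/\ a < t, t < b & high t c]) ->
  ((2 * c)%:E * mu E <= (T a b + (f b - f a))%:E)%E.
Proof.
move=> a0 ab b1 c0 H.
have -> : T a b + (f b - f a) = T a b - (- f b - - f a) by ring.
apply: (@vitali_slope (fun x => - f x)) => //.
- by move=> x y z ax xy yz zb; apply: acTVD => //; lra.
- move=> x y ax xy yb; rewrite -opprD normrN; apply: acTV_ge => //; lra.
- by move=> x ax xb; apply: cvgN; apply: abs_contI_continuous => //; lra.
- by move=> x /H[].
- move=> x /H[_ _ xh] e /xh[s [sx se se']]; exists s; split => //.
  by rewrite -opprD mulNr ltrN2.
Qed.

(** On each interval, [ac_low] and [ac_high] together give |f b - f a| + 2 c mu(E in ]a, b[) <= T a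
    b. Adding over a partition, every variation of f on [0, 1] is at most T 0 1 - 2 c mu E. As T 0 1
    is the supremum of these variations, mu E = 0. *)
Lemma ac_low_high (E : set R) c : 0 < c ->
  (forall t, E t -> [/\ 0 < t, t < 1, low t c & high t c]) -> mu E = 0%E.
Proof.
move=> c0 H.
pose e x y := mu (E `&` `]x, y[%classic).
have efin x y : e x y \is a fin_num.
  rewrite ge0_fin_numE//; apply: (@le_lt_trans _ _ (mu `]x, y[%classic)).
    by apply: (le_outer_measure ((wlength idfun)^*)%mu); exact: subIsetr.
  by rewrite lebesgue_measure_itv; case: ifPn => // _; rewrite ltry.
have piece a b : 0 <= a -> a < b -> b <= 1 ->
    `|f b - f a| + 2 * c * fine (e a b) <= T a b.
  move=> a0 ab b1.
  have h1 : ((2 * c)%:E * e a b <= (T a b - (f b - f a))%:E)%E.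
    apply: ac_low => // t [/H[t0 t1 lt ht]]; rewrite /= in_itv/= => /andP[? ?].
    by split.
  have h2 : ((2 * c)%:E * e a b <= (T a b + (f b - f a))%:E)%E.
    apply: ac_high => // t [/H[t0 t1 lt ht]]; rewrite /= in_itv/= => /andP[? ?].
    by split.
  move: h1 h2; rewrite -(fineK (efin a b)) -EFinM !lee_fin.
  by have [h|h] := ler0P (f b - f a); lra.
(* Subadditivity of the outer measure; the point x between the two open intervals is null. *)
have esplit a x b : a < x -> x < b -> fine (e a b) <= fine (e a x) + fine (e x b).
  move=> ax xb; rewrite -lee_fin EFinD !fineK//.
  have -> : (e a x + e x b = e a x + (mu [set x] + e x b))%E.
    by rewrite lebesgue_measure_set1 add0e.
  apply: le_trans (leeD2l _ (outer_measureU2 ((wlength idfun)^*)%mu _ _)).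
  apply: le_trans (outer_measureU2 ((wlength idfun)^*)%mu _ _).
  apply: (le_outer_measure ((wlength idfun)^*)%mu) => t [Et].
  rewrite /= in_itv/= => /andP[at_ tb].
  have [tx|xt|->] := ltgtP t x.
  - by left; split => //=; rewrite in_itv/= at_.
  - by right; right; split => //=; rewrite in_itv/= xt.
  - by right; left.
have var s a b : 0 <= a -> b <= 1 -> itv_partition a b s ->
    variation a b f s + 2 * c * fine (e a b) <= T a b.
  elim: s a => [|x s IH] a a0 b1.
    move=> /itv_partition_nil ab; rewrite variation_nil add0r -ab /e.
    by rewrite set_itvoo0 ?lexx// setI0 measure0 mulr0 /T total_variationxx.
  move=> /[dup] abs; have ax : a < x by case: abs => /= /andP[].
  have xb := itv_partition_le (itv_partition_cons abs).
  move=> /itv_partition_cons sxb.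
  rewrite -cat1s (variation_cat f (ltW ax) xb (itv_partition1 ax) sxb).
  rewrite (acTVD a0 (ltW ax) xb b1).
  have -> : variation a x f [:: x] = `|f x - f a|.
    by rewrite /variation/= big_nat1.
  have := IH x (le_trans a0 (ltW ax)) b1 sxb.
  have := piece a x a0 ax (le_trans xb b1).
  move: xb; rewrite le_eqVlt => /orP[/eqP xb|xb].
    have -> : fine (e x b) = 0 by rewrite xb /e set_itvoo0 ?lexx// setI0 measure0.
    by rewrite -xb; lra.
  have := esplit a x b ax xb.
  by move=> h; have := ler_wpM2l (ltW (mulr_gt0 (ltr0Sn R 1) c0)) h; lra.
have : (TV 0 1 f <= (T 0 1 - 2 * c * fine (e 0 1))%:E)%E.
  apply: ge_ereal_sup => _ [_ [s sab <-] <-]; rewrite lee_fin.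
  by have := var s 0 1 (lexx _) (lexx _) sab; lra.
rewrite -[X in (X <= _)%E]fineK ?TVfin// lee_fin => h.
have e0 : fine (e 0 1) <= 0.
  rewrite leNgt; apply/negP => h'; have := mulr_gt0 c0 h'.
  by move: h; rewrite /T; lra.
have -> : E = E `&` `]0, 1[%classic.
  apply/seteqP; split=> [t Et|t []//]; split => //=; have [? ? _ _] := H t Et.
  by rewrite in_itv/=; apply/andP.
apply/eqP; rewrite eq_le measure_ge0 andbT -[X in (X <= _)%E]fineK ?efin//.
Qed.

(** The bound 2 n.+1 mu E <= M holds with one finite M for all n. *)
Lemma ac_low_oo (E : set R) :
  (forall t, E t -> [/\ 0 < t, t < 1 & forall n : nat, low t n.+1%:R]) -> mu E = 0%E.
Proof.
move=> H; set M := T 0 1 - (f 1 - f 0).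
have K (n : nat) : ((2 * n.+1%:R)%:E * mu E <= M%:E)%E.
  apply: ac_low => //.
  by move=> t /H[? ? h]; split => //; exact: h.
apply/eqP; rewrite eq_le measure_ge0 andbT; apply/lee_addgt0Pr => e e0.
rewrite add0e.
have [n nM] : exists n : nat, M / e <= n.+1%:R.
  exists (Num.Def.archi_bound (`|M / e|)).
  rewrite (le_trans (ler_norm _))// ltW// (lt_trans (archi_boundP _))//.
  by rewrite ltr_nat.
have n0 : 0 < 2 * n.+1%:R :> R by rewrite mulr_gt0.
move: (K n); rewrite muleC -lee_pdivlMr// => /le_trans; apply.
rewrite lee_fin ler_pdivrMr//; move: nM; rewrite ler_pdivrMr//.
have : 0 <= M by rewrite subr_ge0 (le_trans (ler_norm _))// acTV_ge.
have : 0 < n.+1%:R * e by rewrite mulr_gt0.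
lra.
Qed.

End AcTV.

Lemma ac_high_oo f (fac : abs_contI f) (E : set R) :
  (forall t, E t -> [/\ 0 < t, t < 1 & forall n : nat, forall e : R, 0 < e ->
    exists s : R, [/\ s != t, `|s - t| < e & n.+1%:R < (f s - f t) / (s - t)]]) ->
  mu E = 0%E.
Proof.
(* - f is written as -2 f + f to fit [abs_contI_lin]; its slopes are unbounded below. *)
move=> H; have := abs_contI_lin (-2) fac fac => gac.
apply: (ac_low_oo gac) => t /H[t0 t1 h]; split => // n e /(h n)[s [sx se hs]].
exists s; split => //.
have -> : -2 * f s + f s - (-2 * f t + f t) = - (f s - f t) by ring.
by rewrite mulNr ltrN2.
Qed.

End AbsCont.

(** * Derivatives on the unit interval and the Sobolev form *)

Section DerivI.
Context {R : realType}.
Implicit Types (f g : R -> R) (t : R).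
Local Notation mu := (@lebesgue_measure R).
Local Notation I01 := (`[(0%R : R), (1%R : R)]%classic).

Lemma near_withinI t (P : R -> Prop) :
  (exists2 e : R, 0 < e & forall s, s \in `[0%R, 1%R] -> s != t -> `|s - t| < e -> P s)
  <-> \forall s \near within I01 t^', P s.
Proof.
split=> [[e e0 H]|].
  rewrite near_withinE; apply/nbhs_ballP; exists e => //= s ts st sI.
  by apply: H => //; rewrite distrC.
move=> /nbhs_ballP[e /= e0 H]; exists e => // s sI st se.
by apply: H => //; rewrite /ball/= distrC.
Qed.

Lemma point_nearI t (e : R) : t \in `[0%R, 1%R] -> 0 < e ->
  exists s, [/\ s \in `[0%R, 1%R], s != t & `|s - t| < e].
Proof.
rewrite in_itv/= => /andP[t0 t1] e0.
pose d := Num.min (e / 2) (1 / 4).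
have [d0 de d4] : [/\ 0 < d, d < e & d <= 1 / 4].
  split; first by rewrite lt_min !divr_gt0.
    by rewrite gt_min; apply/orP; left; lra.
  by rewrite ge_min lexx orbT.
have [h|h] := ltP t (1 / 2).
  exists (t + d); rewrite in_itv/= addrAC subrr add0r gtr0_norm//; split=> //.
    by apply/andP; split; lra.
  by rewrite gt_eqF// ltrDl.
exists (t - d); rewrite in_itv/= addrAC subrr add0r normrN gtr0_norm//; split=> //.
  by apply/andP; split; lra.
by rewrite lt_eqF// gtrDl oppr_lt0.
Qed.

Lemma within_I01_proper t : t \in `[0%R, 1%R] -> ProperFilter (within I01 t^').
Proof.
move=> tI; apply: Build_ProperFilter_ex => // P /near_withinI[e e0 H].
by have [s [sI st se]] := point_nearI tI e0; exists s; exact: H.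
Qed.

Lemma cvg_quotIP f t (l : R) : quotI f t s @[s --> within I01 t^'] --> l <->
  forall e : R, 0 < e -> exists2 d : R, 0 < d & forall s, s \in `[0%R, 1%R] ->
     s != t -> `|s - t| < d -> `|l - quotI f t s| < e.
Proof.
split=> [/cvgrPdist_lt H e e0|H]; first by have /near_withinI := H e e0.
by apply/cvgrPdist_lt => e /H/near_withinI.
Qed.

(** Cauchy's criterion eliminates the unknown limit. What remains can be tested at rational points,
    which makes the set of points of derivability measurable for continuous f. *)
Lemma derivableIP f t : t \in `[0%R, 1%R] ->
  derivableI f t <-> forall e : R, 0 < e -> exists2 d : R, 0 < d & forall p q,
    p \in `[0%R, 1%R] -> q \in `[0%R, 1%R] -> p != t -> q != t ->
    `|p - t| < d -> `|q - t| < d -> `|quotI f t p - quotI f t q| < e.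
Proof.
move=> tI; have FP := within_I01_proper tI; split.
  move=> /cvg_ex[/= l /cvg_quotIP H] e e0.
  have [d d0 Hd] := H (e / 2) ltac:(by rewrite divr_gt0).
  exists d => // p q pI qI pt qt pd qd.
  have := Hd p pI pt pd; have := Hd q qI qt qd.
  by rewrite !ltr_distl; lra.
move=> H; apply/cauchy_cvgP/cauchy_exP => e e0.
have [d d0 Hd] := H e e0.
have [p [pI pt pd]] := point_nearI tI d0.
exists (quotI f t p); apply/near_withinI; exists d => // q qI qt qd.
exact: Hd.
Qed.

Lemma derivI_eq f t (l : R) : t \in `[0%R, 1%R] ->
  quotI f t s @[s --> within I01 t^'] --> l -> derivI f t = l.
Proof. by move=> tI; have FP := within_I01_proper tI; exact: cvg_lim. Qed.

Lemma derivableI_cvg f t : derivableI f t ->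
  quotI f t s @[s --> within I01 t^'] --> derivI f t.
Proof. by []. Qed.

Lemma derivI_lin r f g t : t \in `[0%R, 1%R] -> derivableI f t -> derivableI g t ->
  derivableI (fun s => r * f s + g s) t /\
  derivI (fun s => r * f s + g s) t = r * derivI f t + derivI g t.
Proof.
move=> tI /derivableI_cvg df /derivableI_cvg dg.
have FP := within_I01_proper tI.
have H : quotI (fun s => r * f s + g s) t s @[s --> within I01 t^'] -->
         r * derivI f t + derivI g t.
  have -> : quotI (fun s => r * f s + g s) t =
            (fun s => r * quotI f t s + quotI g t s).
    by apply/funext => s; rewrite /quotI mulrA -mulrDl; congr (_ / _); ring.
  by apply: cvgD => //; apply: cvgMr.
by split; [apply/cvg_ex; exists (r * derivI f t + derivI g t)|exact: derivI_eq].
Qed.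

Lemma eq_quotI f g t : t \in `[0%R, 1%R] ->
  (forall s, s \in `[0%R, 1%R] -> f s = g s) ->
  quotI f t s @[s --> within I01 t^'] = quotI g t s @[s --> within I01 t^'].
Proof.
move=> tI fg; apply/seteqP; split=> A /near_withinI[e e0 H]; apply/near_withinI;
  exists e => // s sI st se; have := H s sI st se; rewrite /quotI/= !fg//.
Qed.

Lemma eq_derivableI f g t : t \in `[0%R, 1%R] ->
  (forall s, s \in `[0%R, 1%R] -> f s = g s) -> derivableI f t -> derivableI g t.
Proof. by move=> tI fg; rewrite /derivableI (eq_quotI tI fg). Qed.

Lemma eq_derivI f g t : t \in `[0%R, 1%R] ->
  (forall s, s \in `[0%R, 1%R] -> f s = g s) -> derivI f t = derivI g t.
Proof. by move=> tI fg; rewrite /derivI (eq_quotI tI fg). Qed.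

Lemma small_invn (e : R) : 0 < e -> exists n : nat, n.+1%:R^-1 < e.
Proof.
move=> e0; exists (Num.Def.archi_bound e^-1).
rewrite -[X in _ < X]invrK ltf_pV2 ?posrE ?invr_gt0//.
apply: lt_trans (archi_boundP _) _; first by rewrite invr_ge0 ltW.
by rewrite ltr_nat.
Qed.

(** The Vitali estimates bound the outer measure of sets not known to be measurable. Open supersets
    of small measure intersect in a measurable null set containing E. *)
Lemma outer_null_negligible (E : set R) : mu E = 0%E -> mu.-negligible E.
Proof.
move=> E0.
have /choice[U HU] : forall n : nat, exists U : set R,
    [/\ open U, E `<=` U & (mu U <= (n.+1%:R^-1)%:E)%E].
  move=> n; have [|U [oU EU le]] := @outer_measure_open_le R E n.+1%:R^-1.
    by rewrite invr_gt0.
  by exists U; split => //; apply: le_trans le _; rewrite [X in (X + _)%E]E0 add0e.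
have mU : measurable (\bigcap_n U n).
  by apply: bigcap_measurableType => n _; apply: open_measurable; case: (HU n).
exists (\bigcap_n U n); split=> //.
  apply/eqP; rewrite eq_le measure_ge0 andbT; apply/lee_addgt0Pr => e e0.
  have [n ne] := small_invn e0; have [oU EU le] := HU n.
  rewrite add0e (@le_trans _ _ (mu (U n)))//.
    by apply: le_measure; rewrite ?inE//; [exact: open_measurable|exact: bigcap_inf].
  by apply: le_trans le _; rewrite lee_fin ltW.
by move=> t Et n _; have [_ EU _] := HU n; exact: EU.
Qed.

Lemma abs_contI_id : abs_contI (@idfun R).
Proof.
move=> e e0; exists e => // N p pI _; apply: le_lt_trans.
by apply: ler_sum => i _; have [_ h _] := pI i; rewrite ger0_norm ?subr_ge0.
Qed.

(* If f is not derivable at t, its slopes at t are unbounded below, unbounded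
   above, or oscillate across some q -/+ 1/(k+1), q rational. *)
Lemma nderivableI_slopes f t : 0 < t -> t < 1 -> ~ derivableI f t ->
  let low c := forall e : R, 0 < e -> exists s : R,
    [/\ s != t, `|s - t| < e & (f s - f t) / (s - t) < c] in
  let high c := forall e : R, 0 < e -> exists s : R,
    [/\ s != t, `|s - t| < e & c < (f s - f t) / (s - t)] in
  [\/ forall n : nat, low (- n.+1%:R), forall n : nat, high n.+1%:R |
      exists (q : rat) (k : nat), low (ratr q - k.+1%:R^-1) /\
                                  high (ratr q + k.+1%:R^-1)].
Proof.
move=> t0 t1 nd low high.
have tI : t \in `[0%R, 1%R] by rewrite in_itv/= !ltW.
have [h|/existsNP[n nlow]] := pselect (forall n : nat, low (- n.+1%:R)).
  exact: Or31.
have [h|/existsNP[n' nhigh]] := pselect (forall n : nat, high n.+1%:R).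
  exact: Or32.
(* [ev P] says that the slopes at t eventually satisfy P; the failure of [low c] or of [high c] is
   such an eventual bound. *)
pose ev (P : R -> Prop) := exists2 e : R, 0 < e &
  forall s, s != t -> `|s - t| < e -> P ((f s - f t) / (s - t)).
have evI P Q : ev P -> ev Q -> ev (fun r => P r /\ Q r).
  move=> [e e0 He] [e' e'0 He']; exists (Num.min e e'); first by rewrite lt_min e0.
  by move=> s st; rewrite lt_min => /andP[? ?]; split; [exact: He|exact: He'].
have evW (P Q : R -> Prop) : (forall r, P r -> Q r) -> ev P -> ev Q.
  by move=> PQ [e e0 He]; exists e => // s *; apply: PQ; exact: He.
have ev_ex P : ev P -> exists r, P r.
  move=> [e e0 He]; exists ((f (t + e / 2) - f t) / (t + e / 2 - t)).
  apply: He; first by rewrite gt_eqF// ltrDl divr_gt0.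
  by rewrite addrC addKr gtr0_norm ?divr_gt0//; lra.
have nlow_ev c : ~ low c -> ev (fun r => c <= r).
  move=> /existsNP[e] /not_implyP[e0 He]; exists e => // s st se.
  by rewrite leNgt; apply/negP => h; apply: He; exists s.
have nhigh_ev c : ~ high c -> ev (fun r => r <= c).
  move=> /existsNP[e] /not_implyP[e0 He]; exists e => // s st se.
  by rewrite leNgt; apply/negP => h; apply: He; exists s.
have nev_low c : ~ ev (fun r => c <= r) -> low c.
  move=> h; have [//|/nlow_ev] := pselect (low c); by move=> /h.
(* The supremum L of the eventual lower bounds is the lower limit of the slopes, finite because they
   are eventually bounded on both sides. *)
pose S := [set r | ev (fun x => r <= x)].
have hS : has_sup S.
  split; first by exists (- n.+1%:R); exact: nlow_ev.
  exists n'.+1%:R => r rS.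
  have [x [rx xn]] := ev_ex _ (evI _ _ rS (nhigh_ev _ nhigh)).
  exact: le_trans rx xn.
pose L := sup S.
have [e e0 nev] : exists2 e : R, 0 < e & ~ ev (fun x => `|L - x| < e).
  apply: contrapT => /forall2NP H; apply: nd; apply/derivableIP => // e e0.
  have [//|/contrapT] := H (e / 2); first by move=> []; rewrite divr_gt0.
  move=> [d d0 Hd]; exists d => // p q pI qI pt qt pd qd.
  have := Hd p pt pd; have := Hd q qt qd; rewrite /quotI.
  by rewrite !ltr_distl; lra.
have evL : ev (fun x => L - e / 2 <= x).
  have [r rS rL] := sup_adherent (divr_gt0 e0 (ltr0Sn R 1)) hS.
  by apply: evW rS => x; apply: le_trans; exact: ltW.
(* The slopes eventually exceed L - e / 2 without staying within e of L, so they exceed L + e / 2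
   arbitrarily close to t; by the choice of L they also fall below L + e / 4. The rational q
   separates the two levels with a margin of e / 16 on either side. *)
have highL : high (L + e / 2).
  have [//|/nhigh_ev h] := pselect (high (L + e / 2)).
  exfalso; apply: nev; apply: evW (evI _ _ evL h) => x [? ?].
  by rewrite ltr_distl; lra.
have lowL : low (L + e / 4).
  apply: nev_low => h; have := sup_upper_bound hS h; rewrite -/L; lra.
have [q [q1 q2]] : exists q : rat, L + e / 4 + e / 16 < ratr q /\
    ratr q < L + e / 2 - e / 16 by apply: rat_between; lra.
have [k ke] : exists k : nat, k.+1%:R^-1 < e / 16 by apply: small_invn; rewrite divr_gt0.
apply: Or33; exists q, k; move: (ratr q : R) q1 q2 (k.+1%:R^-1 : R) ke => r q1 q2 iv ke; split.
  move=> d /lowL[s [st sd h]]; exists s; split => //; lra.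
by move=> d /highL[s [st sd h]]; exists s; split => //; lra.
Qed.

(** The exceptional points fall into the three classes of [nderivableI_slopes], the last one a
    countable union over (q, k). Subtracting q t from f turns an oscillation of the slopes around q
    into one around 0, where [ac_low_high] applies. The two end points are added as null sets. *)
Lemma abs_contI_derivable_ae f : abs_contI f ->
  mu.-negligible [set t | t \in `[0%R, 1%R] /\ ~ derivableI f t].
Proof.
move=> fac.
pose low t c := forall e : R, 0 < e -> exists s : R,
    [/\ s != t, `|s - t| < e & (f s - f t) / (s - t) < c].
pose high t c := forall e : R, 0 < e -> exists s : R,
    [/\ s != t, `|s - t| < e & c < (f s - f t) / (s - t)].
pose E1 := [set t | [/\ 0 < t, t < 1 & forall n : nat, low t (- n.+1%:R)]].
pose E2 := [set t | [/\ 0 < t, t < 1 & forall n : nat, high t n.+1%:R]].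
pose E3 (q : rat) (k : nat) := [set t | [/\ 0 < t, t < 1,
  low t (ratr q - k.+1%:R^-1) & high t (ratr q + k.+1%:R^-1)]].
pose E4 n := if unpickle n is Some (q, k) then E3 q k else set0.
have n1 : mu.-negligible E1 by apply/outer_null_negligible/(ac_low_oo fac).
have n2 : mu.-negligible E2 by apply/outer_null_negligible/(ac_high_oo fac).
have n3 : mu.-negligible (\bigcup_n E4 n).
  apply: negligible_bigcup => n; rewrite /E4.
  case: unpickle => [[q k]|]; last exact: negligible_set0.
  apply: outer_null_negligible.
  have gac := abs_contI_lin (- ratr q) abs_contI_id fac.
  have sl s t : s != t -> (- ratr q * s + f s - (- ratr q * t + f t)) / (s - t) =
      (f s - f t) / (s - t) - ratr q.
    by rewrite -subr_eq0 => st; field.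
  apply: (@ac_low_high _ _ gac _ k.+1%:R^-1); first by rewrite invr_gt0.
  move=> t [t0 t1 lt ht]; split=> // e.
    by move=> /lt[s [st se h]]; exists s; split=> //; rewrite sl// ltrBlDr [_ + ratr q]addrC.
  by move=> /ht[s [st se h]]; exists s; split=> //; rewrite sl// ltrBrDr [_ + ratr q]addrC.
have n4 : mu.-negligible ([set 0 : R] `|` [set 1 : R]).
  apply: negligibleU; apply: outer_null_negligible; exact: lebesgue_measure_set1.
apply: negligibleS (negligibleU (negligibleU n1 n2) (negligibleU n3 n4)).
move=> t []; rewrite /= in_itv/= !le_eqVlt => /andP[/orP[/eqP<-|t0]].
  by move=> _ _; right; right; left.
move=> /orP[/eqP->|t1]; first by move=> _; right; right; right.
move=> /(nderivableI_slopes t0 t1)[h|h|[q [k [h1 h2]]]].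
- by left; left; split.
- by left; right; split.
- right; left; exists (pickle (q, k)); first exact: I.
  by rewrite /E4 pickleK; split.
Qed.

(** The retraction of the line onto [0, 1]: for absolutely continuous f, [f \o clampI] is continuous
    on all of R and has the same [derivI] on [0, 1]. *)
Definition clampI (x : R) : R := Num.max 0 (Num.min 1 x).

Lemma clampI_in x : clampI x \in `[0%R, 1%R].
Proof.
rewrite in_itv/= /clampI le_max lexx /= ge_max ler01 /=.
by rewrite ge_min lexx.
Qed.

Lemma clampI_id x : x \in `[0%R, 1%R] -> clampI x = x.
Proof.
rewrite in_itv/= => /andP[x0 x1]; rewrite /clampI.
by rewrite (min_idPr _)// (max_idPr _).
Qed.

Lemma clampI_cases x :
  [\/ x <= 0 /\ clampI x = 0, [/\ 0 <= x, x <= 1 & clampI x = x] | 1 <= x /\ clampI x = 1].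
Proof.
have [x0|x0] := leP x 0.
  by apply: Or31; split=> //; rewrite /clampI (max_idPl _)// ge_min x0 orbT.
have [x1|x1] := leP x 1.
  by apply: Or32; rewrite clampI_id ?in_itv/= ?x1 ?andbT ltW.
by apply: Or33; split; [exact: ltW|rewrite /clampI (min_idPl (ltW x1)) (max_idPr ler01)].
Qed.

Lemma clampI_lipschitz x y : `|clampI x - clampI y| <= `|x - y|.
Proof.
have := ler_norm (x - y); have := ler_norm (y - x); rewrite [in X in X -> _]distrC.
rewrite [in X in _ -> _ -> X]ler_norml.
by case: (clampI_cases x) => [[? ->]|[? ? ->]|[? ->]];
  case: (clampI_cases y) => [[? ->]|[? ? ->]|[? ->]]; lra.
Qed.

Lemma abs_contI_clamp f : abs_contI f -> continuous (f \o clampI).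
Proof.
move=> /abs_contI_cont fc x; apply/cvgrPdist_lt => e /fc[d d0 Hd].
apply/nbhs_ballP; exists d => //= y; rewrite /ball/= => xy.
apply: Hd; [exact: clampI_in|exact: clampI_in|].
exact: le_lt_trans (clampI_lipschitz _ _) xy.
Qed.

Lemma rat_dense_ge0 (phi : R -> R) t d : continuous phi -> t \in `[0%R, 1%R] ->
  (forall p : rat, (ratr p : R) \in `[0%R, 1%R] -> `|ratr p - t| < d -> 0 <= phi (ratr p)) ->
  forall p : R, p \in `[0%R, 1%R] -> `|p - t| < d -> 0 <= phi p.
Proof.
move=> phic; rewrite in_itv/= => /andP[t0 t1] H p.
rewrite in_itv/= => /andP[p0 p1] ptd; rewrite leNgt; apply/negP => phip.
have /cvgrPdist_lt/(_ (- phi p)) := phic p.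
rewrite oppr_gt0 => /(_ phip)/nbhs_ballP[r /= r0 Hr].
have d0 : 0 < d by apply: le_lt_trans ptd.
move: ptd; rewrite ltr_distl => /andP[ptd1 ptd2].
have [q [q1 q2]] : exists q : rat,
    Num.max (p - r) (Num.max 0 (t - d)) < ratr q /\
    ratr q < Num.min (p + r) (Num.min 1 (t + d)).
  by apply: rat_between; rewrite !lt_min !gt_max; apply/and3P; split; apply/and3P; split; lra.
move: q1 q2; rewrite !lt_min !gt_max => /and3P[q1 q2 q3] /and3P[q4 q5 q6].
have := H q; rewrite in_itv/= (ltW q2) (ltW q5) => /(_ isT).
rewrite ltr_distl q3 q6 => /(_ isT) h.
have := Hr (ratr q); rewrite /ball/= distrC ltr_distl q1 q4 => /(_ isT).
by rewrite ltr_distl; lra.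
Qed.

(** * Measurability of the derivative *)

Section MeasurableDeriv.
Variable (f : R -> R).
Hypothesis fc : continuous f.

(** Cauchy's criterion for the slopes at t, multiplied out. Without division it is continuous in p
    and q and measurable in t, and it holds trivially (M = 0) when p or q equals t; it can therefore
    be tested on all rational p and q. *)
Let M (c p q t : R) : R := c * (`|p - t| * `|q - t|) -
  `|(f p - f t) * (q - t) - (f q - f t) * (p - t)|.

Let M_quot c p q t : p != t -> q != t ->
  (0 <= M c p q t) = (`|quotI f t p - quotI f t q| <= c).
Proof.
move=> pt qt; rewrite /M subr_ge0.
have pt0 : p - t != 0 by rewrite subr_eq0.
have qt0 : q - t != 0 by rewrite subr_eq0.
have -> : (f p - f t) * (q - t) - (f q - f t) * (p - t) =
    (quotI f t p - quotI f t q) * ((p - t) * (q - t)).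
  by rewrite /quotI; field; rewrite pt0 qt0.
by rewrite normrM [`|(p - t) * _|]normrM ler_pM2r// mulr_gt0// normr_gt0.
Qed.

Let M_cont (c q t : R) : continuous (fun p => M c p q t).
Proof.
move=> p; apply: cvgB.
  apply: cvgMr; apply: cvgMl; apply: cvg_norm; apply: cvgB; [exact: cvg_id|exact: cvg_cst].
apply: cvg_norm; apply: cvgB.
  by apply: cvgMl; apply: cvgB; [exact: fc|exact: cvg_cst].
by apply: cvgMr; apply: cvgB; [exact: cvg_id|exact: cvg_cst].
Qed.

Let M_sym c p q t : M c p q t = M c q p t.
Proof. by rewrite /M [`|p - t| * _]mulrC [X in _ - X = _]distrC. Qed.

Let Dset (k j : nat) : set R := [set t | forall p q : rat,
  (ratr p : R) \in `[0%R, 1%R] -> (ratr q : R) \in `[0%R, 1%R] ->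
  `|ratr p - t| < j.+1%:R^-1 -> `|ratr q - t| < j.+1%:R^-1 ->
  0 <= M k.+1%:R^-1 (ratr p) (ratr q) t].

Let derivable_Dset t : t \in `[0%R, 1%R] ->
  derivableI f t <-> forall k, exists j, Dset k j t.
Proof.
move=> tI; split.
  move=> /(derivableIP _ tI) H k.
  have [d d0 Hd] := H k.+1%:R^-1 ltac:(by rewrite invr_gt0).
  have [j jd] := small_invn d0; exists j => p q pI qI pj qj.
  have [pt|pt] := eqVneq (ratr p : R) t.
    by rewrite /M pt !subrr normr0 !(mul0r, mulr0) subr0 normr0 subr0.
  have [qt|qt] := eqVneq (ratr q : R) t.
    by rewrite /M qt !subrr normr0 !(mul0r, mulr0) subr0 normr0 subr0.
  rewrite M_quot//; apply/ltW/Hd => //; exact: lt_trans jd.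
move=> H; apply/(derivableIP _ tI) => e e0.
have [k ke] := small_invn e0; have [j Dj] := H k.
exists j.+1%:R^-1; first by rewrite invr_gt0.
move=> p q pI qI pt qt pj qj; apply: le_lt_trans ke; rewrite -M_quot//.
apply: (@rat_dense_ge0 (fun p => M k.+1%:R^-1 p q t) t _ (@M_cont _ _ _) tI _ p pI pj).
move=> p' p'I p'j; rewrite M_sym.
apply: (@rat_dense_ge0 (fun q => M k.+1%:R^-1 q (ratr p') t) t _ (@M_cont _ _ _) tI _ q qI qj).
by move=> q' q'I q'j; rewrite M_sym; exact: Dj.
Qed.

Let mf : measurable_fun setT f.
Proof. exact: continuous_measurable_fun. Qed.

Let mDset k j : measurable (Dset k j).
Proof.
have -> : Dset k j = \bigcap_(pq in [set: rat * rat])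
   ([set t | (ratr pq.1 : R) \in `[0%R, 1%R] -> (ratr pq.2 : R) \in `[0%R, 1%R] ->
  `|ratr pq.1 - t| < j.+1%:R^-1 -> `|ratr pq.2 - t| < j.+1%:R^-1 ->
  0 <= M k.+1%:R^-1 (ratr pq.1) (ratr pq.2) t]).
  apply/seteqP; split=> [t Dt [p q] _ /=|t Dt p q]; first exact: Dt.
  exact: (Dt (p, q) I).
rewrite -[X in measurable X]setCK setC_bigcap; apply: measurableC.
apply: countable_bigcupT_measurable; first exact: countableP.
move=> [p q]; apply: measurableC => /=.
have [pI|pI] := boolP ((ratr p : R) \in `[0%R, 1%R]); last first.
  by rewrite [X in measurable X](_ : _ = setT)//; apply/seteqP; split.
have [qI|qI] := boolP ((ratr q : R) \in `[0%R, 1%R]); last first.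
  by rewrite [X in measurable X](_ : _ = setT)//; apply/seteqP; split.
have md (r : R) : measurable_fun setT (fun t => r - t : R).
  by apply: measurable_funB; [exact: measurable_cst|exact: measurable_id].
have mdn (r : R) : measurable_fun setT (fun t => `|r - t| : R).
  exact: measurableT_comp (md r).
have mM : measurable_fun setT (M k.+1%:R^-1 (ratr p) (ratr q)).
  apply: measurable_funB.
    by apply: measurable_funM; [exact: measurable_cst|exact: measurable_funM].
  apply: measurableT_comp => //; apply: measurable_funB; apply: measurable_funM => //;
    by apply: measurable_funB => //; exact: measurable_cst.
rewrite [X in measurable X](_ : _ = (setT `&` [set t | j.+1%:R^-1 <= `|ratr p - t|]) `|`
   (setT `&` [set t | j.+1%:R^-1 <= `|ratr q - t|]) `|`
   (setT `&` [set t | 0 <= M k.+1%:R^-1 (ratr p) (ratr q) t])); last first.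
  rewrite !setTI; apply/seteqP; split=> t /=.
    move=> H; case: (leP j.+1%:R^-1 `|ratr p - t|) => [?|h1]; first by left; left.
    case: (leP j.+1%:R^-1 `|ratr q - t|) => [?|h2]; first by left; right.
    by right; exact: H.
  by move=> [[h|h]|h] _ _; rewrite ltNge ?h// => _; rewrite ltNge ?h.
by apply: measurableU; [apply: measurableU|]; apply: measurable_fun_le => //;
  exact: measurable_cst.
Qed.

Lemma measurable_derivI_cont : measurable_fun I01 (derivI f).
Proof.
pose D : set R := \bigcap_k \bigcup_j Dset k j.
have mD : measurable D.
  by apply: bigcapT_measurable => k; apply: bigcupT_measurable => j; exact: mDset.
have DE t : t \in `[0%R, 1%R] -> D t <-> derivableI f t.
  move=> tI; rewrite (derivable_Dset tI); split=> [Dt k|H k _].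
    by have [j _ h] := Dt k I; exists j.
  by have [j h] := H k; exists j.
have mI : measurable (`[(0%R : R), (1%R : R)[%classic : set R) by [].
have -> : (I01 : set R) = ((`[0%R, 1%R[%classic `&` D) `|` (`[0%R, 1%R[%classic `\` D))
     `|` [set 1].
  by rewrite setUIDK setUitv1// bnd_simp.
apply/measurable_funU => //.
  by apply: measurableU; [exact: measurableI|exact: measurableD].
split; last exact: measurable_fun_set1.
apply/measurable_funU; [exact: measurableI|exact: measurableD|split].
  (* At points of derivability in [0, 1[ the derivative is the limit of forward quotients. The point
     1, where these leave the interval, has been split off as a singleton. *)
  pose s (n : nat) (t : R) := t + n.+1%:R^-1.
  have ms n : measurable_fun setT (s n).
    by apply: measurable_funD; [exact: measurable_id|exact: measurable_cst].
  apply: (@measurable_fun_cvg _ _ _ _ (fun n t => (f (s n t) - f t) * n.+1%:R)).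
    move=> n; apply: measurable_funTS; apply: measurable_funM; last exact: measurable_cst.
    by apply: measurable_funB => //; apply: measurableT_comp (ms n).
  move=> t []; rewrite /= in_itv/= => /andP[t0 t1] Dt.
  have tI : t \in `[0%R, 1%R] by rewrite in_itv/= t0 ltW.
  have /cvg_quotIP H := derivableI_cvg ((DE t tI).1 Dt).
  apply/cvgrPdist_lt => e e0; have [d d0 Hd] := H e e0.
  have [N] : exists n : nat, n.+1%:R^-1 < Num.min d (1 - t).
    by apply: small_invn; rewrite lt_min d0 subr_gt0.
  rewrite lt_min => /andP[Nd Nt].
  exists N => // n /= Nn.
  have u0 : 0 < n.+1%:R^-1 :> R by rewrite invr_gt0.
  have uN : n.+1%:R^-1 <= N.+1%:R^-1 :> R by rewrite lef_pV2 ?posrE// ler_nat.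
  have st : s n t - t = n.+1%:R^-1 by rewrite /s addrAC subrr add0r.
  have -> : (f (s n t) - f t) * n.+1%:R = quotI f t (s n t).
    by rewrite /quotI st invrK.
  apply: Hd.
  - rewrite in_itv/= /s addr_ge0 ?(ltW u0)//= -lerBrDl.
    exact: ltW (le_lt_trans uN Nt).
  - by rewrite -subr_eq0 st gt_eqF.
  - by rewrite st gtr0_norm//; exact: le_lt_trans uN Nd.
(* Where the quotients do not converge, [lim] returns the default [point], a constant. *)
apply: (@eq_measurable_fun _ _ _ _ _ (fun=> point : R)); last exact: measurable_cst.
move=> t /set_mem[]; rewrite /= in_itv/= => /andP[t0 t1] nDt.
have tI : t \in `[0%R, 1%R] by rewrite in_itv/= t0 ltW.
by rewrite /derivI dvgP// => /(DE t tI).2.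
Qed.
End MeasurableDeriv.

Lemma measurable_derivI f : abs_contI f -> measurable_fun I01 (derivI f).
Proof.
move=> fac; apply: eq_measurable_fun (measurable_derivI_cont (abs_contI_clamp fac)).
move=> t /set_mem tI; apply: eq_derivI => //.
by move=> s sI; rewrite /= clampI_id.
Qed.

Lemma eq_abs_contI f g : (forall t, t \in `[0%R, 1%R] -> f t = g t) ->
  abs_contI f -> abs_contI g.
Proof.
move=> fg fac e /fac[d d0 H]; exists d => // N p pI pd pl.
rewrite (eq_bigr (fun i => `|f (p i).2 - f (p i).1|)); first exact: H.
move=> i _; have [h1 h2 h3] := pI i; rewrite !fg// in_itv/= ?h1 ?h3 ?andbT//=.
- exact: le_trans h2 h3.
- exact: le_trans h1 h2.
Qed.

End DerivI.

(** * Square-integrable functions *)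

Section SquareIntegrable.
Context d (T : measurableType d) (R : realType) (mu : {measure set T -> \bar R}).
Variables (D : set T) (mD : measurable D).
Implicit Types f g h : T -> R.

(** Used twice: with Lebesgue measure on [0, 1], where it is [L2I], and with the probability P on
    the whole space. *)
Definition L2on f := measurable_fun D f /\ (\int[mu]_(x in D) ((f x) ^+ 2)%:E < +oo)%E.

Lemma eq_L2on f g : f =1 g -> L2on f -> L2on g.
Proof. by move=> /funext ->. Qed.

Lemma L2on_sqr f : L2on f -> mu.-integrable D (EFin \o (fun x => f x ^+ 2)).
Proof.
move=> [mf fi]; apply/integrableP; split.
  by apply/measurable_EFinP; exact: measurable_funX.
rewrite (_ : (fun x => `|_|%E) = fun x => ((f x) ^+ 2)%:E)//.
by apply/funext => x /=; rewrite ger0_norm ?sqr_ge0.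
Qed.

Lemma L2on_mul f g : L2on f -> L2on g -> mu.-integrable D (EFin \o (fun x => f x * g x)).
Proof.
move=> f2 g2.
apply: (le_integrable mD (g := ((EFin \o (fun x => (f x ^+ 2)%R)) \+ (EFin \o (fun x => (g x ^+ 2)%R)))%E)) => //.
- by apply/measurable_EFinP/measurable_funM; [case: f2|case: g2].
- move=> x _ /=; rewrite lee_fin normrM [leRHS]ger0_norm ?addr_ge0 ?sqr_ge0//.
  rewrite -(real_normK (num_real (f x))) -(real_normK (num_real (g x))).
  have := sqr_ge0 (`|f x| - `|g x|); have := normr_ge0 (f x); have := normr_ge0 (g x).
  by set a := `|f x|; set b := `|g x|; nra.
- by apply: integrableD => //; exact: L2on_sqr.
Qed.

Lemma L2on_lin r f g : L2on f -> L2on g -> L2on (fun x => r * f x + g x).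
Proof.
move=> f2 g2; have [mf _] := f2; have [mg _] := g2.
split; first by apply: measurable_funD => //; apply: measurable_funM.
have -> : (fun x => ((r * f x + g x) ^+ 2)%:E) = EFin \o (fun x => r ^+ 2 * (f x ^+ 2) +
    (2 * r * (f x * g x) + g x ^+ 2)).
  by apply/funext => x /=; congr EFin; ring.
apply: integrable_lty => //.
have h1 := integrableZl mD (r ^+ 2) (L2on_sqr f2).
have h2 := integrableZl mD (2 * r) (L2on_mul f2 g2).
exact: (integrableD mD h1 (integrableD mD h2 (L2on_sqr g2))).
Qed.

Definition ipon f g : R := \int[mu]_(x in D) (f x * g x).

Lemma iponC f g : ipon f g = ipon g f.
Proof. by apply: eq_Rintegral => x _; rewrite mulrC. Qed.

Lemma ipon_linl r f g h : L2on f -> L2on g -> L2on h ->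
  ipon (fun x => r * f x + g x) h = r * ipon f h + ipon g h.
Proof.
move=> f2 g2 h2.
rewrite /ipon -RintegralZl//; last exact: L2on_mul.
rewrite -RintegralD//; [| |exact: L2on_mul].
  by apply: eq_Rintegral => x _; ring.
exact: (integrableZl mD r (L2on_mul f2 h2)).
Qed.

Lemma ipon_ge0 f : 0 <= ipon f f.
Proof. by apply: Rintegral_ge0 => x _; rewrite -expr2 sqr_ge0. Qed.

Lemma ae_eq_L2on f g : measurable_fun D g -> ae_eq mu D f g -> L2on f -> L2on g.
Proof.
move=> mg fg [mf fi]; split=> //; apply: le_lt_trans fi.
rewrite le_eqVlt; apply/orP; left; apply/eqP.
apply: ge0_ae_eq_integral => //.
- by apply/measurable_EFinP/measurable_funX.
- by apply/measurable_EFinP/measurable_funX.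
- by move=> x _; rewrite lee_fin sqr_ge0.
- by move=> x _; rewrite lee_fin sqr_ge0.
- by apply: filterS fg => x + Dx => /(_ Dx) ->.
Qed.

Lemma ae_eq_ipon f f' g : measurable_fun D f -> measurable_fun D f' ->
  measurable_fun D g -> ae_eq mu D f f' -> ipon f g = ipon f' g.
Proof.
move=> mf mf' mg ff; congr fine; apply: ae_eq_integral => //.
- by apply/measurable_EFinP/measurable_funM.
- by apply/measurable_EFinP/measurable_funM.
- by apply: filterS ff => x + Dx => /(_ Dx) ->.
Qed.

End SquareIntegrable.

Section Sobolev.
Context {R : realType}.
Implicit Types (f g : R -> R) (t : R).
Local Notation mu := (@lebesgue_measure R).
Local Notation I01 := (`[(0%R : R), (1%R : R)]%classic).

Let mI : measurable (I01 : set R). Proof. by []. Qed.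

Lemma L2I_lin r f g : L2I f -> L2I g -> L2I (fun t => r * f t + g t).
Proof. exact: (@L2on_lin _ _ _ mu _ mI). Qed.

Lemma dotIC f g : dotI f g = dotI g f.
Proof. exact: iponC. Qed.

Lemma dotI_linl r f g h : L2I f -> L2I g -> L2I h ->
  dotI (fun t => r * f t + g t) h = r * dotI f h + dotI g h.
Proof. exact: (@ipon_linl _ _ _ mu _ mI). Qed.

Lemma dotI_linr r f g h : L2I f -> L2I g -> L2I h ->
  dotI h (fun t => r * f t + g t) = r * dotI h f + dotI h g.
Proof. by move=> *; rewrite dotIC dotI_linl// !(dotIC h). Qed.

Lemma abs_contI_L2I f : abs_contI f -> L2I f.
Proof.
move=> fac; have fc := abs_contI_clamp fac.
have mf : measurable_fun I01 f.
  apply: eq_measurable_fun (measurable_funTS (continuous_measurable_fun fc)).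
  by move=> t /set_mem tI; rewrite /= clampI_id.
split=> //.
have [e e0 H] := abs_contI_cont fac ltr01.
have TVf : forall t, t \in `[0%R, 1%R] -> `|f t - f 0| <= fine (total_variation 0 1 f).
  move=> t; rewrite in_itv/= => /andP[t0 t1].
  apply: (le_trans (acTV_ge fac (lexx _) t0 t1)).
  rewrite (acTVD fac (lexx _) t0 t1 (lexx _)) lerDl.
  by rewrite fine_ge0// total_variation_ge0.
set M := fine _ in TVf.
apply: (@le_lt_trans _ _ (\int[mu]_(x in I01) ((`|f 0| + M) ^+ 2)%:E)%E).
  apply: ge0_le_integral => //.
  - by move=> x _; rewrite lee_fin sqr_ge0.
  - by apply/measurable_EFinP/measurable_funX.
  - move=> t tI; rewrite lee_fin -real_normK ?num_real// ler_sqr ?nnegrE//.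
      rewrite -[f t](subrK (f 0)) (le_trans (ler_normD _ _))// addrC lerD2l; exact: TVf.
    rewrite addr_ge0//; apply: le_trans (TVf 0 _) => //.
    by rewrite in_itv/= lexx ler01.
rewrite integral_cst//= lebesgue_measure_itv/= lte_fin ltr01 oppr0 adde0 mule1.
exact: ltry.
Qed.

Lemma Hm_L2I m f : (0 < m)%N -> Hm m f -> L2I f.
Proof. by move=> m0 [_ /(_ 0%N m0) /abs_contI_L2I]. Qed.

Lemma derivnI_lin m r f g : Hm m f -> Hm m g -> forall j t, (j < m)%N -> t \in `[0%R, 1%R] ->
  derivnI j (fun s => r * f s + g s) t = r * derivnI j f t + derivnI j g t.
Proof.
move=> [df _ _] [dg _ _]; elim=> [//|j IH] t jm tI.
rewrite /derivnI !iterS -!/(derivnI _ _).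
rewrite (eq_derivI (g := fun s => r * derivnI j f s + derivnI j g s))//.
  by apply: (derivI_lin _ tI _ _).2; [exact: df|exact: dg].
by move=> s sI; apply: IH => //; exact: ltnW.
Qed.

(** Up to order m - 1 derivatives exist everywhere on [0, 1] and are linear there. The last one
    differentiates a function that is merely absolutely continuous, so linearity can fail on a null
    set, which J does not see. *)
Lemma derivnI_ae_lin m r f g : (0 < m)%N -> Hm m f -> Hm m g ->
  ae_eq mu I01 (fun t => r * derivnI m f t + derivnI m g t)
    (derivnI m (fun s => r * f s + g s)).
Proof.
case: m => // m _ hf hg.
have [_ af _] := hf; have [_ ag _] := hg.
have nf := abs_contI_derivable_ae (af m (ltnSn _)).
have ng := abs_contI_derivable_ae (ag m (ltnSn _)).
apply: negligibleS (negligibleU nf ng) => t /not_implyP[tI neq].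
have [df|] := pselect (derivableI (derivnI m f) t); last by left.
have [dg|] := pselect (derivableI (derivnI m g) t); last by right.
exfalso; apply: neq.
have E h : derivnI m.+1 h = derivI (derivnI m h) by [].
rewrite !E [RHS](eq_derivI (g := fun s => r * derivnI m f s + derivnI m g s))//.
  by rewrite (derivI_lin r tI df dg).2.
by move=> s sI; exact: (derivnI_lin r hf hg (ltnSn m) sI).
Qed.

Lemma Hm_lin m r f g : (0 < m)%N -> Hm m f -> Hm m g -> Hm m (fun t => r * f t + g t).
Proof.
move=> m0 hf hg; have [df af lf] := hf; have [dg ag lg] := hg.
have ac j : (j < m)%N -> abs_contI (derivnI j (fun t => r * f t + g t)).
  move=> jm; apply: eq_abs_contI (abs_contI_lin r (af j jm) (ag j jm)) => t tI.
  by rewrite (derivnI_lin r hf hg).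
split=> //.
- move=> j jm t tI.
  apply: (eq_derivableI tI _ (derivI_lin r tI (df j jm t tI) (dg j jm t tI)).1).
  by move=> s sI; rewrite (derivnI_lin r hf hg)// ltnW.
- apply: (@ae_eq_L2on _ _ _ mu _ mI _ _ _ (derivnI_ae_lin r m0 hf hg)); last exact: L2I_lin.
  by case: m m0 {hf hg df af lf dg ag lg} ac => // m _ ac; apply: measurable_derivI; exact: ac.
Qed.

Lemma JformC m f g : Jform m f g = Jform m g f.
Proof. exact: dotIC. Qed.

Lemma Jform_linl m r f g h : (0 < m)%N -> Hm m f -> Hm m g -> Hm m h ->
  Jform m (fun t => r * f t + g t) h = r * Jform m f h + Jform m g h.
Proof.
move=> m0 hf hg hh; have [_ _ lf] := hf; have [_ _ lg] := hg; have [_ _ lh] := hh.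
have [_ _ lfg] := Hm_lin r m0 hf hg.
rewrite /Jform -dotI_linl//; apply: ae_eq_ipon => //.
- by case: lfg.
- by case: (L2I_lin r lf lg).
- by case: lh.
by apply: filterS (derivnI_ae_lin r m0 hf hg) => t + tI => /(_ tI).
Qed.

Lemma Jform_ge0 m f : 0 <= Jform m f f.
Proof. exact: ipon_ge0. Qed.

End Sobolev.

(** * Measurability of the sample paths and Fubini *)

Section ProcessFubini.
Context {R : realType} {d : measure_display} {Omega : measurableType d}.
Variable P : probability Omega R.
Local Notation mu := (@lebesgue_measure R).
Local Notation I01 := (`[(0%R : R), (1%R : R)]%classic).
Local Notation leb := (@lebesgue_measure R).

Lemma measurable_dotI (X : Omega -> L2path R) b : L2process X -> L2I b ->
  measurable_fun setT (fun w => dotI (X w) b).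
Proof.
move=> [mX _] [mb _].
pose k : Omega * R -> R := (fun q => X q.1 q.2 * b q.2) \_ ([set: Omega] `*` I01).
have mD : measurable ([set: Omega] `*` (I01 : set R)) by apply: measurableX.
have mk : measurable_fun setT k.
  apply: (measurable_restrictT _ mD).1; apply: measurable_funM => //.
  rewrite (_ : (fun q => b q.2) = b \o snd)//.
  apply: (measurable_comp (F := I01)) => //; first by move=> _ [[w t] [_ tI] <-].
  exact: measurable_funTS.
(* The positive and negative parts of k have integrals measurable in w by Tonelli, and their
   difference is the integral by definition, whether finite or not. *)
have mpos := measurable_funepos ((measurable_EFinP _ _).2 mk).
have mneg := measurable_funeneg ((measurable_EFinP _ _).2 mk).
have pos0 q : (0 <= (EFin \o k)^\+%E q)%E by [].
have neg0 q : (0 <= (EFin \o k)^\-%E q)%E by [].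
have m1 := measurable_fun_fubini_tonelli_F (m2 := mu) _ mpos pos0.
have m2 := measurable_fun_fubini_tonelli_F (m2 := mu) _ mneg neg0.
have mF : measurable_fun setT (fun w => \int[mu]_t (k (w, t))%:E)%E.
  have := emeasurable_funB m1 m2; apply: eq_measurable_fun => w _ /=.
  by rewrite [RHS]integralE /fubini_F; congr (_ - _)%E; apply: eq_integral => t _;
    rewrite ?funeposE ?funenegE.
have -> : (fun w => dotI (X w) b) = fine \o (fun w => \int[mu]_t (k (w, t))%:E)%E.
  apply/funext => w /=; rewrite /dotI /intI Rintegral_mkcond; congr fine.
  apply: eq_integral => t _; congr EFin; rewrite /k /patch/=.
  by rewrite in_setX/= in_setT.
exact: measurableT_comp.
Qed.

Lemma measurable_L2path (X : Omega -> L2path R) : L2process X ->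
  measurable_fun setT X.
Proof.
move=> pX; apply: (@measurability _ _ _ (L2path R) setT X (@L2cylinders R)) => //.
move=> _ [_ [b [D [lb mD ->]]] <-].
exact: measurable_dotI pX lb _ _ mD.
Qed.

Lemma measurable_dotI_path b : L2I b ->
  measurable_fun setT (fun x : L2path R => dotI x b).
Proof.
move=> lb _ D mD; rewrite setTI; apply: sub_sigma_algebra.
by exists b, D.
Qed.

Variables (X : Omega -> L2path R) (pX : L2process X) (K : R).
Hypothesis XK : forall t, t \in `[0%R, 1%R] ->
  (\int[P]_w ((X w t) ^+ 2)%:E <= K%:E)%E.

Let mD : measurable ([set: Omega] `*` (I01 : set R)).
Proof. exact: measurableX. Qed.

Let mXt t : t \in `[0%R, 1%R] -> measurable_fun setT (fun w => X w t).
Proof.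
move=> tI; have [mX _] := pX.
rewrite (_ : (fun w => X w t) = (fun p : Omega * R => X p.1 p.2) \o (fun w => (w, t)))//.
apply: (measurable_comp mD) => //; first by move=> _ [w _ <-].
Qed.

Lemma L2_Xt t : t \in `[0%R, 1%R] -> L2on P setT (fun w => X w t).
Proof. by move=> tI; split; [exact: mXt|apply: le_lt_trans (XK tI) _; exact: ltry]. Qed.

Lemma measurable_energy :
  measurable_fun setT (fun w => \int[mu]_(t in I01) ((X w t) ^+ 2)%:E)%E.
Proof.
have [mX _] := pX.
pose k : Omega * R -> R := (fun q => (X q.1 q.2) ^+ 2) \_ ([set: Omega] `*` I01).
have mk : measurable_fun setT k.
  by apply: (measurable_restrictT _ mD).1; exact: measurable_funX.
have k0 q : (0 <= (EFin \o k) q)%E.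
  by rewrite /k /patch/=; case: ifPn => // _; rewrite lee_fin sqr_ge0.
have := measurable_fun_fubini_tonelli_F (m2 := mu) _ ((measurable_EFinP _ _).2 mk) k0.
apply: eq_measurable_fun => w _; rewrite [RHS]integral_mkcond.
apply: eq_integral => t _.
by rewrite /k /patch/= in_setX/= in_setT/=; case: ifP.
Qed.

Lemma L2path_energy : (\int[P]_w \int[mu]_(t in I01) ((X w t) ^+ 2)%:E <= K%:E)%E.
Proof.
have [mX _] := pX.
pose k : Omega * R -> R := (fun q => (X q.1 q.2) ^+ 2) \_ ([set: Omega] `*` I01).
have mk : measurable_fun setT k.
  by apply: (measurable_restrictT _ mD).1; exact: measurable_funX.
have k0 q : (0 <= (EFin \o k) q)%E.
  by rewrite /k /patch/=; case: ifPn => // _; rewrite lee_fin sqr_ge0.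
have kw w t : (k (w, t))%:E = (((fun t => ((X w t) ^+ 2)%:E) \_ I01) t)%E.
  by rewrite /k /patch/= in_setX/= in_setT/=; case: ifP.
have := fubini_tonelli (m1 := P) (m2 := mu) _ ((measurable_EFinP _ _).2 mk) k0 => /= H.
have -> : (\int[P]_w \int[mu]_(t in I01) ((X w t) ^+ 2)%:E =
           \int[P]_w \int[mu]_t (k (w, t))%:E)%E.
  by apply: eq_integral => w _; rewrite integral_mkcond; apply: eq_integral => t _; rewrite kw.
rewrite H; apply: (@le_trans _ _ (\int[mu]_(t in I01) K%:E)%E); last first.
  by rewrite integral_cst//= lebesgue_measure_itv/= lte_fin ltr01 oppr0 adde0 mule1.
rewrite [leRHS]integral_mkcond; apply: ge0_le_integral => //.
- by move=> t _; apply: integral_ge0 => w _; exact: k0.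
- exact: (measurable_fun_fubini_tonelli_G (m1 := P) _ ((measurable_EFinP _ _).2 mk) k0).
- by apply: (measurable_restrictT _ _).1.
- move=> t _; rewrite /patch; case: ifPn => tI.
    have tI' : t \in `[0%R, 1%R] by move/set_mem : tI.
    apply: le_trans (XK tI'); rewrite le_eqVlt; apply/orP; left; apply/eqP.
    by apply: eq_integral => w _; rewrite kw /patch tI.
  by rewrite integral0_eq// => w _; rewrite kw /patch (negbTE tI).
Qed.

(** Integrability on the product space comes from |Z X(t) b(t)| <= Z^2 b(t)^2 + X(t)^2, whose
    integral is at most |b|^2 E Z^2 + K. *)
Lemma fubini_dotI (Z : Omega -> R) b : L2on P setT Z -> L2I b ->
  P.-integrable setT (EFin \o (fun w => Z w * dotI (X w) b)) /\
  \int[P]_w (Z w * dotI (X w) b) = intI (fun t => (\int[P]_w (Z w * X w t)) * b t).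
Proof.
move=> lZ lb; have [mZ _] := lZ; have [mb _] := lb; have [mX lX] := pX.
pose k : Omega * R -> R :=
  (fun q => Z q.1 * (X q.1 q.2 * b q.2)) \_ ([set: Omega] `*` I01).
have mb2 : measurable_fun ([set: Omega] `*` I01) (fun q : Omega * R => b q.2).
  rewrite (_ : (fun q => b q.2) = b \o snd)//.
  apply: (measurable_comp (F := I01)) => //; first by move=> _ [[w t] [_ tI] <-].
  exact: measurable_funTS.
have mZ1 : measurable_fun ([set: Omega] `*` I01) (fun q : Omega * R => Z q.1).
  apply: measurable_funTS; rewrite (_ : (fun q => Z q.1) = Z \o fst)//.
  exact: measurableT_comp.
have mk : measurable_fun setT k.
  by apply: (measurable_restrictT _ mD).1; do 2 apply: measurable_funM => //.
have kw w t : k (w, t) = ((fun t => Z w * (X w t * b t)) \_ I01) t.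
  by rewrite /k /patch/= in_setX/= in_setT.
pose A := fine (\int[mu]_(x in I01) (b x ^+ 2)%:E)%E.
have Afin : (\int[mu]_(x in I01) (b x ^+ 2)%:E = A%:E)%E.
  rewrite fineK//; apply: integrable_fin_num => //.
  exact: (@L2on_sqr _ _ _ mu I01 b lb).
have mk' := (measurable_EFinP _ _).2 mk.
have ik : (P \x mu)%E.-integrable setT (EFin \o k).
  apply/(integrable12ltyP P mu mk') => /=.
  apply: (@le_lt_trans _ _ (\int[P]_w (((Z w) ^+ 2)%:E * A%:E +
     \int[mu]_(t in I01) ((X w t) ^+ 2)%:E))%E).
    apply: ge0_le_integral => //.
    - by move=> w _; exact: integral_ge0.
    - apply: (measurable_fun_fubini_tonelli_F (m2 := mu) (fun p => `|(k p)%:E|%E)) => //.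
      exact: measurableT_comp.
    - apply: emeasurable_funD; last exact: measurable_energy.
      apply: emeasurable_funM; last exact: measurable_cst.
      by apply/measurable_EFinP/measurable_funX.
    - move=> w _; rewrite -Afin -ge0_integralZl//; last 3 first.
      + by apply/measurable_EFinP/measurable_funX.
      + by move=> t _; rewrite lee_fin sqr_ge0.
      + by rewrite lee_fin sqr_ge0.
      rewrite -ge0_integralD//; last 4 first.
      + by move=> t _; rewrite -EFinM lee_fin mulr_ge0 ?sqr_ge0.
      + by apply/measurable_funeM/measurable_EFinP/measurable_funX.
      + by move=> t _; rewrite lee_fin sqr_ge0.
      + by apply/measurable_EFinP/measurable_funX; case: (lX w).
      rewrite [leRHS]integral_mkcond; apply: ge0_le_integral => //.
      + apply/measurable_EFinP; apply: measurableT_comp => //.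
        exact: (measurable_fun_pair2 w mk).
      + apply: (measurable_restrictT _ _).1 => //; apply: emeasurable_funD.
          by apply/measurable_funeM/measurable_EFinP/measurable_funX.
        by apply/measurable_EFinP/measurable_funX; case: (lX w).
      + move=> t _; rewrite kw /patch; case: ifPn => [tI|_]; last by rewrite normr0.
        rewrite -EFinM -EFinD lee_fin.
        rewrite mulrCA mulrA [X in `|X|](_ : _ = (Z w * b t) * X w t); last by ring.
        by rewrite ler_norml; move: (Z w) (b t) (X w t) => z y x; nra.
  rewrite ge0_integralD//; last 4 first.
  - by move=> w _; rewrite mule_ge0 ?lee_fin ?sqr_ge0// -lee_fin -Afin; apply: integral_ge0 => t _; rewrite lee_fin sqr_ge0.
  - apply: emeasurable_funM; last exact: measurable_cst.
    by apply/measurable_EFinP/measurable_funX.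
  - by move=> w _; apply: integral_ge0 => t _; rewrite lee_fin sqr_ge0.
  - exact: measurable_energy.
  have A0 : (0 <= A%:E)%E by rewrite -Afin; apply: integral_ge0 => t _; rewrite lee_fin sqr_ge0.
  rewrite ge0_integralZr//; last 2 first.
  - by apply/measurable_EFinP/measurable_funX.
  - by move=> w _; rewrite lee_fin sqr_ge0.
  rewrite lte_add_pinfty//; last by apply: le_lt_trans L2path_energy (ltry _).
  by case: lZ => _ lZ2; rewrite muleC lte_mul_pinfty// fin_numE.
have EF w : fubini_F mu (EFin \o k) w = (Z w * dotI (X w) b)%:E.
  rewrite /fubini_F (_ : (fun y => _) = (fun t => ((Z w)%:E * (X w t * b t)%:E)%E) \_ I01); last first.
    by apply/funext => t; rewrite /= kw /patch; case: ifP.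
  rewrite -integral_mkcond.
  have iXb : mu.-integrable I01 (EFin \o (fun t => X w t * b t)).
    exact: (@L2on_mul _ _ _ mu _ _ _ _ (lX w) lb).
  by rewrite integralZl// EFinM /dotI /intI /Rintegral fineK// integrable_fin_num.
have EG t : t \in `[0%R, 1%R] -> fubini_G P (EFin \o k) t =
    ((\int[P]_w (Z w * X w t)) * b t)%:E.
  move=> tI; rewrite /fubini_G (eq_integral (fun w => (Z w * X w t)%:E * (b t)%:E)%E); last first.
    move=> w _; rewrite /= kw /patch mem_set//.
    by rewrite -EFinM mulrA.
  have iZX : P.-integrable setT (EFin \o (fun w => Z w * X w t)).
    exact: (@L2on_mul _ _ _ P _ _ _ _ lZ (L2_Xt tI)).
  by rewrite integralZr// EFinM /Rintegral fineK// integrable_fin_num.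
split.
  have := integrable_fubini_F ik; apply: eq_integrable => //.
rewrite /Rintegral (eq_integral (fubini_F mu (EFin \o k))); last by move=> w _; rewrite EF.
rewrite integral12_prod_meas1// -integral21_prod_meas1//.
rewrite /intI Rintegral_mkcond; congr fine; apply: eq_integral => t _.
rewrite /patch; case: ifPn => tI; first exact: (EG t (set_mem tI)).
rewrite /fubini_G integral0_eq// => w _.
by rewrite /= kw /patch (negbTE tI).
Qed.

End ProcessFubini.

(** * Elementary facts *)

(** The common source of the Cauchy-Schwarz inequalities below, for sums, integrals and forms. If c
    = 0 and b is nonzero, some t makes the affine polynomial equal to -1. *)
Lemma discriminant_le (R : realType) (a b c : R) : 0 <= a -> 0 <= c ->
  (forall t : R, 0 <= a + 2 * t * b + t ^+ 2 * c) -> b ^+ 2 <= a * c.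
Proof.
move=> a0 c0 H; move: c0; rewrite le_eqVlt => /orP[/eqP c0|c0].
  rewrite -c0 mulr0; have [->|b0] := eqVneq b 0; first by rewrite expr0n.
  have := H (- (a + 1) / (2 * b)); rewrite -c0 mulr0 addr0.
  rewrite (_ : a + _ = -1); first by rewrite lerNr oppr0 ler10.
  by field.
have := H (- b / c); rewrite (_ : a + _ + _ = (a * c - b ^+ 2) / c).
  by rewrite ler_pdivlMr// mul0r subr_ge0.
by field; rewrite gt_eqF.
Qed.

Section SquareIntegrableVariables.
Context {R : realType} {d : measure_display} {Omega : measurableType d}.
Variable P : probability Omega R.

Lemma fine_expectation (f : Omega -> R) : fine ('E_P[f])%E = \int[P]_w f w.
Proof. by rewrite unlock. Qed.

Lemma L2_cst (r : R) : L2on P setT (fun=> r).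
Proof.
split; first exact: measurable_cst.
by rewrite integral_cst//= probability_setT mule1 ltry.
Qed.

Lemma L2_int (u : Omega -> R) : L2on P setT u -> P.-integrable setT (EFin \o u).
Proof.
move=> lu; apply: eq_integrable (L2on_mul measurableT lu (L2_cst 1)) => //.
by move=> w _; rewrite /= mulr1.
Qed.

Lemma L2_sqrE (u : Omega -> R) : L2on P setT u ->
  (\int[P]_w (u w ^+ 2)%:E = (ipon P setT u u)%:E)%E.
Proof.
move=> lu; rewrite /ipon /Rintegral fineK.
  by apply: eq_integral => w _; rewrite expr2.
by apply: integrable_fin_num => //; exact: (L2on_mul measurableT lu lu).
Qed.

End SquareIntegrableVariables.

(** * Conditional expectations and independence *)

Section LayerCake.
Context {R : realType} {d : measure_display} {Omega : measurableType d}.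
Variable P : probability Omega R.
Local Notation leb := (@lebesgue_measure R).

(** Tonelli applied to phi = \int_0^oo 1(t < phi) dt. It reduces integrals against phi(X) to
    integrals over events X^-1(A), the only ones that a conditional expectation or an equality in
    law controls directly. *)
Lemma layer_cake d' (T : measurableType d') (X : Omega -> T) (Z : Omega -> \bar R)
    (phi : T -> R) : measurable_fun setT X -> measurable_fun setT Z ->
  (forall w, (0 <= Z w)%E) -> measurable_fun setT phi -> (forall x, 0 <= phi x) ->
  measurable_fun (`[0%R, +oo[%classic : set R)
    (fun t => \int[P]_(w in X @^-1` [set x | (t < phi x)%R]) Z w)%E /\
  (\int[P]_w (Z w * (phi (X w))%:E) =
   \int[leb]_(t in `[0%R, +oo[) \int[P]_(w in X @^-1` [set x | (t < phi x)%R]) Z w)%E.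
Proof.
move=> mX mZ Z0 mphi phi0.
pose S : set (Omega * R) := [set p | 0 <= p.2 /\ p.2 < phi (X p.1)].
have m2 : measurable_fun setT (fun p : Omega * R => p.2) by exact: measurable_snd.
have m1 : measurable_fun setT (fun p : Omega * R => phi (X p.1)).
  apply: (measurableT_comp mphi); apply: (measurableT_comp mX); exact: measurable_fst.
have mS : measurable S.
  have -> : S = (setT `&` [set p | 0 <= p.2]) `\` (setT `&` [set p : Omega * R | phi (X p.1) <= p.2]).
    apply/seteqP; split=> p /=.
      by move=> [h1 h2]; split; [split|move=> [_]; rewrite leNgt h2].
    by move=> [[_ h1]] h2; split => //; rewrite ltNge; apply/negP => h3; apply: h2.
  by apply: measurableD; apply: measurable_fun_le.
pose f (p : Omega * R) : \bar R := (Z p.1 * (\1_S p)%:E)%E.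
have mf : measurable_fun setT f.
  apply: emeasurable_funM; first by apply: (measurableT_comp mZ); exact: measurable_fst.
  exact/measurable_EFinP/measurable_indic.
have f0 p : (0 <= f p)%E by rewrite mule_ge0.
have Fw w : (\int[leb]_t f (w, t) = Z w * (phi (X w))%:E)%E.
  have -> : (\int[leb]_t f (w, t) = \int[leb]_t (Z w * (\1_S (w, t))%:E))%E by [].
  rewrite ge0_integralZl//=.
  - congr (_ * _)%E.
    transitivity (\int[leb]_t (\1_(`[0%R, phi (X w)[%classic : set R) t)%:E)%E.
      apply: eq_integral => t _; rewrite !indicE; congr (((nat_of_bool _)%:R)%:E); apply/idP/idP; rewrite !inE /S/= in_itv/=.
        by move=> [-> ->].
      by move=> /andP.
    transitivity (leb (`[0%R, phi (X w)[%classic : set R)).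
      by rewrite integral_indic ?setIT//; exact: measurable_itv.
    rewrite lebesgue_measure_itv /= lte_fin.
    case: ifPn => [_|]; first by rewrite oppr0 adde0.
    by rewrite -leNgt => h; congr EFin; apply/eqP; rewrite eq_le phi0 h.
  - by apply/measurable_EFinP; exact: (measurable_fun_pair2 w (measurable_indic mS)).
have Gt t : (\int[P]_w f (w, t) =
   ((fun t => \int[P]_(w in X @^-1` [set x | (t < phi x)%R]) Z w) \_ `[0%R, +oo[) t)%E.
  rewrite /patch; case: ifPn => [/set_mem|/negP].
    rewrite /= in_itv/= andbT => t0; rewrite [RHS]integral_mkcond; apply: eq_integral => w _.
    rewrite /f /patch indicE /S/=; case: ifPn => h.
      by rewrite mem_set ?mule1//=; split => //; exact: set_mem h.
    rewrite memNset ?mule0//= => -[_ h2]; move/negP: h; apply.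
    by apply/mem_set.
  rewrite inE /= in_itv/= andbT => t0; rewrite integral0_eq// => w _.
  by rewrite /f indicE memNset ?mule0//= => -[].
split.
  apply: (measurable_restrictT _ _).2 => //.
  have := measurable_fun_fubini_tonelli_G (m1 := P) _ mf f0.
  by apply: eq_measurable_fun => t _; rewrite -Gt.
transitivity (\int[P]_w \int[leb]_t f (w, t))%E.
  by apply: eq_integral => w _; rewrite Fw.
rewrite (fubini_tonelli (m1 := P) (m2 := leb) _ mf f0) [RHS]integral_mkcond.
by apply: eq_integral => t _; rewrite Gt.
Qed.

Lemma measurable_layer d' (T : measurableType d') (phi : T -> R) t :
  measurable_fun setT phi -> measurable [set x | t < phi x].
Proof.
move=> mphi; rewrite -[X in measurable X]setTI.
have := mphi measurableT _ (measurable_itv `]t, +oo[).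
by congr measurable; congr (_ `&` _); apply/seteqP; split => x; rewrite /= in_itv/= andbT.
Qed.

Lemma cond_mono d' (T : measurableType d') (X : Omega -> T) (Z1 Z2 : Omega -> \bar R)
    (phi : T -> R) : measurable_fun setT X ->
  measurable_fun setT Z1 -> (forall w, (0 <= Z1 w)%E) ->
  measurable_fun setT Z2 -> (forall w, (0 <= Z2 w)%E) ->
  (forall A, measurable A ->
    (\int[P]_(w in X @^-1` A) Z1 w <= \int[P]_(w in X @^-1` A) Z2 w)%E) ->
  measurable_fun setT phi -> (forall x, 0 <= phi x) ->
  (\int[P]_w (Z1 w * (phi (X w))%:E) <= \int[P]_w (Z2 w * (phi (X w))%:E))%E.
Proof.
move=> mX m1 p1 m2 p2 H mphi phi0.
have [l1 ->] := layer_cake mX m1 p1 mphi phi0.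
have [l2 ->] := layer_cake mX m2 p2 mphi phi0.
apply: ge0_le_integral => //.
- by move=> t _; apply: integral_ge0.
- by move=> t _; apply: H; exact: measurable_layer.
Qed.

Lemma cond_eq d' (T : measurableType d') (X : Omega -> T) (Z1 Z2 : Omega -> \bar R)
    (phi : T -> R) : measurable_fun setT X ->
  measurable_fun setT Z1 -> (forall w, (0 <= Z1 w)%E) ->
  measurable_fun setT Z2 -> (forall w, (0 <= Z2 w)%E) ->
  (forall A, measurable A ->
    (\int[P]_(w in X @^-1` A) Z1 w = \int[P]_(w in X @^-1` A) Z2 w)%E) ->
  measurable_fun setT phi -> (forall x, 0 <= phi x) ->
  (\int[P]_w (Z1 w * (phi (X w))%:E) = \int[P]_w (Z2 w * (phi (X w))%:E))%E.
Proof.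
move=> mX m1 p1 m2 p2 H mphi phi0; apply/eqP; rewrite eq_le.
by apply/andP; split; apply: cond_mono => // A mA; rewrite H.
Qed.

Lemma ident_ge0_integral d' (T : measurableType d') (X X' : Omega -> T) (phi : T -> R) :
  measurable_fun setT X -> measurable_fun setT X' ->
  (forall A, measurable A -> P (X @^-1` A) = P (X' @^-1` A)) ->
  measurable_fun setT phi -> (forall x, 0 <= phi x) ->
  (\int[P]_w (phi (X w))%:E = \int[P]_w (phi (X' w))%:E)%E.
Proof.
move=> mX mX' XX mphi phi0.
have E (Y : Omega -> T) : (\int[P]_w (phi (Y w))%:E = \int[P]_w (1 * (phi (Y w))%:E))%E.
  by apply: eq_integral => w _; rewrite mul1e.
rewrite (E X) (E X').
have [_ ->] := layer_cake (Z := fun=> 1%E) mX (measurable_cst _) ltac:(by []) mphi phi0.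
have [_ ->] := layer_cake (Z := fun=> 1%E) mX' (measurable_cst _) ltac:(by []) mphi phi0.
apply: eq_integral => t _; have ml := measurable_layer t mphi.
have mp (Y : Omega -> T) : measurable_fun setT Y -> measurable (Y @^-1` [set x | t < phi x]).
  by move=> mY; rewrite -[X in measurable X]setTI; exact: mY.
by rewrite !integral_cst ?mul1e; [exact: XX|exact: mp|exact: mp].
Qed.

(** * Independent copies and the variance of averages *)

Section Independence.
Context d' (T : measurableType d').
Variables (Z : nat -> Omega -> T) (Z0 : Omega -> T).
Hypotheses (mZ : forall i, measurable_fun setT (Z i)) (mZ0 : measurable_fun setT Z0).
Hypotheses (ind : mutually_independent P Z) (ide : identically_distributed P Z Z0).

Let mpre i A : measurable A -> measurable (Z i @^-1` A).
Proof. by move=> mA; rewrite -[X in measurable X]setTI; exact: mZ. Qed.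

Lemma indep_pair i j A A' : i != j -> measurable A -> measurable A' ->
  P (Z i @^-1` A `&` Z j @^-1` A') = (P (Z i @^-1` A) * P (Z j @^-1` A'))%E.
Proof.
move=> ij mA mA'.
have := ind (J := [:: i; j]) (A := fun k => if k == i then A else A').
rewrite !big_cons big_nil mule1 eqxx (eq_sym j i) (negbTE ij) => <-.
- congr (P _); apply/seteqP; split=> w.
    move=> [h1 h2] k /=; rewrite !inE => /orP[/eqP ->|/eqP ->].
      by rewrite eqxx.
    by rewrite eq_sym (negbTE ij).
  move=> h; split.
    by have := h i; rewrite /= mem_head eqxx; apply.
  by have := h j; rewrite /= !inE eqxx orbT eq_sym (negbTE ij); apply.
- by rewrite /= inE ij.
- by move=> k; case: ifP.
Qed.

(** [cond_eq] is applied twice: given Z i, the indicator of an event of Z j acts as its probability;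
    then, given Z j, the variable f(Z i) acts as its mean. *)
Lemma indep_ge0_integral i j (f g : T -> R) : i != j ->
  measurable_fun setT f -> (forall x, 0 <= f x) ->
  measurable_fun setT g -> (forall x, 0 <= g x) ->
  (\int[P]_w ((f (Z i w))%:E * (g (Z j w))%:E) =
   (\int[P]_w (f (Z i w))%:E) * (\int[P]_w (g (Z j w))%:E))%E.
Proof.
move=> ij mf f0 mg g0.
have mfZ : measurable_fun setT (fun w => (f (Z i w))%:E).
  by apply/measurable_EFinP; exact: measurableT_comp.
have mgZ : measurable_fun setT (fun w => (g (Z j w))%:E).
  by apply/measurable_EFinP; exact: measurableT_comp.
have F0 : (0 <= \int[P]_w (f (Z i w))%:E)%E by apply: integral_ge0 => w _; rewrite lee_fin.
have step1 A : measurable A ->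
    (\int[P]_(w in Z j @^-1` A) (f (Z i w))%:E = (\int[P]_w (f (Z i w))%:E) * P (Z j @^-1` A))%E.
  move=> mA.
  have -> : (\int[P]_(w in Z j @^-1` A) (f (Z i w))%:E =
             \int[P]_w ((\1_(Z j @^-1` A) w)%:E * (f (Z i w))%:E))%E.
    by rewrite integral_mkcond; apply: eq_integral => w _; rewrite muleC epatch_indic.
  rewrite (@cond_eq _ _ (Z i) (fun w => (\1_(Z j @^-1` A) w)%:E) (fun=> P (Z j @^-1` A)) f)//.
  - by rewrite [RHS]muleC ge0_integralZl// => w _; rewrite lee_fin.
  - by apply/measurable_EFinP/measurable_indic; exact: mpre.
  move=> A' mA'; rewrite integral_indic//; [|exact: mpre|exact: mpre].
  rewrite integral_cst; last exact: mpre.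
  by rewrite setIC muleC setIC -indep_pair// 1?eq_sym// setIC.
rewrite (@cond_eq _ _ (Z j) (fun w => (f (Z i w))%:E) (fun=> (\int[P]_w (f (Z i w))%:E)%E) g)//.
- by rewrite ge0_integralZl// => w _; rewrite lee_fin.
- by move=> w; rewrite lee_fin.
- by move=> A mA; rewrite step1// integral_cst//; exact: mpre.
Qed.

Lemma ident_integral i (f : T -> R) : measurable_fun setT f -> (forall x, 0 <= f x) ->
  (\int[P]_w (f (Z i w))%:E = \int[P]_w (f (Z0 w))%:E)%E.
Proof. by move=> mf f0; apply: ident_ge0_integral => // A mA; exact: ide. Qed.

Variable f : T -> R.
Hypotheses (mf : measurable_fun setT f) (f2 : L2on P setT (f \o Z0)).

Lemma ident_L2 i : L2on P setT (f \o Z i).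
Proof.
have [_ fi] := f2; split; first exact: measurableT_comp.
rewrite (ident_integral i (f := fun x => f x ^+ 2))//; first exact: measurable_funX.
by move=> x; exact: sqr_ge0.
Qed.

(** The integral formulas above concern nonnegative functions; square-integrable ones are split into
    their two parts. *)
Let fp x := Num.max (f x) 0.
Let fn x := Num.max (- f x) 0.

Let fpn x : f x = fp x - fn x.
Proof. by rewrite /fp /fn; case: (ltP (f x) 0) => ?; case: (ltP (- f x) 0) => ?; lra. Qed.

Let mfp : measurable_fun setT fp.
Proof. by apply: measurable_maxr => //; exact: measurable_cst. Qed.

Let mfn : measurable_fun setT fn.
Proof. by apply: measurable_maxr; [exact: measurable_funN|exact: measurable_cst]. Qed.

Let L2pn (Y : Omega -> T) : measurable_fun setT Y -> L2on P setT (f \o Y) ->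
  L2on P setT (fp \o Y) /\ L2on P setT (fn \o Y).
Proof.
move=> mY [_ fY]; split; split; try exact: measurableT_comp.
  apply: le_lt_trans fY; apply: ge0_le_integral => //.
  - by move=> w _; rewrite lee_fin sqr_ge0.
  - by apply/measurable_EFinP/measurable_funX; exact: measurableT_comp.
  - by apply/measurable_EFinP/measurable_funX; exact: measurableT_comp.
  - move=> w _; rewrite lee_fin /= /fp; case: (ltP (f (Y w)) 0) => h //.
    by rewrite expr0n sqr_ge0.
apply: le_lt_trans fY; apply: ge0_le_integral => //.
- by move=> w _; rewrite lee_fin sqr_ge0.
- by apply/measurable_EFinP/measurable_funX; exact: measurableT_comp.
- by apply/measurable_EFinP/measurable_funX; exact: measurableT_comp.
- move=> w _; rewrite lee_fin /= /fn; case: (ltP (- f (Y w)) 0) => h.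
    by rewrite expr0n sqr_ge0.
  by rewrite sqrrN.
Qed.

Let ip_ge0_pair i j (g h : T -> R) : i != j ->
  measurable_fun setT g -> (forall x, 0 <= g x) ->
  measurable_fun setT h -> (forall x, 0 <= h x) ->
  L2on P setT (g \o Z0) -> L2on P setT (h \o Z0) ->
  ipon P setT (g \o Z i) (h \o Z j) = (\int[P]_w g (Z0 w)) * (\int[P]_w h (Z0 w)).
Proof.
move=> ij mg g0 mh h0 lg lh; rewrite /ipon /Rintegral.
have := indep_ge0_integral ij mg g0 mh h0.
rewrite (ident_integral i mg g0) (ident_integral j mh h0) => H.
rewrite -fineM; last 2 first.
- by apply: integrable_fin_num => //; exact: L2_int lg.
- by apply: integrable_fin_num => //; exact: L2_int lh.
by rewrite -H; congr fine; apply: eq_integral => w _.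
Qed.

Let mean := \int[P]_w f (Z0 w).

Let fp0 x : 0 <= fp x. Proof. by rewrite /fp le_max lexx orbT. Qed.
Let fn0 x : 0 <= fn x. Proof. by rewrite /fn le_max lexx orbT. Qed.

Let lp0 := (L2pn mZ0 f2).1.
Let ln0 := (L2pn mZ0 f2).2.

Let meanE : mean = (\int[P]_w fp (Z0 w)) - (\int[P]_w fn (Z0 w)).
Proof.
rewrite -RintegralB//; [|exact: L2_int lp0|exact: L2_int ln0].
by apply: eq_Rintegral => w _; rewrite -fpn.
Qed.

Lemma indep_ipon i j : i != j -> ipon P setT (f \o Z i) (f \o Z j) = mean ^+ 2.
Proof.
move=> ij; have [lpi lni] := L2pn (mZ i) (ident_L2 i).
have [lpj lnj] := L2pn (mZ j) (ident_L2 j).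
have E k : f \o Z k = (fun w => -1 * (fn \o Z k) w + (fp \o Z k) w).
  by apply/funext => w /=; rewrite fpn; ring.
have lj := ident_L2 j; have ji : j != i by rewrite eq_sym.
rewrite [in LHS](E i) ipon_linl// !(iponC _ _ _ (f \o Z j)) (E j) !ipon_linl//.
rewrite (ip_ge0_pair ji mfn fn0 mfn fn0)// (ip_ge0_pair ji mfp fp0 mfn fn0)//.
rewrite (ip_ge0_pair ji mfn fn0 mfp fp0)// (ip_ge0_pair ji mfp fp0 mfp fp0)//.
by rewrite meanE; ring.
Qed.

Lemma ident_mean i : \int[P]_w f (Z i w) = mean.
Proof.
have [lpi lni] := L2pn (mZ i) (ident_L2 i).
rewrite meanE /Rintegral -(ident_integral i mfp fp0) -(ident_integral i mfn fn0).
rewrite -!/(Rintegral _ _ _) -RintegralB//; [|exact: L2_int lpi|exact: L2_int lni].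
by apply: eq_Rintegral => w _; rewrite -fpn.
Qed.

Let U i w := f (Z i w) - mean.

Let lU i : L2on P setT (U i).
Proof.
apply: eq_L2on (L2on_lin measurableT (-1) (L2_cst P mean) (ident_L2 i)) => w.
by rewrite /U /=; ring.
Qed.

Let ipU i j : i != j -> ipon P setT (U i) (U j) = 0.
Proof.
move=> ij; have E k : U k = (fun w => - mean * (fun=> 1) w + (f \o Z k) w).
  by apply/funext => w; rewrite /U /=; ring.
have l1 := L2_cst P 1; have li := ident_L2 i; have lj := ident_L2 j; have lUj := lU j.
rewrite E ipon_linl// !(iponC _ _ _ (U j)) E !ipon_linl// indep_ipon 1?eq_sym//.
have e1 k : ipon P setT (f \o Z k) (fun=> 1) = mean.
  by rewrite -(ident_mean k); apply: eq_Rintegral => w _; rewrite mulr1.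
have e2 : ipon P setT (fun=> 1) (fun=> 1) = 1.
  transitivity (\int[P]_(w in setT) (1 : R)); first by apply: eq_Rintegral => w _; rewrite mulr1.
  by rewrite Rintegral_cst// [X in fine X](probability_setT P) mul1r.
by rewrite (iponC _ _ (fun=> 1) (f \o _)) !e1 e2; ring.
Qed.

Let ipUU i : ipon P setT (U i) (U i) <= ipon P setT (f \o Z0) (f \o Z0).
Proof.
have E : U i = (fun w => - mean * (fun=> 1) w + (f \o Z i) w).
  by apply/funext => w; rewrite /U /=; ring.
have l1 := L2_cst P 1; have li := ident_L2 i; have lUi := lU i.
rewrite [X in ipon P _ X]E ipon_linl// !(iponC _ _ _ (U i)) E !ipon_linl//.
have e1 : ipon P setT (f \o Z i) (fun=> 1) = mean.
  by rewrite -(ident_mean i); apply: eq_Rintegral => w _; rewrite mulr1.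
have e2 : ipon P setT (fun=> 1) (fun=> 1) = 1.
  transitivity (\int[P]_(w in setT) (1 : R)); first by apply: eq_Rintegral => w _; rewrite mulr1.
  by rewrite Rintegral_cst// [X in fine X](probability_setT P) mul1r.
have e3 : ipon P setT (f \o Z i) (f \o Z i) = ipon P setT (f \o Z0) (f \o Z0).
  apply: EFin_inj; rewrite -!L2_sqrE//.
  apply: (ident_integral i (f := fun x => f x ^+ 2)); first exact: measurable_funX.
  by move=> x; exact: sqr_ge0.
rewrite (iponC _ _ (fun=> 1) (f \o _)) !e1 e2 e3.
by have := sqr_ge0 mean; rewrite expr2; lra.
Qed.

(** The centred variables are pairwise orthogonal, so the squared norms of the partial sums grow by
    one term at each step. Each term, a variance, is at most the second moment, the quantity for
    which bounds will be available. *)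
Lemma average_variance n : (0 < n)%N ->
  (\int[P]_w ((n%:R^-1 * (\sum_(i < n) f (Z i w)) - mean) ^+ 2)%:E <=
   (n%:R^-1 * ipon P setT (f \o Z0) (f \o Z0))%:E)%E.
Proof.
move=> n0; pose S k w := \sum_(i < k) U i w.
have SS k : S k.+1 = (fun w => 1 * U k w + S k w).
  by apply/funext => w; rewrite /S big_ord_recr/= mul1r addrC.
have S0 : S 0%N = (fun=> 0) by apply/funext => w; rewrite /S big_ord0.
have lS k : L2on P setT (S k).
  elim: k => [|k IH]; first by rewrite S0; exact: L2_cst.
  by rewrite SS; exact: L2on_lin.
have SU k j : (k <= j)%N -> ipon P setT (S k) (U j) = 0.
  elim: k => [|k IH] kj.
    rewrite S0; transitivity (\int[P]_(w in setT) (0 : R)); last by rewrite /Rintegral integral0.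
    by apply: eq_Rintegral => w _; rewrite mul0r.
  rewrite SS ipon_linl// IH ?(ltnW kj)// addr0 mul1r ipU//.
  by rewrite ltn_eqF.
have SSk k : ipon P setT (S k) (S k) <= k%:R * ipon P setT (f \o Z0) (f \o Z0).
  elim: k => [|k IH].
    rewrite S0 mul0r.
    suff -> : ipon P setT (fun=> 0) (fun=> 0) = \int[P]_(w in setT) (0 : R) by rewrite /Rintegral integral0.
    by apply: eq_Rintegral => w _; rewrite mul0r.
  have lSk := lS k; have lSk1 := lS k.+1; have lUk := lU k.
  rewrite [X in ipon P _ X]SS ipon_linl// !(iponC _ _ _ (S k.+1)) SS !ipon_linl//.
  rewrite (iponC _ _ (U k) (S k)) SU// -natr1 mulrDl mul1r.
  by have := ipUU k; lra.
have nn0 : (n%:R : R) != 0 by rewrite pnatr_eq0 -lt0n.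
have E w : n%:R^-1 * (\sum_(i < n) f (Z i w)) - mean = n%:R^-1 * S n w.
  by rewrite /S sumrB sumr_const card_ord mulrBr -(mulr_natl mean) mulKf.
have lnS : L2on P setT (fun w => n%:R^-1 * S n w).
  by apply: eq_L2on (L2on_lin measurableT n%:R^-1 (lS n) (L2_cst P 0)) => w; rewrite addr0.
under eq_integral do rewrite E.
rewrite (L2_sqrE lnS) lee_fin.
have -> : ipon P setT (fun w => n%:R^-1 * S n w) (fun w => n%:R^-1 * S n w) =
    n%:R^-1 ^+ 2 * ipon P setT (S n) (S n).
  have ll := lS n; rewrite /ipon -RintegralZl//; last exact: (L2on_mul measurableT ll ll).
  by apply: eq_Rintegral => w _; ring.
rewrite expr2 -mulrA ler_pM2l ?invr_gt0 ?ltr0n// mulrC ler_pdivrMr ?ltr0n// mulrC.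
exact: SSk.
Qed.

End Independence.

End LayerCake.

(** * Derivatives of the loss *)

Section Differentiation.
Context {R : realType}.
Implicit Types f : R -> R.

Lemma derivable_is_derive1 f u : derivable f u 1 -> is_derive u 1 f (f^`()%classic u).
Proof. by move=> fu; apply: DeriveDef => //; rewrite derive1E. Qed.

Lemma derivable1_continuous f : (forall u, derivable f u 1) -> continuous f.
Proof. by move=> df u; apply: differentiable_continuous; apply/derivable1_diffP. Qed.

Lemma mean_value f u v : (forall u, derivable f u 1) ->
  exists c, `|c - u| <= `|v - u| /\ f v - f u = f^`()%classic c * (v - u).
Proof.
move=> df; have [uv|uv] := leP u v.
- have [|c + ->] := MVT_segment uv (fun x _ => derivable_is_derive1 (df x)).
    exact/continuous_subspaceT/derivable1_continuous.
  rewrite in_itv/= => /andP[uc cv]; exists c; split=> //.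
  by rewrite !ger0_norm ?subr_ge0//; lra.
- have [|c + H] := MVT_segment (ltW uv) (fun x _ => derivable_is_derive1 (df x)).
    exact/continuous_subspaceT/derivable1_continuous.
  rewrite in_itv/= => /andP[uc cv]; exists c; split=> //.
    by rewrite !ler0_norm ?subr_le0 ?(ltW uv)//; lra.
  by apply: oppr_inj; rewrite opprB H; ring.
Qed.

(** A derivative as the limit of a sequence: this is how measurability in y passes from ell to its
    derivatives. *)
Lemma quotient_cvg f u : derivable f u 1 ->
  n.+1%:R * (f (u + n.+1%:R^-1) - f u) @[n --> \oo] --> f^`()%classic u.
Proof.
move=> fu; rewrite derive1E.
have H : (n.+1%:R^-1 : R) @[n --> \oo] --> 0^'.
  move=> A [e /= e0 HA].
  suff : \forall n \near \oo, A (n.+1%:R^-1) by [].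
  near=> n; apply: HA => /=; last by rewrite invr_eq0 pnatr_eq0.
  rewrite sub0r normrN ger0_norm ?invr_ge0//.
  by near: n; exact: near_infty_natSinv_lt (PosNum e0).
have := cvg_comp _ _ H fu; apply: cvg_trans.
apply: near_eq_cvg; near=> n => /=.
by rewrite invrK [n.+1%:R^-1 *: 1]mulr1 [u + _]addrC.
Unshelve. all: by end_near. Qed.

(** If f''(u) > 0, then f' is smaller than f'(u) just before u and larger just after. The mean value
    theorem on [u - h, u] and on [u, u + h] then puts f(u) below the mean of f(u - h) and f(u +
    h). *)
Lemma concave_derive2_le0 f u : (forall u, derivable f u 1) ->
  derivable f^`()%classic u 1 ->
  (forall x y t : R, x != y -> 0 < t -> t < 1 ->
     t * f x + (1 - t) * f y < f (t * x + (1 - t) * y)) ->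
  f^`(2)%classic u <= 0.
Proof.
move=> df ddf cf; rewrite leNgt; apply/negP; rewrite derive1nS derive1E => c0.
have [e /= e0 He] : \forall h \near 0^', 0 < h^-1 *: ((f^`()%classic \o shift u) (h *: 1) - f^`()%classic u).
  exact: (cvgr_gt _ ddf).
pose h := e / 2; have h0 : 0 < h by rewrite divr_gt0.
have inc c : c != u -> `|c - u| < e -> 0 < (c - u)^-1 * (f^`()%classic c - f^`()%classic u).
  move=> cu ce; have := He (c - u); rewrite /= sub0r normrN subr_eq0.
  by rewrite [(c - u) *: 1]mulr1 subrK; apply.
have cont a b : {within `[a, b], continuous f}.
  exact/continuous_subspaceT/derivable1_continuous.
have [|c1] := MVT (_ : u < u + h) (fun x _ => derivable_is_derive1 (df x)) (cont _ _).
  by rewrite ltrDl.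
rewrite in_itv/= => /andP[c1l c1r] E1.
have [|c2] := MVT (_ : u - h < u) (fun x _ => derivable_is_derive1 (df x)) (cont _ _).
  by rewrite ltrBlDr ltrDl.
rewrite in_itv/= => /andP[c2l c2r] E2.
have he : h < e by rewrite /h; lra.
have I1 : f^`()%classic u < f^`()%classic c1.
  have := inc c1; rewrite gt_eqF// => /(_ isT); rewrite gtr0_norm ?subr_gt0//.
  by rewrite pmulr_rgt0 ?invr_gt0 ?subr_gt0//; apply; lra.
have I2 : f^`()%classic c2 < f^`()%classic u.
  have := inc c2; rewrite lt_eqF// => /(_ isT); rewrite ltr0_norm ?subr_lt0//.
  by rewrite nmulr_rgt0 ?invr_lt0 ?subr_lt0//; apply; lra.
have := cf (u + h) (u - h) 2^-1; rewrite (_ : 2^-1 * (u + h) + (1 - 2^-1) * (u - h) = u); last by field.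
have uh : u + h != u - h by rewrite gt_eqF//; lra.
have h2 : 0 < 2^-1 :> R by rewrite invr_gt0.
have h21 : 2^-1 < 1 :> R by rewrite invf_lt1// ltr1n.
move=> /(_ uh h2 h21).
have : f^`()%classic u * h < f^`()%classic c1 * h by rewrite ltr_pM2r.
have : f^`()%classic c2 * h < f^`()%classic u * h by rewrite ltr_pM2r.
by move: E1 E2; rewrite addrAC subrr add0r opprB addrCA subrr addr0; lra.
Qed.

End Differentiation.

Section Caratheodory.
Context {R : realType} {d d' : measure_display}.
Context {T : measurableType d} {U : measurableType d'}.

(** The value q x is rounded down to the grid of mesh 1 / n.+1, which leaves countably many values
    of the second argument of psi; continuity in that argument gives the limit. This makes the
    weight ell''(y; <x,theta0>) measurable in (y, x). *)
Lemma caratheodory_measurable (psi : T -> R -> R) (q : U -> R) :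
  (forall u, measurable_fun setT (psi ^~ u)) -> (forall y, continuous (psi y)) ->
  measurable_fun setT q ->
  measurable_fun setT (fun p : T * U => psi p.1 (q p.2)).
Proof.
move=> mpsi cpsi mq.
pose grid n (u : R) : R := (Num.floor (u * n.+1%:R))%:~R / n.+1%:R.
have gridP u : grid n u @[n --> \oo] --> u.
  apply/cvgrPdist_lt => e e0; near=> n.
  have n0 : 0 < n.+1%:R :> R by rewrite ltr0n.
  have := floor_itv (u * n.+1%:R); rewrite intrD -ler_pdivrMr// => /andP[h1 h2].
  rewrite ger0_norm ?subr_ge0//; apply: le_lt_trans (_ : n.+1%:R^-1 < e).
    by rewrite lerBlDl -(ler_pM2r n0) mulrDl mulVf ?gt_eqF// mulfVK ?gt_eqF// ltW.
  by near: n; exact: near_infty_natSinv_lt (PosNum e0).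
apply: (@measurable_fun_cvg _ _ _ _ (fun n (p : T * U) => psi p.1 (grid n (q p.2)))); last first.
  by move=> p _; apply: cvg_comp (gridP _) _; exact: cpsi.
move=> n _ A mA; rewrite setTI.
have -> : (fun p : T * U => psi p.1 (grid n (q p.2))) @^-1` A =
    \bigcup_(k : int) (([set y | A (psi y (k%:~R / n.+1%:R))] `*` setT) `&`
      (setT `*` [set x | Num.floor (q x * n.+1%:R) = k])).
  apply/seteqP; split=> -[y x] /=.
    by move=> h; exists (Num.floor (q x * n.+1%:R)).
  by move=> [k _ [[/= h _] [_ /= e]]]; rewrite /grid e.
apply: countable_bigcupT_measurable => [|k]; first exact: countableP.
apply: measurableI; apply: measurableX => //.
  by rewrite -[X in measurable X]setTI; exact: mpsi.
have -> : [set x | Num.floor (q x * n.+1%:R) = k] =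
    setT `&` (fun x => q x * n.+1%:R) @^-1` (`[(k%:~R : R), ((k + 1)%:~R : R)[%classic).
  rewrite setTI; apply/seteqP; split=> x /=; rewrite in_itv/=.
    by move=> <-; exact: floor_itv.
  by move=> h; apply/eqP; rewrite floor_eq.
have mq' : measurable_fun setT (fun x => q x * n.+1%:R) by exact: measurable_funM.
by apply: mq' => //; exact: measurable_itv.
Unshelve. all: by end_near. Qed.

End Caratheodory.

Section LossDerivatives.
Context {R : realType}.
Variables (Yset : set R) (mYset : measurable Yset) (ell : R -> R -> R).
Hypothesis mell : forall u : R, measurable_fun Yset (fun y => ell y u).
Hypothesis Hell : forall y, Yset y ->
        [/\ forall j, (j < 3)%N -> forall u : R, derivable ((ell y)^`(j)%classic) u 1,
            continuous ((ell y)^`(3)%classic)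
          & forall u v t : R, u != v -> 0 < t -> t < 1 ->
              t * ell y u + (1 - t) * ell y v < ell y (t * u + (1 - t) * v)].

Lemma measurable_derive1n_ell j u : (j <= 3)%N ->
  measurable_fun Yset (fun y => (ell y)^`(j)%classic u).
Proof.
elim: j u => [|j IH] u j3; first exact: mell.
apply: (@measurable_fun_cvg _ _ _ _
  (fun n y => n.+1%:R * ((ell y)^`(j)%classic (u + n.+1%:R^-1) - (ell y)^`(j)%classic u))).
  move=> n; apply: measurable_funM => //.
  by apply: measurable_funB; apply: IH; exact: ltnW.
by move=> y /Hell[D _ _]; apply: quotient_cvg; exact: D.
Qed.

Lemma continuous_derive1n_ell j y : (j <= 3)%N -> Yset y -> continuous ((ell y)^`(j)%classic).
Proof.
rewrite leq_eqVlt => /orP[/eqP ->|j3] /Hell[D C _] //.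
by apply: derivable1_continuous; exact: D.
Qed.

(* Both functions are extended by 0 outside Yset, where ell need not be measurable. *)
Definition dell (j : nat) (y u : R) : R := if y \in Yset then (ell y)^`(j)%classic u else 0.

Lemma dellE j y u : Yset y -> dell j y u = (ell y)^`(j)%classic u.
Proof. by move=> yY; rewrite /dell mem_set. Qed.

Lemma measurable_dell j u : (j <= 3)%N -> measurable_fun setT (fun y => dell j y u).
Proof.
by move=> j3; have := (measurable_restrictT _ mYset).1 (measurable_derive1n_ell u j3).
Qed.

Lemma continuous_dell j y : (j <= 3)%N -> continuous (dell j y).
Proof.
move=> j3; rewrite /dell; case: (boolP (y \in Yset)) => [/set_mem yY|_] /=.
  exact: continuous_derive1n_ell.
exact: cst_continuous.
Qed.

Definition supell (j : nat) (y : R) : \bar R := if y \in Yset then supderiv ell j y else 0%E.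

Lemma supellE j y : Yset y -> supell j y = supderiv ell j y.
Proof. by move=> yY; rewrite /supell mem_set. Qed.

Lemma le_supderiv j y u : (`|(ell y)^`(j)%classic u|%:E <= supderiv ell j y)%E.
Proof. by apply: ereal_sup_ubound; exists u. Qed.

Lemma supderiv_ge0 j y : (0 <= supderiv ell j y)%E.
Proof. by apply: le_trans (le_supderiv j y 0); rewrite lee_fin. Qed.

Lemma supell_ge0 j y : (0 <= supell j y)%E.
Proof. by rewrite /supell; case: ifP => // _; exact: supderiv_ge0. Qed.

(** By continuity in u the supremum runs over the rationals, enumerated by q; numbers coding no
    rational repeat the value at 0. *)
Lemma measurable_supell j : (j <= 3)%N -> measurable_fun setT (supell j).
Proof.
move=> j3.
pose q (n : nat) : R := ratr (odflt 0 (unpickle n : option rat)).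
have E y : supell j y = esups (fun n => `|dell j y (q n)|%:E) 0%N.
  apply/eqP; rewrite eq_le; apply/andP; split; last first.
    apply: ge_ereal_sup => _ [n _ <-]; rewrite /supell /dell; case: ifP => _.
      exact: le_supderiv.
    by rewrite normr0.
  have qle u : Yset y -> (`|(ell y)^`(j)%classic u|%:E <= esups (fun n => `|dell j y (q n)|%:E) 0%N)%E.
    move=> yY; apply/lee_addgt0Pr => e e0.
    have cf := continuous_derive1n_ell j3 yY; have := cf u.
    move=> /cvgrPdist_lt/(_ _ e0)[dl /= dl0 H].
    have [|r [r1 r2]] := @rat_between _ u (u + dl); first by rewrite ltrDl.
    have /H/ltW h : `|u - ratr r| < dl by rewrite ltr0_norm ?subr_lt0//; lra.
    apply: (@le_trans _ _ (`|dell j y (q (pickle r))| + e)%:E).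
      rewrite lee_fin /q pickleK/= dellE// -lerBlDl.
      by apply: le_trans h; exact: lerB_dist.
    rewrite EFinD leeD2r//; apply: ereal_sup_ubound; by exists (pickle r).
  rewrite /supell; case: ifPn => [/set_mem yY|/negP yY].
    by apply: ge_ereal_sup => _ [u _ <-]; exact: qle.
  apply: (@le_trans _ _ (`|dell j y (q 0%N)|%:E)); first by rewrite lee_fin.
  by apply: ereal_sup_ubound; exists 0%N.
rewrite (_ : supell j = (fun y => esups (fun n => `|dell j y (q n)|%:E) 0%N)); last exact/funext.
apply: (measurable_fun_esups (f := fun n y => `|dell j y (q n)|%:E)) => n.
by apply/measurable_EFinP; apply: measurableT_comp => //; exact: measurable_dell.
Qed.

Lemma ell2_le0 y u : Yset y -> (ell y)^`(2)%classic u <= 0.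
Proof.
move=> /Hell[D _ cc]; apply: concave_derive2_le0 => //; first exact: (D 0%N).
exact: (D 1%N).
Qed.

Lemma le_fine_supderiv j y u : (supderiv ell j y < +oo)%E ->
  `|(ell y)^`(j)%classic u| <= fine (supderiv ell j y).
Proof.
move=> fS; rewrite -lee_fin fineK ?le_supderiv// ge0_fin_numE//.
exact: supderiv_ge0.
Qed.

(** Linear in the increment, hence meant for large |v - u|; [taylor_bound3] is quadratic and meant
    for small ones. Their combination produces the factor min(2, |v - u|). *)
Lemma taylor_bound2 y u v : Yset y -> (supderiv ell 2 y < +oo)%E ->
  `|(ell y)^`()%classic v - (ell y)^`()%classic u - (ell y)^`(2)%classic u * (v - u)| <=
  `|v - u| * (2 * fine (supderiv ell 2 y)).
Proof.
move=> yY fS; have [D _ _] := Hell yY.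
have [c [_ ->]] := mean_value u v (D 1%N isT).
rewrite -derive1nS -mulrBl normrM mulrC ler_wpM2l//.
apply: le_trans (ler_normB _ _) _.
by rewrite mulr_natl mulr2n; apply: lerD; exact: le_fine_supderiv.
Qed.

Lemma taylor_bound3 y u v : Yset y -> (supderiv ell 3 y < +oo)%E ->
  `|(ell y)^`()%classic v - (ell y)^`()%classic u - (ell y)^`(2)%classic u * (v - u)| <=
  `|v - u| * (fine (supderiv ell 3 y) * `|v - u|).
Proof.
move=> yY fS; have [D _ _] := Hell yY.
have [c [cu ->]] := mean_value u v (D 1%N isT).
rewrite -derive1nS -mulrBl normrM mulrC ler_wpM2l//.
have [c' [_ ->]] := mean_value u c (D 2%N isT).
rewrite -derive1nS normrM; apply: ler_pM => //.
exact: le_fine_supderiv.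
Qed.

End LossDerivatives.

(** * Conditional moments *)

Section ConditionalMoments.
Context {R : realType} {d : measure_display} {Omega : measurableType d}.
Variable P : probability Omega R.
Variable X : Omega -> L2path R.
Hypothesis mX : measurable_fun setT X.

Let mpre A : measurable A -> measurable (X @^-1` A).
Proof. by move=> mA; rewrite -[Y in measurable Y]setTI; exact: mX. Qed.

Lemma cond_exp_le (Z : Omega -> \bar R) g (c : R) : 0 <= c -> cond_exp P X Z g ->
  {ae P, forall w, (g (X w) <= c%:E)%E} ->
  forall A, measurable A ->
  (\int[P]_(w in X @^-1` A) Z w <= \int[P]_(w in X @^-1` A) c%:E)%E.
Proof.
move=> c0 [_ mg H] gc A mA; rewrite H// integralE.
have mgX : measurable_fun (X @^-1` A) (fun w => g (X w)).
  exact/measurable_funTS/measurableT_comp.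
(* g has no prescribed sign or integrability, but its positive part is still at most c almost
   surely, as c >= 0. *)
apply: (@le_trans _ _ (\int[P]_(w in X @^-1` A) ((fun w => g (X w)) ^\+ w))%E).
  by rewrite geeDl// leeNl oppe0; apply: integral_ge0.
apply: ae_ge0_le_integral => //; first exact: mpre.
- exact: measurable_funepos.
apply: filterS gc => w gw _; rewrite funeposE ge_max gw lee_fin c0//.
Qed.

Variables (S : Omega -> \bar R) (C0 C1 : R).
Hypotheses (mS : measurable_fun setT S) (S0 : forall w, (0 <= S w)%E).
Hypotheses (C00 : 0 < C0) (C10 : 0 < C1).
Variable g : L2path R -> \bar R.
Hypothesis Hg : cond_exp P X (fun w => expeR (S w * (C0^-1)%:E)%E) g.
Hypothesis gC : {ae P, forall w, (g (X w) <= C1%:E)%E}.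

Lemma sqr_le_expeR (x : \bar R) : (0 <= x)%E ->
  (((fine x) ^+ 2)%:E <= (2 * C0 ^+ 2)%:E * expeR (x * (C0^-1)%:E))%E.
Proof.
(* At +oo, [fine] is 0 and the bound is trivial; [ae_lty] shows that S takes this value with
   probability 0. *)
case: x => [r| |]//= r0; last first.
  rewrite expr0n /=; apply: mule_ge0; last exact: expeR_ge0.
  by rewrite lee_fin mulr_ge0// sqr_ge0.
rewrite -EFinM lee_fin; have y0 : 0 <= r / C0 by rewrite divr_ge0// ltW.
have := expR_ge1Dxn 1 y0 => h.
apply: (@le_trans _ _ (2 * C0 ^+ 2 * ((r / C0) ^+ 2 / 2`!%:R))).
  rewrite le_eqVlt; apply/orP; left; apply/eqP.
  by rewrite (_ : 2`!%:R = 2 :> R)//; field; rewrite gt_eqF.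
rewrite ler_wpM2l//; first by rewrite mulr_ge0// sqr_ge0.
by apply: le_trans h; rewrite lerDr.
Qed.

Lemma cond_square_le A : measurable A ->
  (\int[P]_(w in X @^-1` A) ((fine (S w)) ^+ 2)%:E <=
   \int[P]_(w in X @^-1` A) (2 * C0 ^+ 2 * C1)%:E)%E.
Proof.
move=> mA; have me : measurable_fun setT (fun w => expeR (S w * (C0^-1)%:E)%E).
  by have [[/integrableP[]|[]]] := Hg.
apply: (@le_trans _ _ (\int[P]_(w in X @^-1` A) ((2 * C0 ^+ 2)%:E * expeR (S w * (C0^-1)%:E)))%E).
  apply: ge0_le_integral => //; first exact: mpre.
  - by move=> w _; rewrite lee_fin sqr_ge0.
  - apply/measurable_EFinP/measurable_funX; apply: (measurable_comp (F := setT)) => //.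
    exact: measurable_funTS.
  - by apply/measurable_funeM/measurable_funTS.
  - by move=> w _; exact: sqr_le_expeR.
have c0 : 0 <= 2 * C0 ^+ 2 by rewrite mulr_ge0// sqr_ge0.
rewrite ge0_integralZl//; last 3 first.
- exact: mpre.
- exact: measurable_funTS.
- by move=> w _; exact: expeR_ge0.
have := cond_exp_le (ltW C10) Hg gC mA.
rewrite integral_cst; last exact: mpre.
rewrite integral_cst; last exact: mpre.
by move=> h; rewrite [(_ * C1)%:E]EFinM -[leRHS]muleA; apply: lee_wpmul2l.
Qed.

(** The conditional exponential moment is only used in this form: inside any expectation against a
    function of X, the square of the supremum acts as a constant. *)
Lemma moment_square_le (phi : L2path R -> R) : measurable_fun setT phi -> (forall x, 0 <= phi x) ->
  (\int[P]_w ((fine (S w)) ^+ 2 * phi (X w))%:E <=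
   (2 * C0 ^+ 2 * C1)%:E * \int[P]_w (phi (X w))%:E)%E.
Proof.
move=> mphi phi0.
have c0 : 0 <= 2 * C0 ^+ 2 * C1 by rewrite mulr_ge0 ?(ltW C10)// mulr_ge0// sqr_ge0.
have mphiX : measurable_fun setT (fun w => (phi (X w))%:E).
  by apply/measurable_EFinP; exact: measurableT_comp.
rewrite -ge0_integralZl//; last by move=> w _; rewrite lee_fin.
have := @cond_mono _ _ _ P _ _ X (fun w => ((fine (S w)) ^+ 2)%:E) (fun=> (2 * C0 ^+ 2 * C1)%:E) phi mX.
under eq_integral do rewrite -EFinM.
apply => //.
- by apply/measurable_EFinP/measurable_funX; apply: (measurable_comp (F := setT)).
- by move=> w; rewrite lee_fin sqr_ge0.
- by move=> A mA; exact: cond_square_le.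
Qed.

Lemma ae_lty : {ae P, forall w, (S w < +oo)%E}.
Proof.
have me : measurable_fun setT (fun w => expeR (S w * (C0^-1)%:E)%E).
  by have [[/integrableP[]|[]]] := Hg.
have int : P.-integrable setT (fun w => expeR (S w * (C0^-1)%:E)%E).
  apply/integrableP; split => //.
  under eq_integral do rewrite gee0_abs ?expeR_ge0//.
  have := cond_exp_le (ltW C10) Hg gC measurableT; rewrite preimage_setT => h.
  apply: (le_lt_trans h); rewrite integral_cst// [X in (_ * X)%E](probability_setT P).
  by rewrite mule1 ltry.
apply: filterS (integrable_ae measurableT int) => w /(_ I).
case: (S w) (S0 w) => [r| |]//; first by rewrite ltry.
by rewrite mulyr gtr0_sg ?invr_gt0// mul1e.
Qed.

End ConditionalMoments.

Section Curvature.
Context {R : realType} {d : measure_display} {Omega : measurableType d}.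
Variable P : probability Omega R.
Variables (X : Omega -> L2path R) (B : L2path R -> R) (Z : Omega -> R).
Hypotheses (mX : measurable_fun setT X) (mB : measurable_fun setT B).
Hypotheses (mZ : measurable_fun setT Z) (Z0 : forall w, Z w <= 0).
Hypothesis HB : cond_exp P X (fun w => (Z w)%:E) (fun x => (- B x)%:E).
Hypothesis B0 : {ae P, forall w, 0 <= B (X w)}.

(** [cond_eq] asks for variables that are nonnegative everywhere, while B(X) is so only almost
    surely; hence the detour through max(B, 0). *)
Lemma curvature_eq (phi : L2path R -> R) : measurable_fun setT phi -> (forall x, 0 <= phi x) ->
  (\int[P]_w ((- Z w) * phi (X w))%:E = \int[P]_w (B (X w) * phi (X w))%:E)%E.
Proof.
move=> mphi phi0; have [_ _ H] := HB.
have mb : measurable_fun setT (fun w => B (X w)) by exact: measurableT_comp.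
have mbp : measurable_fun setT (fun w => Num.max (B (X w)) 0) by exact: measurable_maxr.
have bE : {ae P, forall w, B (X w) = Num.max (B (X w)) 0}.
  by apply: filterS B0 => w; rewrite /Num.max ltNge => ->.
have mphiX : measurable_fun setT (fun w => phi (X w)) by exact: measurableT_comp.
transitivity (\int[P]_w (Num.max (B (X w)) 0 * phi (X w))%:E)%E; last first.
  apply: ae_eq_integral => //; try (by apply/measurable_EFinP/measurable_funM).
  by apply: filterS bE => w bw _; rewrite -bw.
have := @cond_eq _ _ _ P _ _ X (fun w => (- Z w)%:E) (fun w => (Num.max (B (X w)) 0)%:E) phi mX.
move=> E; have -> : forall f g : Omega -> R, (\int[P]_w (f w * g w)%:E = \int[P]_w ((f w)%:E * (g w)%:E))%E.
  by move=> f f'; apply: eq_integral.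
rewrite E//.
- exact/measurable_EFinP/measurable_funN.
- by move=> w; rewrite lee_fin oppr_ge0.
- exact/measurable_EFinP.
- by move=> w; rewrite lee_fin le_max lexx orbT.
move=> A mA.
have mXA : measurable (X @^-1` A) by rewrite -[Y in measurable Y]setTI; exact: mX.
transitivity (- \int[P]_(w in X @^-1` A) (Z w)%:E)%E.
  rewrite (_ : (fun w => (Z w)%:E) = (fun w => - (- Z w)%:E)%E); last first.
    by apply/funext => w; rewrite -EFinN opprK.
  by rewrite integral_ge0N ?oppeK// => w _; rewrite lee_fin oppr_ge0.
rewrite H//.
transitivity (- \int[P]_(w in X @^-1` A) - (Num.max (B (X w)) 0)%:E)%E; last first.
  by rewrite integral_ge0N ?oppeK// => w _; rewrite lee_fin le_max lexx orbT.
congr (- _)%E; apply: ae_eq_integral => //.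
- exact/measurable_funTS/measurable_EFinP/measurable_funN.
- by apply: measurableT_comp => //; exact/measurable_funTS/measurable_EFinP.
- by apply: filterS bE => w bw _; rewrite EFinN -bw.
Qed.

End Curvature.

(** * Deviations of empirical moments *)

Lemma weighted_cauchy_schwarz (R : realType) (I : finType) (g a b : I -> R) :
  (forall i, 0 < g i) ->
  (\sum_i a i * b i) ^+ 2 <= (\sum_i (a i) ^+ 2 / g i) * (\sum_i g i * (b i) ^+ 2).
Proof.
move=> g0; have g0' i : 0 <= g i by exact: ltW.
apply: discriminant_le.
- by apply: sumr_ge0 => i _; rewrite divr_ge0// sqr_ge0.
- by apply: sumr_ge0 => i _; rewrite mulr_ge0// sqr_ge0.
move=> t; have -> : \sum_i (a i) ^+ 2 / g i + 2 * t * (\sum_i a i * b i) +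
    t ^+ 2 * (\sum_i g i * (b i) ^+ 2) = \sum_i (a i + t * g i * b i) ^+ 2 / g i.
  rewrite !mulr_sumr -!big_split; apply: eq_bigr => i _ /=.
  by field; rewrite gt_eqF.
by apply: sumr_ge0 => i _; rewrite divr_ge0// sqr_ge0.
Qed.

Section FiniteSums.
Context d (T : measurableType d) (R : realType) (mu : {measure set T -> \bar R}).

Lemma integrable_ord_sum n (F : 'I_n -> T -> R) :
  (forall i, mu.-integrable setT (EFin \o F i)) ->
  mu.-integrable setT (EFin \o (fun w => \sum_i F i w)).
Proof.
move=> H; have := @integrable_sum _ _ _ mu setT measurableT _ (index_enum 'I_n) xpredT (fun i => EFin \o F i).
move=> /(_ (fun i _ => H i)); congr (integrable _ _ _); apply/funext => w.
by rewrite /= sumEFin.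
Qed.

Lemma Rintegral_ord_sum n (F : 'I_n -> T -> R) :
  (forall i, mu.-integrable setT (EFin \o F i)) ->
  \int[mu]_w (\sum_i F i w) = \sum_i \int[mu]_w F i w.
Proof.
elim: n F => [|n IH] F H.
  rewrite big_ord0; transitivity (\int[mu]_(w in setT) (0 : R)).
    by apply: eq_Rintegral => w _; rewrite big_ord0.
  by rewrite /Rintegral integral0.
rewrite big_ord_recr /= -IH// -RintegralD//; last exact: integrable_ord_sum.
by apply: eq_Rintegral => w _; rewrite big_ord_recr.
Qed.

End FiniteSums.

Section Events.
Context {R : realType} {d : measure_display} {Omega : measurableType d}.
Variable P : probability Omega R.

Lemma markov_ge0 (f : Omega -> R) (t b : R) : 0 < t -> measurable_fun setT f ->
  (forall w, 0 <= f w) -> (\int[P]_w (f w)%:E <= b%:E)%E ->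
  (P [set w | (t < f w)%R] <= (b / t)%:E)%E.
Proof.
move=> t0 mf f0 fb.
have mA : measurable [set w | (t < f w)%R] by exact: measurable_layer.
have : (t%:E * P [set w | (t < f w)%R] <= b%:E)%E.
  apply: le_trans fb; rewrite -[X in (t%:E * P X)%E]setIT -(integral_indic P measurableT mA).
  rewrite -ge0_integralZl//; first last.
  - by rewrite lee_fin ltW.
  - exact/measurable_EFinP/measurable_indic.
  apply: ge0_le_integral => //.
  - by move=> w _; rewrite mule_ge0// lee_fin ltW.
  - exact/measurable_funeM/measurable_EFinP/measurable_indic.
  - exact/measurable_EFinP.
  move=> w _; rewrite indicE -EFinM lee_fin; case: (boolP (w \in _)) => [/set_mem/= h|_].
    by rewrite mulr1 ltW.
  by rewrite mulr0.
have : P [set w | (t < f w)%R] \is a fin_num by exact: fin_num_measure.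
move=> /fineK <-; rewrite -EFinM !lee_fin => h.
by rewrite ler_pdivlMr// mulrC.
Qed.

(** The intersections over N >= M increase with M and each has probability at most b, so the union
    keeps the bound: no sum over N appears. *)
Lemma eventually_event_le (E : nat -> set Omega) (b : \bar R) :
  (forall N, measurable (E N)) -> (forall N, (P (E N) <= b)%E) ->
  measurable (\bigcup_M \bigcap_(N in [set N | (M <= N)%N]) E N) /\
  (P (\bigcup_M \bigcap_(N in [set N | (M <= N)%N]) E N) <= b)%E.
Proof.
move=> mE Eb; pose F M := \bigcap_(N in [set N | (M <= N)%N]) E N.
have mF M : measurable (F M) by apply: bigcap_measurable => //; exists M => /=.
have mU : measurable (\bigcup_M F M) by exact: bigcupT_measurable.
split=> //; have := @nondecreasing_cvg_mu _ _ _ P F mF mU.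
have nd : nondecreasing_seq F.
  by move=> M M' MM'; apply/subsetPset => w h N /= MN; apply: h; exact: leq_trans MN.
move=> /(_ nd) h; apply: cvge_le h; apply: nearW => M /=.
apply: le_trans (Eb M); apply: le_measure; rewrite ?inE//.
by move=> w; apply => /=.
Qed.

End Events.

Section Deviation.
Context {R : realType} {d dT : measure_display} {Omega : measurableType d}.
Context {T : measurableType dT}.
Variable P : probability Omega R.
Variables (Z : nat -> Omega -> T) (Z0 : Omega -> T).
Hypotheses (mZ : forall i, measurable_fun setT (Z i)) (mZ0 : measurable_fun setT Z0).
Hypotheses (ind : mutually_independent P Z) (ide : identically_distributed P Z Z0).
Variables (om : T -> R) (x : nat -> T -> R) (ga : nat -> R) (K : R).
Hypotheses (mom : measurable_fun setT om) (mx : forall nu, measurable_fun setT (x nu)).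
Hypothesis ga0 : forall nu, 0 < ga nu.
Hypothesis HK : forall nu mu,
  (\int[P]_w ((om (Z0 w) * x nu (Z0 w) * x mu (Z0 w)) ^+ 2)%:E <= K%:E)%E.

Let f nu mu z := om z * x nu z * x mu z.

Definition moment_dev n nu mu w : R :=
  n%:R^-1 * (\sum_(i < n) om (Z i w) * x nu (Z i w) * x mu (Z i w)) -
  \int[P]_w (om (Z0 w) * x nu (Z0 w) * x mu (Z0 w)).

(** The squared Hilbert-Schmidt norm, in the basis normalized by ga, of the difference between the
    empirical and the population quadratic form with weight om. There are N.+1 indices because 0
    stands for the intercept. *)
Definition total_dev n N w : R :=
  \sum_(nu < N.+1) \sum_(mu < N.+1) (moment_dev n nu mu w) ^+ 2 / (ga nu * ga mu).

Let mf nu mu : measurable_fun setT (f nu mu).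
Proof. by apply: measurable_funM => //; apply: measurable_funM. Qed.

Lemma L2_moment nu mu : L2on P setT (f nu mu \o Z0).
Proof.
by split; [exact: measurableT_comp|apply: le_lt_trans (HK nu mu) _; exact: ltry].
Qed.

Lemma measurable_moment_dev n nu mu : measurable_fun setT (moment_dev n nu mu).
Proof.
apply: measurable_funB => //; apply: measurable_funM => //.
apply: measurable_sum => i; exact: (measurableT_comp (mf nu mu) (mZ i)).
Qed.

Lemma measurable_total_dev n N : measurable_fun setT (total_dev n N).
Proof.
apply: measurable_sum => nu; apply: measurable_sum => mu.
by apply: measurable_funM => //; apply: measurable_funX; exact: measurable_moment_dev.
Qed.

Lemma total_dev_ge0 n N w : 0 <= total_dev n N w.
Proof.
apply: sumr_ge0 => nu _; apply: sumr_ge0 => mu _.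
by rewrite divr_ge0 ?sqr_ge0// mulr_ge0// ltW.
Qed.

(** Each entry has variance at most K / n, and the double sum of the weights 1 / (ga nu ga mu)
    factors into a square. *)
Lemma total_dev_moment n N : (0 < n)%N ->
  (\int[P]_w (total_dev n N w)%:E <= (n%:R^-1 * K * (\sum_(nu < N.+1) (ga nu)^-1) ^+ 2)%:E)%E.
Proof.
move=> n0; have mdev nu mu := measurable_moment_dev n nu mu.
have mt nu mu : measurable_fun setT (fun w => (moment_dev n nu mu w ^+ 2 / (ga nu * ga mu))%:E).
  by apply/measurable_EFinP/measurable_funM => //; exact: measurable_funX.
have pt nu mu w : (0 <= (moment_dev n nu mu w ^+ 2 / (ga nu * ga mu))%:E)%E.
  by rewrite lee_fin divr_ge0 ?sqr_ge0// mulr_ge0// ltW.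
have -> : (\int[P]_w (total_dev n N w)%:E = \sum_(nu < N.+1) \sum_(mu < N.+1)
    \int[P]_w (moment_dev n nu mu w ^+ 2 / (ga nu * ga mu))%:E)%E.
  transitivity (\int[P]_w (\sum_(nu < N.+1) \sum_(mu < N.+1)
      (moment_dev n nu mu w ^+ 2 / (ga nu * ga mu))%:E))%E.
    apply: eq_integral => w _; rewrite /total_dev -sumEFin; apply: eq_bigr => nu _.
    by rewrite -sumEFin.
  rewrite (ge0_integral_sum _ measurableT (f := fun (nu : 'I_N.+1) w => (\sum_(mu < N.+1)
      (moment_dev n nu mu w ^+ 2 / (ga nu * ga mu))%:E)%E)).
  - apply: eq_bigr => nu _.
    by rewrite (ge0_integral_sum _ measurableT (f := fun (mu : 'I_N.+1) w =>
      (moment_dev n nu mu w ^+ 2 / (ga nu * ga mu))%:E)).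
  - by move=> nu; apply: emeasurable_sum.
  - by move=> nu w _; apply: sume_ge0.
rewrite [leRHS](_ : _ = (\sum_(nu < N.+1) \sum_(mu < N.+1) (n%:R^-1 * K / (ga nu * ga mu))%:E)%E); last first.
  rewrite expr2 mulr_suml mulr_sumr -sumEFin; apply: eq_bigr => nu _.
  rewrite !mulr_sumr -sumEFin; apply: eq_bigr => mu _.
  by rewrite invfM.
apply: lee_sum => nu _; apply: lee_sum => mu _.
have g0 : 0 < ga nu * ga mu by rewrite mulr_gt0.
under eq_integral do rewrite mulrC EFinM.
rewrite ge0_integralZl//; last 3 first.
- by apply/measurable_EFinP; exact: measurable_funX.
- by move=> w _; rewrite lee_fin sqr_ge0.
- by rewrite lee_fin invr_ge0 ltW.
rewrite [_ / (ga _ * _)]mulrC [in leRHS]EFinM; apply: lee_wpmul2l; first by rewrite lee_fin invr_ge0 ltW.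
apply: le_trans (average_variance mZ mZ0 ind ide (mf nu mu) (L2_moment nu mu) n0) _.
rewrite lee_fin ler_pM2l ?invr_gt0 ?ltr0n// -lee_fin -(L2_sqrE (L2_moment nu mu)).
exact: HK.
Qed.

(** Cauchy-Schwarz over pairs of indices: the Hilbert-Schmidt norm dominates the form. The sample
    point w is fixed, so c and c' may be chosen depending on it; this is what allows random
    directions. *)
Lemma deviation_form n N w (c c' : nat -> R) :
  (n%:R^-1 * (\sum_(i < n) om (Z i w) * (\sum_(nu < N.+1) c nu * x nu (Z i w)) *
     (\sum_(nu < N.+1) c' nu * x nu (Z i w))) -
   \int[P]_w (om (Z0 w) * (\sum_(nu < N.+1) c nu * x nu (Z0 w)) *
     (\sum_(nu < N.+1) c' nu * x nu (Z0 w)))) ^+ 2 <=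
  total_dev n N w * ((\sum_(nu < N.+1) ga nu * (c nu) ^+ 2) *
                     (\sum_(nu < N.+1) ga nu * (c' nu) ^+ 2)).
Proof.
have E z : om z * (\sum_(nu < N.+1) c nu * x nu z) * (\sum_(nu < N.+1) c' nu * x nu z) =
    \sum_(nu < N.+1) \sum_(mu < N.+1) c nu * c' mu * f nu mu z.
  rewrite -mulrA mulr_suml mulr_sumr; apply: eq_bigr => nu _.
  by rewrite !mulr_sumr; apply: eq_bigr => mu _; rewrite /f; ring.
have intf nu mu : P.-integrable setT (EFin \o (f nu mu \o Z0)) := L2_int (L2_moment nu mu).
have intc nu mu : P.-integrable setT (EFin \o (fun w => c nu * c' mu * f nu mu (Z0 w))).
  exact: (integrableZl measurableT (c nu * c' mu) (intf nu mu)).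
have -> : \int[P]_w (om (Z0 w) * (\sum_(nu < N.+1) c nu * x nu (Z0 w)) *
     (\sum_(nu < N.+1) c' nu * x nu (Z0 w))) =
   \sum_(nu < N.+1) \sum_(mu < N.+1) c nu * c' mu * \int[P]_w f nu mu (Z0 w).
  transitivity (\int[P]_w (\sum_(nu < N.+1) \sum_(mu < N.+1) c nu * c' mu * f nu mu (Z0 w))).
    by apply: eq_Rintegral => w' _; exact: E.
  rewrite Rintegral_ord_sum; last by move=> nu; exact: integrable_ord_sum.
  apply: eq_bigr => nu _; rewrite Rintegral_ord_sum//; apply: eq_bigr => mu _.
  by rewrite RintegralZl//; exact: (intf nu mu).
have -> : n%:R^-1 * (\sum_(i < n) om (Z i w) * (\sum_(nu < N.+1) c nu * x nu (Z i w)) *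
     (\sum_(nu < N.+1) c' nu * x nu (Z i w))) =
   \sum_(nu < N.+1) \sum_(mu < N.+1) c nu * c' mu * (n%:R^-1 * \sum_(i < n) f nu mu (Z i w)).
  under eq_bigr do rewrite E.
  rewrite exchange_big mulr_sumr; apply: eq_bigr => nu _ /=.
  rewrite exchange_big mulr_sumr; apply: eq_bigr => mu _ /=.
  by rewrite -mulr_sumr; ring.
rewrite -sumrB.
under eq_bigr do (rewrite -sumrB; under eq_bigr do rewrite -mulrBr).
rewrite pair_bigA /= /total_dev pair_bigA /=.
have gg nu mu : 0 < ga nu * ga mu by rewrite mulr_gt0.
have wcs := weighted_cauchy_schwarz (fun p : 'I_N.+1 * 'I_N.+1 => moment_dev n p.1 p.2 w)
  (fun p => c p.1 * c' p.2) (fun p => gg p.1 p.2).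
under [X in X ^+ 2 <= _]eq_bigr do rewrite mulrC.
apply: (le_trans wcs); rewrite le_eqVlt; apply/orP; left; apply/eqP; congr (_ * _).
rewrite mulr_suml -(pair_bigA _ (fun nu mu : 'I_N.+1 => ga nu * ga mu * (c nu * c' mu) ^+ 2)) /=.
apply: eq_bigr => nu _; rewrite mulr_sumr; apply: eq_bigr => mu _; ring.
Qed.

End Deviation.

(** The comparison of (b - a) b^(-p) with the integral of x^(-p) from a to b, obtained without
    integration from ln (b / a) >= (b - a) / b and expR x >= 1 + x. *)
Lemma powR_gap (R : realType) (a b p : R) : 0 < a -> 0 < b -> 1 < p ->
  (p - 1) * (b - a) * b `^ (- p) <= a `^ (1 - p) - b `^ (1 - p).
Proof.
move=> a0 b0 p1; have p10 : 0 < p - 1 by rewrite subr_gt0.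
have -> : a `^ (1 - p) = b `^ (1 - p) * expR ((p - 1) * ln (b / a)).
  rewrite /powR !gt_eqF// -expRD; congr expR.
  by rewrite ln_div// ; ring.
have -> : b `^ (- p) = b `^ (1 - p) / b.
  rewrite (_ : b `^ (- p) = b `^ ((1 - p) + (- 1))); last by congr (_ `^ _); ring.
  have bn : (1 - p - 1 == 0) ==> (b != 0) by rewrite (gt_eqF b0) implybT.
  by rewrite (powRD bn) (powR_inv1 (ltW b0)).
have l : (b - a) / b <= ln (b / a).
  have ab : 0 < a / b by rewrite divr_gt0.
  have : ln (1 + (a / b - 1)) <= a / b - 1 by apply: le_ln1Dx; lra.
  rewrite addrC subrK ln_div// ln_div// => h.
  by rewrite mulrBl divff ?gt_eqF//; lra.
have e := expR_ge1Dx ((p - 1) * ln (b / a)).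
have b1 : 0 < b `^ (1 - p) by exact: powR_gt0.
have : (p - 1) * ((b - a) / b) <= expR ((p - 1) * ln (b / a)) - 1.
  by apply: (@le_trans _ _ ((p - 1) * ln (b / a))); [rewrite ler_pM2l|rewrite lerBrDl].
rewrite -(ler_pM2l b1) mulrBr mulr1; apply: le_trans.
by rewrite le_eqVlt; apply/orP; left; apply/eqP; ring.
Qed.

Lemma powR_sum_le (R : realType) (h p : R) N : 0 < h -> 1 < p ->
  \sum_(nu < N) (1 + h * nu.+1%:R) `^ (- p) <= ((p - 1) * h)^-1.
Proof.
move=> h0 p1; have p10 : 0 < p - 1 by rewrite subr_gt0.
have ph : 0 < (p - 1) * h by rewrite mulr_gt0.
have pos k : 0 < 1 + h * k%:R by rewrite ltr_wpDr// mulr_ge0// ltW.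
(* The right-hand side is sharpened to the telescoping value so that the induction goes through. *)
suff : (p - 1) * h * \sum_(nu < N) (1 + h * nu.+1%:R) `^ (- p) <= 1 - (1 + h * N%:R) `^ (1 - p).
  move=> H; rewrite -(ler_pM2l ph) mulfV ?gt_eqF//; apply: (le_trans H).
  by rewrite gerBl powR_ge0.
elim: N => [|N IH]; first by rewrite big_ord0 mulr0 mulr0 addr0 powR1 subrr.
rewrite big_ord_recr /= mulrDr.
have := powR_gap (pos N) (pos N.+1) p1.
rewrite (_ : 1 + h * N.+1%:R - (1 + h * N%:R) = h); last by rewrite -natr1; ring.
by move: IH; lra.
Qed.

Lemma cvg_ord_sum (R : realType) k (u : 'I_k -> nat -> R) (l : 'I_k -> R) :
  (forall i, u i N @[N --> \oo] --> l i) -> \sum_i u i N @[N --> \oo] --> \sum_i l i.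
Proof.
elim: k u l => [|k IH] u l H.
  rewrite big_ord0; under eq_fun do rewrite big_ord0; exact: cvg_cst.
rewrite big_ord_recr; under eq_fun do rewrite big_ord_recr /=.
by apply: cvgD => //; apply: IH => i; exact: H.
Qed.

Lemma frequently_le (R : realType) (u : nat -> R) (l K : R) : u N @[N --> \oo] --> l ->
  (forall M, exists2 N, (M <= N)%N & u N <= K) -> l <= K.
Proof.
move=> ul H; rewrite leNgt; apply/negP => Kl.
have [M _ HM] := cvgr_gt l ul K Kl; have [N MN uN] := H M.
by have := HM N MN; rewrite ltNge uN.
Qed.

Lemma sum_weighted_cauchy_schwarz (R : realType) n (om' a b : 'I_n -> R) : (forall i, 0 <= om' i) ->
  (\sum_i om' i * a i * b i) ^+ 2 <= (\sum_i om' i * a i ^+ 2) * (\sum_i om' i * b i ^+ 2).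
Proof.
move=> o0; apply: discriminant_le; try by apply: sumr_ge0 => i _; rewrite mulr_ge0 ?sqr_ge0.
move=> t; rewrite (_ : _ + _ + _ = \sum_i om' i * (a i + t * b i) ^+ 2).
  by apply: sumr_ge0 => i _; rewrite mulr_ge0 ?sqr_ge0.
by rewrite !mulr_sumr -!big_split; apply: eq_bigr => i _ /=; ring.
Qed.

(** * Geometry of the penalized inner product *)

Section L2CauchySchwarz.
Context d (T : measurableType d) (R : realType) (mu : {measure set T -> \bar R}).
Variables (D : set T) (mD : measurable D).

Lemma ipon_cauchy_schwarz (f g : T -> R) : L2on mu D f -> L2on mu D g ->
  (ipon mu D f g) ^+ 2 <= ipon mu D f f * ipon mu D g g.
Proof.
move=> f2 g2; apply: discriminant_le; [exact: ipon_ge0|exact: ipon_ge0|move=> t].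
rewrite (_ : _ + _ + _ = ipon mu D (fun x => t * g x + f x) (fun x => t * g x + f x)).
  exact: ipon_ge0.
have tgf : L2on mu D (fun x => t * g x + f x) by exact: L2on_lin.
rewrite ipon_linl// !(iponC _ _ _ (fun x => t * g x + f x)) !ipon_linl//.
by rewrite (iponC _ _ f g); ring.
Qed.

End L2CauchySchwarz.

Section Geometry.
Context {R : realType} {d : measure_display} {Omega : measurableType d}.
Variables (P : probability Omega R) (X : Omega -> L2path R) (B : L2path R -> R).
Variables (m : nat) (m0 : (0 < m)%N) (C2 : R).
Hypotheses (pX : L2process X) (mB : measurable_fun setT B) (C20 : 0 < C2).
Hypothesis BC : {ae P, forall w, C2^-1 <= B (X w) /\ B (X w) <= C2}.
Hypothesis BX0 : forall t, t \in `[0%R, 1%R] -> ('E_P[fun w => (B (X w) * X w t)%R] = 0)%E.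
Hypothesis BXX : forall s t, s \in `[0%R, 1%R] -> t \in `[0%R, 1%R] ->
  P.-integrable setT (fun w => (B (X w) * X w s * X w t)%:E).
Hypothesis Cc : {within (`[(0%R : R), (1%R : R)]%classic) `*` (`[(0%R : R), (1%R : R)]%classic),
  continuous (fun p : R * R => Cov P X B p.1 p.2)}.
Implicit Types (b f g : R -> R) (theta : R * (R -> R)).
Local Notation mu := (@lebesgue_measure R).
Local Notation I01 := (`[(0%R : R), (1%R : R)]%classic).

Let bx w := B (X w).

Lemma measurable_BX : measurable_fun setT bx.
Proof. by apply: measurableT_comp; [exact: mB|exact: measurable_L2path]. Qed.

Lemma L2_BM (u : Omega -> R) : L2on P setT u -> L2on P setT (fun w => bx w * u w).
Proof.
move=> [mf fi]; have mbf : measurable_fun setT (fun w => bx w * u w).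
  by apply: measurable_funM => //; exact: measurable_BX.
split => //.
apply: (@le_lt_trans _ _ (\int[P]_w ((C2 ^+ 2)%:E * (u w ^+ 2)%:E))%E).
  apply: ae_ge0_le_integral => //.
  - by move=> w _; rewrite lee_fin sqr_ge0.
  - by apply/measurable_EFinP/measurable_funX.
  - by move=> w _; rewrite -EFinM lee_fin mulr_ge0 ?sqr_ge0.
  - by apply/measurable_funeM/measurable_EFinP/measurable_funX.
  - apply: filterS BC => w [h1 h2] _; rewrite -EFinM lee_fin exprMn ler_wpM2r ?sqr_ge0//.
    rewrite ler_sqr ?nnegrE ?(ltW C20)// (le_trans _ h1)// invr_ge0 ltW//.
rewrite ge0_integralZl//; last 3 first.
- by apply/measurable_EFinP/measurable_funX.
- by move=> w _; rewrite lee_fin sqr_ge0.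
- by rewrite lee_fin sqr_ge0.
by rewrite lte_mul_pinfty// lee_fin sqr_ge0.
Qed.

Lemma L2_BX : L2on P setT bx.
Proof.
by apply: eq_L2on (L2_BM (L2_cst P 1)) => w; rewrite mulr1.
Qed.

(** Continuity of C on the compact square bounds the diagonal C(t, t) = E B X(t)^2, and B is bounded
    below. This uniform bound feeds every use of Fubini below. *)
Lemma Xt_energy : exists K : R, forall t, t \in `[0%R, 1%R] ->
  (\int[P]_w ((X w t) ^+ 2)%:E <= K%:E)%E.
Proof.
have cI : compact (I01 `*` I01) by apply: compact_setX; exact: segment_compact.
have [K [_ HK]] := compact_bounded (continuous_compact Cc cI).
(* [compact_bounded] gives every bound above K, whence K + 1; the factor C2 undoes the weight B >= 1
   / C2. *)
exists (C2 * (K + 1)) => t tI.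
have [mX _] := pX.
have mXt : measurable_fun setT (fun w => X w t).
  rewrite (_ : (fun w => X w t) = (fun p : Omega * R => X p.1 p.2) \o (fun w => (w, t)))//.
  apply: (measurable_comp (F := [set: Omega] `*` I01)) => //.
  - exact: measurableX.
  - by move=> _ [w _ <-].
have -> : (C2 * (K + 1))%:E = (C2%:E * (K + 1)%:E)%E by [].
apply: (@le_trans _ _ (C2%:E * \int[P]_w `|(bx w * X w t * X w t)%:E|)%E); last first.
  apply: lee_wpmul2l; first by rewrite lee_fin ltW.
  have CK : `|Cov P X B t t| <= K + 1.
    apply: HK; first by rewrite ltrDl.
    by exists (t, t).
  have -> : (\int[P]_w `|(bx w * X w t * X w t)%:E| = \int[P]_w (bx w * X w t * X w t)%:E)%E.
    have mbX : measurable_fun setT (fun w => (bx w * X w t * X w t)%:E).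
      exact: measurable_int (BXX tI tI).
    apply: ae_eq_integral => //; first exact: measurableT_comp.
    apply: filterS BC => w [h1 h2] _; rewrite /= ger0_norm// -mulrA -expr2.
    by rewrite mulr_ge0 ?sqr_ge0// (le_trans _ h1)// invr_ge0 ltW.
  rewrite -[X in (X <= _)%E]fineK; last exact: integrable_fin_num (BXX tI tI).
  by rewrite lee_fin; move: CK; rewrite /Cov unlock; apply: le_trans; exact: ler_norm.
rewrite -ge0_integralZl//; last 2 first.
- by apply: measurableT_comp => //; exact: measurable_int (BXX tI tI).
- by rewrite lee_fin ltW.
apply: ae_ge0_le_integral => //.
- by move=> w _; rewrite lee_fin sqr_ge0.
- by apply/measurable_EFinP/measurable_funX.
- by move=> w _; rewrite mule_ge0// lee_fin ltW.
- by apply: measurable_funeM; apply: measurableT_comp => //; exact: measurable_int (BXX tI tI).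
apply: filterS BC => w [h1 h2] _; rewrite -EFinM lee_fin -mulrA -expr2 normrM.
rewrite (ger0_norm (sqr_ge0 _)) mulrA ler_peMl ?sqr_ge0//.
by rewrite -[X in X <= _](mulfV (lt0r_neq0 C20)) ler_pM2l// (le_trans h1)// ler_norm.
Qed.

Lemma dotI_sqrE f : L2I f -> ((dotI f f)%:E = \int[mu]_(t in I01) ((f t) ^+ 2)%:E)%E.
Proof.
move=> lf; rewrite /dotI /intI /Rintegral fineK.
  by apply: eq_integral => t _; rewrite expr2.
apply: integrable_fin_num => //.
exact: (@L2on_mul _ _ _ mu _ _ _ _ lf lf).
Qed.

Lemma dotI_ge0 f : 0 <= dotI f f.
Proof. exact: ipon_ge0. Qed.

Lemma dotI_cauchy_schwarz f g : L2I f -> L2I g -> (dotI f g) ^+ 2 <= dotI f f * dotI g g.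
Proof. exact: (@ipon_cauchy_schwarz _ _ _ mu I01). Qed.

Lemma L2_dotX b : L2I b -> L2on P setT (fun w => dotI (X w) b).
Proof.
move=> lb; have mdb := measurable_dotI pX lb.
have [K HK] := Xt_energy; have [_ lX] := pX.
split => //.
apply: (@le_lt_trans _ _ (\int[P]_w ((dotI b b)%:E * \int[mu]_(t in I01) ((X w t) ^+ 2)%:E))%E).
  apply: ge0_le_integral => //.
  - by move=> w _; rewrite lee_fin sqr_ge0.
  - by apply/measurable_EFinP/measurable_funX.
  - by apply: measurable_funeM; exact: measurable_energy.
  - by move=> w _; rewrite -dotI_sqrE// -EFinM lee_fin mulrC dotI_cauchy_schwarz.
rewrite ge0_integralZl//.
- rewrite lte_mul_pinfty ?lee_fin ?dotI_ge0//.
  by apply: le_lt_trans (L2path_energy pX HK) (ltry _).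
- exact: measurable_energy.
- by move=> w _; apply: integral_ge0 => t _; rewrite lee_fin sqr_ge0.
- by rewrite lee_fin dotI_ge0.
Qed.

Lemma expectation_BdotX b : L2I b -> \int[P]_w (bx w * dotI (X w) b) = 0.
Proof.
move=> lb; have [K HK] := Xt_energy.
have [_ ->] := fubini_dotI pX HK L2_BX lb.
transitivity (\int[mu]_(t in I01) (0 : R)); last by rewrite /Rintegral integral0.
apply: eq_Rintegral => t /set_mem tI; rewrite -(fine_expectation P (fun w => bx w * X w t)) BX0//.
by rewrite mul0r.
Qed.

(** Fubini is applied twice: to Z = B <X,b'> against b, then, for each fixed t, to Z = b(t) B X(t)
    against b'. *)
Lemma Vform_E b b' : L2I b -> L2I b' ->
  Vform P X B b b' = \int[P]_w (bx w * dotI (X w) b' * dotI (X w) b).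
Proof.
move=> lb lb'; have [K HK] := Xt_energy.
have [_ ->] := fubini_dotI pX HK (L2_BM (L2_dotX lb')) lb.
apply: eq_Rintegral => t /set_mem tI.
have LXt := L2_Xt pX HK tI.
have LbXt : L2on P setT (fun w => b t * (bx w * X w t)).
  by apply: eq_L2on (L2on_lin measurableT (b t) (L2_BM LXt) (L2_cst P 0)) => w; rewrite addr0.
have [_ H] := fubini_dotI pX HK LbXt lb'.
transitivity (intI (fun s => \int[P]_w (b t * (bx w * X w t) * X w s) * b' s)).
  apply: eq_Rintegral => s /set_mem sI; congr (_ * _).
  rewrite /Cov fine_expectation -RintegralZr//; last exact: BXX.
  by apply: eq_Rintegral => w _; rewrite -/(bx w); ring.
rewrite -H -RintegralZr//.
  by apply: eq_Rintegral => w _; ring.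
exact: (@L2on_mul _ _ _ P _ _ _ _ (L2_BM (L2_dotX lb')) LXt).
Qed.

Lemma VformC b b' : L2I b -> L2I b' -> Vform P X B b b' = Vform P X B b' b.
Proof.
move=> lb lb'; rewrite (Vform_E lb lb') (Vform_E lb' lb).
by apply: eq_Rintegral => w _; rewrite mulrAC.
Qed.

Lemma Vform_linl r f g h : L2I f -> L2I g -> L2I h ->
  Vform P X B (fun t => r * f t + g t) h = r * Vform P X B f h + Vform P X B g h.
Proof.
move=> lf lg lh; have lfg := L2I_lin r lf lg; rewrite !Vform_E//.
have [_ lX] := pX.
pose ip := ipon P setT.
have E u : \int[P]_w (bx w * dotI (X w) h * u w) = ip u (fun w => bx w * dotI (X w) h).
  by apply: eq_Rintegral => w _; rewrite mulrC.
rewrite !E /ip -(@ipon_linl _ _ _ P setT)//; [|exact: L2_dotX|exact: L2_dotX|exact/L2_BM/L2_dotX].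
by congr ipon; apply/funext => w; rewrite dotI_linr.
Qed.

Lemma bx_ge0 : {ae P, forall w, 0 <= bx w}.
Proof.
by apply: filterS BC => w [h1 _]; rewrite (le_trans _ h1)// invr_ge0 ltW.
Qed.

Lemma ae_le_Rintegral (u v : Omega -> R) : P.-integrable setT (EFin \o u) ->
  P.-integrable setT (EFin \o v) -> {ae P, forall w, u w <= v w} ->
  \int[P]_w u w <= \int[P]_w v w.
Proof.
move=> iu iv uv; rewrite -subr_ge0 -RintegralB//.
have ivu : P.-integrable setT (EFin \o (fun w => v w - u w)).
  exact: (integrableB measurableT iv iu).
have muv := measurable_int _ ivu.
rewrite /Rintegral (ae_eq_integral (fun w => `|(v w - u w)%:E|%E))//.
- by apply: fine_ge0; exact: integral_ge0.
- exact: measurableT_comp.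
- by apply: filterS uv => w h _; rewrite /= ger0_norm// subr_ge0.
Qed.

Lemma Vform_ge0 b : L2I b -> 0 <= Vform P X B b b.
Proof.
move=> lb; rewrite Vform_E//.
have -> : 0 = \int[P]_w (0 : R) by rewrite /Rintegral integral0.
apply: ae_le_Rintegral.
- by apply: integrable0.
- exact: (@L2on_mul _ _ _ P _ _ _ _ (L2_BM (L2_dotX lb)) (L2_dotX lb)).
- by apply: filterS bx_ge0 => w h; rewrite -mulrA -expr2 mulr_ge0// sqr_ge0.
Qed.

Definition EB := \int[P]_w bx w.

Lemma EB_ge : C2^-1 <= EB.
Proof.
have -> : C2^-1 = \int[P]_w C2^-1.
  by rewrite Rintegral_cst// [X in fine X](probability_setT P) mulr1.
apply: ae_le_Rintegral.
- exact: L2_int (L2_cst P _).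
- exact: L2_int L2_BX.
- by apply: filterS BC => w [].
Qed.

(** The cross terms vanish because E B <X,b> = 0, so intercept and slope are orthogonal. This
    explains the component 1 / E B of the representer. *)
Lemma ipH_E lam theta theta' : L2I theta.2 -> L2I theta'.2 ->
  ipH P X B m lam theta theta' =
  EB * theta.1 * theta'.1 + ip1 P X B m lam theta.2 theta'.2.
Proof.
move=> l l'; rewrite /ipH /ip1 addrA fine_expectation; congr (_ + _).
rewrite VformC// Vform_E//.
have e1 := expectation_BdotX l; have e2 := expectation_BdotX l'.
pose ip := ipon P setT.
transitivity (ip (fun w => theta.1 * bx w + bx w * dotI (X w) theta.2)
                 (fun w => theta'.1 * 1 + dotI (X w) theta'.2)).
  by apply: eq_Rintegral => w _; rewrite /lin -/(bx w); ring.
have lb := L2_BX; have l1 := L2_cst P 1; have ld := L2_dotX l; have ld' := L2_dotX l'.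
have lbd := L2_BM ld.
have ll := L2on_lin measurableT theta'.1 l1 ld'.
rewrite /ip ipon_linl// !(iponC _ _ _ (fun w => theta'.1 * 1 + _)) !ipon_linl//.
rewrite !(iponC _ _ (fun w => dotI (X w) theta'.2)) !(iponC _ _ (fun=> 1)).
have -> : ipon P setT bx (fun w => dotI (X w) theta'.2) = 0 by rewrite -e2.
have -> : ipon P setT (fun w => bx w * dotI (X w) theta.2) (fun=> 1) = 0.
  by rewrite -[RHS]e1; apply: eq_Rintegral => w _; rewrite mulr1.
have -> : ipon P setT bx (fun=> 1) = EB.
  by apply: eq_Rintegral => w _; rewrite mulr1.
by rewrite /ipon; ring.
Qed.

(** One operation for sums, differences and multiples, with the slope in the shape r * f t + g t of
    the linearity lemmas. *)
Definition hcomb (r : R) theta theta' : R * (R -> R) :=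
  (r * theta.1 + theta'.1, fun t => r * theta.2 t + theta'.2 t).

Lemma lin_hcomb x r theta theta' : L2I x -> L2I theta.2 -> L2I theta'.2 ->
  lin x (hcomb r theta theta') = r * lin x theta + lin x theta'.
Proof. by move=> *; rewrite /lin /= dotI_linr//; ring. Qed.

Local Notation ip := (ipH P X B m).

Lemma ipHC lam theta theta' : Hm m theta.2 -> Hm m theta'.2 ->
  ip lam theta theta' = ip lam theta' theta.
Proof.
move=> h h'; have l := Hm_L2I m0 h; have l' := Hm_L2I m0 h'.
by rewrite (ipH_E _ l l') (ipH_E _ l' l) /ip1 (VformC l l') JformC; ring.
Qed.

Lemma ipH_linl lam r theta theta' eta : Hm m theta.2 -> Hm m theta'.2 -> Hm m eta.2 ->
  ip lam (hcomb r theta theta') eta = r * ip lam theta eta + ip lam theta' eta.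
Proof.
move=> h h' h''; have l := Hm_L2I m0 h; have l' := Hm_L2I m0 h'.
have l'' := Hm_L2I m0 h''; have ll := L2I_lin r l l'.
have -> := @ipH_E lam (hcomb r theta theta') eta ll l''.
rewrite (ipH_E lam l l'') (ipH_E lam l' l'') /ip1.
rewrite [Vform _ _ _ (hcomb _ _ _).2 _](Vform_linl r l l' l'').
rewrite [Jform _ (hcomb _ _ _).2 _](Jform_linl r m0 h h' h'').
rewrite [(hcomb _ _ _).1]/=.
move: (Vform P X B theta.2 eta.2) (Vform P X B theta'.2 eta.2) => v v'.
by move: (Jform m theta.2 eta.2) (Jform m theta'.2 eta.2) => j j'; ring.
Qed.

Lemma ipH_linr lam r theta theta' eta : Hm m theta.2 -> Hm m theta'.2 -> Hm m eta.2 ->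
  ip lam eta (hcomb r theta theta') = r * ip lam eta theta + ip lam eta theta'.
Proof.
move=> h h' h''; have hh : Hm m (hcomb r theta theta').2 by exact: Hm_lin.
by rewrite (ipHC _ h'' hh) (ipH_linl _ _ h h' h'') (ipHC _ h'' h) (ipHC _ h'' h').
Qed.

Lemma EB_gt0 : 0 < EB.
Proof. by apply: lt_le_trans EB_ge; rewrite invr_gt0. Qed.

Lemma ipH_ge lam theta : 0 <= lam -> Hm m theta.2 ->
  EB * theta.1 ^+ 2 + Vform P X B theta.2 theta.2 <= ip lam theta theta.
Proof.
move=> lam0 h; have l := Hm_L2I m0 h.
rewrite (ipH_E _ l l) /ip1 expr2 mulrA addrA lerDl mulr_ge0//; exact: Jform_ge0.
Qed.

Lemma ipH_ge0 lam theta : 0 <= lam -> Hm m theta.2 -> 0 <= ip lam theta theta.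
Proof.
move=> lam0 h; apply: le_trans (ipH_ge lam0 h).
apply: addr_ge0; last exact: Vform_ge0 (Hm_L2I m0 h).
by apply: mulr_ge0; [exact: ltW EB_gt0|exact: sqr_ge0].
Qed.

Lemma ipH_cauchy_schwarz lam theta eta : 0 <= lam -> Hm m theta.2 -> Hm m eta.2 ->
  `|ip lam theta eta| <= normH P X B m lam theta * normH P X B m lam eta.
Proof.
move=> lam0 h h'.
have t0 := ipH_ge0 lam0 h; have e0 := ipH_ge0 lam0 h'.
rewrite -ler_sqr ?nnegrE ?mulr_ge0 ?sqrtr_ge0// real_normK ?num_real//.
rewrite exprMn !sqr_sqrtr//; apply: discriminant_le => // t.
rewrite (_ : _ + _ + _ = ip lam (hcomb t eta theta) (hcomb t eta theta)).
  by apply: ipH_ge0 => //; exact: Hm_lin.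
have hh : Hm m (hcomb t eta theta).2 by exact: Hm_lin.
by rewrite ipH_linl// !ipH_linr// (@ipHC _ eta theta)//; ring.
Qed.

Lemma normH_sqr lam theta : 0 <= lam -> Hm m theta.2 ->
  normH P X B m lam theta ^+ 2 = ip lam theta theta.
Proof. by move=> lam0 h; rewrite sqr_sqrtr// ipH_ge0. Qed.

Lemma normH_ge0 lam theta : 0 <= normH P X B m lam theta.
Proof. exact: sqrtr_ge0. Qed.

Lemma Rep_reproducing lam tau x theta : is_tau P X B m lam tau -> L2I x ->
  Hm m theta.2 -> ip lam (Rep P X B tau x) theta = lin x theta.
Proof.
move=> /(_ x) htau lx h; have [ht Ht] := htau lx.
rewrite ipH_E; [|exact: Hm_L2I m0 ht|exact: Hm_L2I m0 h].
rewrite /= Ht// fine_expectation mulfV ?mul1r//.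
by rewrite gt_eqF// EB_gt0.
Qed.

Lemma Pen_E lam W theta eta : is_W P X B m lam W -> Hm m theta.2 -> Hm m eta.2 ->
  ip lam (Pen W theta) eta = lam * Jform m theta.2 eta.2.
Proof.
move=> /(_ theta.2) hW h h'; have [hw Hw] := hW h.
rewrite ipH_E; [|exact: Hm_L2I m0 hw|exact: Hm_L2I m0 h'].
by rewrite /= Hw// mulr0 mul0r add0r.
Qed.

Lemma lin_le lam tau x theta : 0 <= lam -> is_tau P X B m lam tau -> L2I x ->
  Hm m theta.2 ->
  `|lin x theta| <= normH P X B m lam (Rep P X B tau x) * normH P X B m lam theta.
Proof.
move=> lam0 htau lx h; rewrite -(Rep_reproducing htau lx h).
by apply: ipH_cauchy_schwarz => //; have [] := htau x lx.
Qed.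

Lemma L2_lin theta : L2I theta.2 -> L2on P setT (fun w => lin (X w) theta).
Proof.
move=> l; apply: eq_L2on (L2on_lin measurableT theta.1 (L2_cst P 1) (L2_dotX l)) => w.
by rewrite mulr1.
Qed.

Lemma second_moment_le b : L2I b ->
  (\int[P]_w ((dotI (X w) b) ^+ 2)%:E <= (C2 * Vform P X B b b)%:E)%E.
Proof.
move=> lb; have ld := L2_dotX lb; have li := L2on_mul measurableT (L2_BM ld) ld.
rewrite (L2_sqrE ld) lee_fin Vform_E// -RintegralZl//.
apply: ae_le_Rintegral; first exact: (L2on_mul measurableT ld ld).
  exact: (integrableZl measurableT C2 li).
apply: filterS BC => w [h _]; rewrite -mulrA mulrA -expr2 ler_peMl ?sqr_ge0//.
by rewrite -[X in X <= _](mulfV (lt0r_neq0 C20)) ler_pM2l.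
Qed.

Section FourthMoment.
Variable M0 : R.
Hypotheses (M00 : 0 < M0) (HM0 : forall b, Hm m b ->
     ('E_P[fun w => (`|dotI (X w) b| ^+ 4)%R] <=
      M0%:E * ('E_P[fun w => (`|dotI (X w) b| ^+ 2)%R]) ^+ 2)%E).

(** The 8 is that of (a + b)^4 <= 8 (a^4 + b^4), and each square of the intercept or of the L^2 norm
    of <X,b> costs one factor C2 when compared with the form weighted by B. *)
Definition kappa4 : R := 8 * C2 ^+ 2 * (1 + M0).

Lemma kappa4_ge0 : 0 <= kappa4.
Proof.
by apply: mulr_ge0; [apply: mulr_ge0 => //; exact: sqr_ge0|rewrite addr_ge0// ltW].
Qed.

Lemma dotX_moment4 b : Hm m b ->
  (\int[P]_w ((dotI (X w) b) ^+ 4)%:E <= (M0 * (C2 * Vform P X B b b) ^+ 2)%:E)%E.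
Proof.
move=> hb; have lb := Hm_L2I m0 hb; have := HM0 hb; rewrite unlock.
rewrite (_ : (fun w => (`|dotI (X w) b| ^+ 4)%:E) = (fun w => (dotI (X w) b ^+ 4)%:E)); last first.
  by apply/funext => w; rewrite -normrX ger0_norm// exprn_even_ge0.
rewrite (_ : (fun w => (`|dotI (X w) b| ^+ 2)%:E) = (fun w => (dotI (X w) b ^+ 2)%:E)); last first.
  by apply/funext => w; rewrite -normrX ger0_norm// sqr_ge0.
move=> h; apply: (le_trans h); have := second_moment_le lb.
rewrite (L2_sqrE (L2_dotX lb)) => h2; rewrite -EFin_expe -EFinM lee_fin.
rewrite ler_wpM2l ?(ltW M00)// ler_sqr ?nnegrE//; first exact: ipon_ge0.
by rewrite mulr_ge0 ?(ltW C20)//; exact: Vform_ge0.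
Qed.

Lemma lin_moment4 theta : Hm m theta.2 ->
  (\int[P]_w ((lin (X w) theta) ^+ 4)%:E <= (kappa4 * (ip 0 theta theta) ^+ 2)%:E)%E.
Proof.
move=> h; have l := Hm_L2I m0 h; have md := measurable_dotI pX l.
apply: (@le_trans _ _ (\int[P]_w ((8 * theta.1 ^+ 4)%:E + 8%:E * (dotI (X w) theta.2 ^+ 4)%:E))%E).
  apply: ge0_le_integral => //.
  - by move=> w _; rewrite lee_fin exprn_even_ge0.
  - apply/measurable_EFinP/measurable_funX; apply: measurable_funD => //.
  - apply: emeasurable_funD; first exact: measurable_cst.
    by apply/measurable_funeM/measurable_EFinP/measurable_funX.
  - move=> w _; rewrite -EFinM -EFinD lee_fin /lin.
    move: theta.1 (dotI _ _) => a b.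
    have e4 (z : R) : z ^+ 4 = (z ^+ 2) ^+ 2 by rewrite -exprM.
    have h1 : (a + b) ^+ 2 <= 2 * (a ^+ 2 + b ^+ 2) by have := sqr_ge0 (a - b); nra.
    rewrite !e4; apply: (@le_trans _ _ ((2 * (a ^+ 2 + b ^+ 2)) ^+ 2)).
      by rewrite ler_sqr ?nnegrE ?sqr_ge0// mulr_ge0// addr_ge0 ?sqr_ge0.
    by have := sqr_ge0 (a ^+ 2 - b ^+ 2); move: (a ^+ 2) (b ^+ 2) => x y; nra.
have m4 : measurable_fun setT (fun w => (dotI (X w) theta.2 ^+ 4)%:E).
  by apply/measurable_EFinP/measurable_funX.
have p4 w : (0 <= (dotI (X w) theta.2 ^+ 4)%:E)%E by rewrite lee_fin exprn_even_ge0.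
rewrite ge0_integralD//; last 3 first.
- by move=> w _; rewrite lee_fin mulr_ge0// exprn_even_ge0.
- by move=> w _; rewrite mule_ge0.
- exact: measurable_funeM.
rewrite integral_cst//= [X in (_ * X)%E](probability_setT P) mule1 ge0_integralZl//.
apply: (@le_trans _ _ ((8 * theta.1 ^+ 4)%:E + 8%:E * (M0 * (C2 * Vform P X B theta.2 theta.2) ^+ 2)%:E)%E).
  by apply: leeD2l; apply: lee_wpmul2l => //; exact: dotX_moment4.
rewrite -EFinM -EFinD lee_fin.
have q := ipH_ge (lexx 0) h; have V0 := Vform_ge0 l; have E0 := EB_ge.
move: q V0; set V := Vform _ _ _ _ _; set Q := ip _ _ _ => q V0.
have t2 : theta.1 ^+ 2 <= C2 * (Q - V).
  apply: (@le_trans _ _ (C2 * (EB * theta.1 ^+ 2))).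
    rewrite mulrA ler_peMl ?sqr_ge0//.
    by rewrite -[X in X <= _](mulfV (lt0r_neq0 C20)) ler_pM2l.
  by rewrite ler_pM2l// lerBrDr.
have -> : theta.1 ^+ 4 = (theta.1 ^+ 2) ^+ 2 by rewrite -exprM.
have t3 : (theta.1 ^+ 2) ^+ 2 <= (C2 * Q) ^+ 2.
  rewrite ler_sqr ?nnegrE ?sqr_ge0//; last first.
    rewrite mulr_ge0 ?(ltW C20)//; exact: ipH_ge0.
  by apply: (le_trans t2); rewrite ler_pM2l// gerBl.
have VQ : V <= Q by apply: le_trans q; rewrite lerDr mulr_ge0 ?sqr_ge0// ltW// EB_gt0.
have t4 : (C2 * V) ^+ 2 <= (C2 * Q) ^+ 2.
  by rewrite ler_sqr ?nnegrE ?mulr_ge0 ?(ltW C20)// ?ler_pM2l// (le_trans V0).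
apply: (@le_trans _ _ (8 * (C2 * Q) ^+ 2 + 8 * (M0 * (C2 * Q) ^+ 2))).
  by apply: lerD; rewrite ler_pM2l// ler_pM2l.
by rewrite /kappa4 le_eqVlt; apply/orP; left; apply/eqP; ring.
Qed.

End FourthMoment.

(** * Expansion in the basis *)

Section Expansion.
Variables (phi : nat -> R -> R) (rho : nat -> R) (lam : R).
Hypothesis lam0 : 0 <= lam.
Hypothesis Hphi : forall nu, (1 <= nu)%N -> Hm m (phi nu).
Hypothesis HVJ : forall nu mu, (1 <= nu)%N -> (1 <= mu)%N ->
  Vform P X B (phi nu) (phi mu) = (nu == mu)%:R /\
  Jform m (phi nu) (phi mu) = rho nu * (nu == mu)%:R.
Hypothesis Hexp : forall b, Hm m b ->
  let rest N : R -> R := fun t =>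
    b t - \sum_(1 <= nu < N.+1) Vform P X B b (phi nu) * phi nu t in
  ip1 P X B m lam (rest N) (rest N) @[N --> \oo] --> (0 : R).
Hypothesis Hrho : forall nu, (1 <= nu)%N -> 0 <= rho nu.

Local Notation nH := (normH P X B m lam).

(** Here and in [xi] and [coef], index 0 is the constant direction (1, 0) and not [phi 0], so the
    basis of the product space is indexed by nat. *)
Definition gam (nu : nat) : R := if nu is 0 then EB else 1 + lam * rho nu.
Definition comb (N : nat) (c : nat -> R) : R * (R -> R) :=
  (c 0%N, fun t => \sum_(1 <= nu < N.+1) c nu * phi nu t).
Definition xi (nu : nat) (x : R -> R) : R := if nu is 0 then 1 else dotI x (phi nu).
Definition coef theta (nu : nat) : R :=
  if nu is 0 then theta.1 else Vform P X B theta.2 (phi nu).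
Definition proj N theta := comb N (coef theta).

Lemma gam_gt0 nu : 0 < gam nu.
Proof.
case: nu => [|nu]; first exact: EB_gt0.
by rewrite /gam ltr_wpDr// mulr_ge0// Hrho.
Qed.

(** 0 = - phi_1 + phi_1, which spares the computation of its derivatives. *)
Lemma Hm0 : Hm m (fun=> 0 : R).
Proof.
have := Hm_lin (-1) m0 (Hphi (leqnn 1)) (Hphi (leqnn 1)).
by rewrite (_ : (fun t => _) = (fun=> 0))//; apply/funext => t; rewrite mulN1r addNr.
Qed.

Lemma ip_0l a theta : Hm m theta.2 -> ip lam (a, fun=> 0) theta = EB * a * theta.1.
Proof.
move=> h; have l0 := Hm_L2I m0 Hm0; have l := Hm_L2I m0 h.
rewrite (@ipH_E lam (a, fun=> 0) theta l0 l) /ip1 /=.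
have E : (fun=> 0 : R) = (fun t : R => -1 * (fun=> 0 : R) t + (fun=> 0 : R) t).
  by apply/funext => t /=; rewrite mulr0 addr0.
have -> : Vform P X B (fun=> 0) theta.2 = 0.
  by rewrite E (Vform_linl _ l0 l0 l) mulN1r addNr.
have -> : Jform m (fun=> 0) theta.2 = 0.
  by rewrite E (Jform_linl _ m0 Hm0 Hm0 h) mulN1r addNr.
by rewrite mulr0 !addr0.
Qed.

Lemma comb0 c : comb 0 c = (c 0%N, fun=> 0).
Proof. by congr pair; apply/funext => t; rewrite big_geq. Qed.

Lemma combS N c : comb N.+1 c = hcomb (c N.+1) (0, phi N.+1) (comb N c).
Proof.
rewrite /comb /hcomb/= mulr0 add0r; congr pair; apply/funext => t.
by rewrite big_nat_recr//= addrC.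
Qed.

Lemma comb_Hm N c : Hm m (comb N c).2.
Proof.
elim: N => [|N IH]; first by rewrite comb0; exact: Hm0.
by rewrite combS; apply: Hm_lin => //; exact: Hphi.
Qed.

Lemma ip_phi_phi nu mu : (1 <= nu)%N -> (1 <= mu)%N ->
  ip lam (0, phi nu) (0, phi mu) = gam nu * (nu == mu)%:R.
Proof.
move=> n1 m1; rewrite ipH_E; [|exact: Hm_L2I m0 (Hphi n1)|exact: Hm_L2I m0 (Hphi m1)].
rewrite /= mulr0 add0r /ip1; have [-> ->] := HVJ n1 m1.
by case: nu n1 => // nu _; rewrite /gam; ring.
Qed.

Lemma ip_comb_phi N c mu : (N < mu)%N -> ip lam (comb N c) (0, phi mu) = 0.
Proof.
elim: N => [|N IH] Nmu.
  by rewrite comb0 ip_0l ?mulr0//; exact: Hphi.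
have m1 : (1 <= mu)%N by exact: leq_ltn_trans Nmu.
rewrite combS ipH_linl//; [|exact: Hphi|exact: comb_Hm|exact: Hphi].
rewrite ip_phi_phi// IH ?(ltn_trans _ Nmu)// (ltn_eqF Nmu).
by rewrite !mulr0 addr0.
Qed.

Lemma ip_comb N c c' :
  ip lam (comb N c) (comb N c') = \sum_(nu < N.+1) gam nu * c nu * c' nu.
Proof.
elim: N => [|N IH].
  by rewrite big_ord1 !comb0 ip_0l//; exact: Hm0.
have hp : Hm m (0 : R, phi N.+1).2 by exact: Hphi.
have hc := comb_Hm N c; have hc' := comb_Hm N c'.
have hcS := comb_Hm N.+1 c'.
rewrite big_ord_recr/= -IH combS ipH_linl// combS !ipH_linr//.
rewrite ip_phi_phi// (ip_comb_phi _ (ltnSn N)) (ipHC _ hp hc') (ip_comb_phi _ (ltnSn N)).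
by rewrite eqxx /=; ring.
Qed.

Lemma lin_comb N c x : L2I x -> lin x (comb N c) = \sum_(nu < N.+1) c nu * xi nu x.
Proof.
move=> lx; elim: N => [|N IH].
  rewrite big_ord1 comb0 /lin /= mulr1.
  rewrite (_ : dotI x (fun=> 0) = 0) ?addr0//.
  have l0 := Hm_L2I m0 Hm0.
  have E : (fun=> 0 : R) = (fun t : R => -1 * (fun=> 0 : R) t + (fun=> 0 : R) t).
    by apply/funext => t /=; rewrite mulr0 addr0.
  by rewrite {1}E (dotI_linr (-1) l0 l0 lx) mulN1r addNr.
have lp := Hm_L2I m0 (Hphi (isT : (1 <= N.+1)%N)).
rewrite combS lin_hcomb//; last exact: Hm_L2I m0 (comb_Hm N c).
by rewrite IH [RHS]big_ord_recr/= [RHS]addrC /lin/= add0r.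
Qed.

Definition resid N theta := nH (hcomb (-1) (proj N theta) theta).

Lemma resid_cvg theta : Hm m theta.2 -> resid N theta @[N --> \oo] --> (0 : R).
Proof.
move=> h; have := Hexp h => /= H.
rewrite -(sqrtr0 R); apply: continuous_cvg; first exact: sqrt_continuous.
suff E N : ip lam (hcomb (-1) (proj N theta) theta) (hcomb (-1) (proj N theta) theta) =
    ip1 P X B m lam
      (fun t => theta.2 t - \sum_(1 <= nu < N.+1) Vform P X B theta.2 (phi nu) * phi nu t)
      (fun t => theta.2 t - \sum_(1 <= nu < N.+1) Vform P X B theta.2 (phi nu) * phi nu t).
  by under eq_fun do rewrite E.
have lr := Hm_L2I m0 (Hm_lin (-1) m0 (comb_Hm N (coef theta)) h).
rewrite (@ipH_E lam (hcomb (-1) (proj N theta) theta) (hcomb (-1) (proj N theta) theta) lr lr).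
rewrite [(hcomb _ _ _).1]/= mulN1r addNr !(mulr0, mul0r) add0r.
have -> : (hcomb (-1) (proj N theta) theta).2 = (fun t => theta.2 t -
    \sum_(1 <= nu < N.+1) Vform P X B theta.2 (phi nu) * phi nu t).
  apply/funext => t; rewrite /hcomb/= mulN1r addrC; congr (_ - _).
  by rewrite big_nat [RHS]big_nat; apply: eq_bigr => -[].
by [].
Qed.

Lemma norm_proj_mono N M theta : (N <= M)%N ->
  ip lam (proj N theta) (proj N theta) <= ip lam (proj M theta) (proj M theta).
Proof.
elim: M => [|M IH]; first by rewrite leqn0 => /eqP ->.
rewrite leq_eqVlt => /orP[/eqP->//|]; rewrite ltnS => /IH /le_trans; apply.
rewrite !ip_comb [leRHS]big_ord_recr/= lerDl -mulrA -expr2.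
by rewrite mulr_ge0 ?sqr_ge0//; exact: ltW (gam_gt0 M.+1).
Qed.

Lemma norm_proj_resid N theta : Hm m theta.2 -> nH (proj N theta) <= nH theta + resid N theta.
Proof.
move=> h; have hp := comb_Hm N (coef theta).
have hr : Hm m (hcomb (-1) (proj N theta) theta).2 := Hm_lin (-1) m0 hp h.
have p0 := normH_ge0 lam (proj N theta).
have E : ip lam (proj N theta) (proj N theta) =
  ip lam theta (proj N theta) - ip lam (hcomb (-1) (proj N theta) theta) (proj N theta).
  by rewrite (ipH_linl lam (-1) hp h hp); ring.
have c1 := ipH_cauchy_schwarz lam0 h hp.
have c2 := ipH_cauchy_schwarz lam0 hr hp.
move: p0; rewrite le_eqVlt => /orP[/eqP <-|p0].
  by rewrite addr_ge0// normH_ge0.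
rewrite -(ler_pM2r p0) -expr2 normH_sqr// E mulrDl.
by move: c1 c2; rewrite !ler_norml /resid; lra.
Qed.

(** Bessel's inequality. The coefficients are taken with respect to V rather than the penalized
    form, so it is derived from the expansion: |proj N| <= |proj M| <= |theta| + resid M for M >= N,
    and M tends to infinity. *)
Lemma norm_proj_le N theta : Hm m theta.2 -> nH (proj N theta) <= nH theta.
Proof.
move=> h; have r0 := resid_cvg h.
have lim : nH theta + resid M theta @[M --> \oo] --> nH theta.
  by rewrite -[X in _ --> X]addr0; apply: cvgD => //; exact: cvg_cst.
apply: (ler_cvg_to (cvg_cst _) lim).
near=> M; apply: le_trans (norm_proj_resid M h).
apply: ler_wsqrtr; apply: norm_proj_mono.
by near: M; exact: nbhs_infty_ge.
Unshelve. all: by end_near. Qed.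

Lemma cvg_le_resid (a K : R) (u r : nat -> R) : (forall N, `|a - u N| <= K * r N) ->
  r N @[N --> \oo] --> (0 : R) -> u N @[N --> \oo] --> a.
Proof.
move=> H r0.
have : K * r N @[N --> \oo] --> (0 : R).
  by rewrite -(mulr0 K); apply: cvgMr.
move=> Kr; have : a - u N @[N --> \oo] --> (0 : R).
  apply/cvgr0Pnorm_lt => e e0; have /cvgr0Pnorm_lt /(_ e e0) := Kr.
  by apply: filterS => N; apply: le_lt_trans; apply: (le_trans (H N)); exact: ler_norm.
move=> au; have : a - (a - u N) @[N --> \oo] --> a.
  by rewrite -[X in _ --> X]subr0; apply: cvgB => //; exact: cvg_cst.
by under eq_fun do rewrite subKr.
Qed.

Lemma lin_proj_cvg tau x theta : is_tau P X B m lam tau -> L2I x -> Hm m theta.2 ->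
  lin x (proj N theta) @[N --> \oo] --> lin x theta.
Proof.
move=> htau lx h.
apply: (cvg_le_resid (K := nH (Rep P X B tau x)) _ (resid_cvg h)) => N.
have hp := comb_Hm N (coef theta).
rewrite (_ : _ - _ = lin x (hcomb (-1) (proj N theta) theta)).
  by apply: (lin_le lam0 htau lx); exact: Hm_lin.
by rewrite lin_hcomb//; [ring|exact: Hm_L2I m0 hp|exact: Hm_L2I m0 h].
Qed.

Lemma normH_mono theta : Hm m theta.2 -> normH P X B m 0 theta <= nH theta.
Proof.
move=> h; apply: ler_wsqrtr; have l := Hm_L2I m0 h.
rewrite !(ipH_E _ l l) /ip1 mul0r addr0 addrA lerDl mulr_ge0//; exact: Jform_ge0.
Qed.

Lemma ip0_proj_cvg theta eta : Hm m theta.2 -> Hm m eta.2 ->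
  ip 0 (proj N theta) (proj N eta) @[N --> \oo] --> ip 0 theta eta.
Proof.
move=> h h'.
apply: (cvg_le_resid (K := 1) (r := fun N => resid N theta * nH eta + nH theta * resid N eta)).
  move=> N; rewrite mul1r.
  have hp := comb_Hm N (coef theta); have hp' := comb_Hm N (coef eta).
  have hr : Hm m (hcomb (-1) (proj N theta) theta).2 := Hm_lin (-1) m0 hp h.
  have hr' : Hm m (hcomb (-1) (proj N eta) eta).2 := Hm_lin (-1) m0 hp' h'.
  rewrite (_ : _ - _ = ip 0 (hcomb (-1) (proj N theta) theta) eta +
                       ip 0 (proj N theta) (hcomb (-1) (proj N eta) eta)).
    apply: (le_trans (ler_normD _ _)); apply: lerD.
      apply: (le_trans (ipH_cauchy_schwarz (lexx 0) hr h')).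
      by apply: ler_pM; rewrite ?normH_ge0//; exact: normH_mono.
    apply: (le_trans (ipH_cauchy_schwarz (lexx 0) hp hr')).
    apply: ler_pM; rewrite ?normH_ge0//; last exact: normH_mono.
    by apply: (le_trans (normH_mono hp)); exact: norm_proj_le.
  by rewrite (ipH_linl 0 (-1) hp h h') (ipH_linr 0 (-1) hp' h' hp); ring.
rewrite (_ : 0 = 0 * nH eta + nH theta * 0); last by rewrite mul0r mulr0 addr0.
by apply: cvgD; [apply: cvgMl|apply: cvgMr]; exact: resid_cvg.
Qed.

(** * The identity for the estimation error *)

(** Index 0 contributes at most C2, indices below nu0 at most 1 each. From nu0 on, lam rho_nu >= c1
    (h nu)^p makes 1 / gam comparable with (1 + h nu)^(-p), whose sum is of order 1 / h. As h <= 1,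
    the constants are absorbed too. *)
Lemma gam_sum_le (h p c1 : R) (nu0 N : nat) : 0 < h -> h <= 1 -> 1 < p -> 0 < c1 ->
  lam = h `^ p -> (forall nu, (nu0 <= nu)%N -> c1 * nu%:R `^ p <= rho nu) ->
  \sum_(nu < N.+1) (gam nu)^-1 <=
  (C2 + nu0%:R + 2 `^ p * (1 + c1^-1) / (p - 1)) / h.
Proof.
move=> h0 h1 p1 c10 lamE Hr; have p10 : 0 < p - 1 by rewrite subr_gt0.
have p0 : 0 < p by apply: lt_trans p1.
pose q := 2 `^ p * (1 + c1^-1).
have q0 : 0 <= q by rewrite mulr_ge0 ?powR_ge0// addr_ge0// invr_ge0 ltW.
have pos k : 0 < 1 + h * k%:R by rewrite ltr_wpDr// mulr_ge0// ltW.
have g0 : (gam 0)^-1 <= C2.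
  by rewrite -[leRHS]invrK lef_pV2 ?posrE ?invr_gt0// /gam; [exact: EB_ge|exact: EB_gt0].
have gS nu : (gam nu.+1)^-1 <= (nu.+1 < nu0)%:R + q * (1 + h * nu.+1%:R) `^ (- p).
  have [lt0|ge0] := ltnP nu.+1 nu0.
    apply: (@le_trans _ _ 1); last by rewrite lerDl mulr_ge0// powR_ge0.
    by rewrite invf_le1 ?gam_gt0// /gam lerDl mulr_ge0// Hrho.
  rewrite add0r powRN -[_^-1]mul1r ler_pdivrMr ?gam_gt0// mulrAC ler_pdivlMr ?powR_gt0// mul1r.
  set x := h * nu.+1%:R; have x0 : 0 <= x by rewrite mulr_ge0// ltW.
  have xp : c1 * x `^ p <= lam * rho nu.+1.
    rewrite /x powRM ?(ltW h0)// lamE mulrCA ler_wpM2l ?powR_ge0//; exact: Hr.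
  (* (1 + x)^p <= 2^p max(1, x)^p <= 2^p (1 + x^p) *)
  apply: (@le_trans _ _ (2 `^ p * (1 + x `^ p))).
    have [x1|x1] := leP x 1.
      apply: (@le_trans _ _ (2 `^ p)); last by rewrite ler_peMr ?powR_ge0// lerDl powR_ge0.
      by apply: ge0_ler_powR; rewrite ?nnegrE ?(ltW p0)// ?(ltW (pos _))// -[2]/(1 + 1) lerD2l.
    apply: (@le_trans _ _ ((2 * x) `^ p)).
      apply: ge0_ler_powR; rewrite ?nnegrE ?(ltW p0) ?(ltW (pos _))//.
        by rewrite mulr_ge0.
      by rewrite mulr_natl mulr2n lerD2r ltW.
    by rewrite powRM// ler_wpM2l ?powR_ge0// lerDr.
  rewrite /q -mulrA ler_wpM2l ?powR_ge0// /gam.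
  have i0 : 0 < c1^-1 by rewrite invr_gt0.
  have : x `^ p <= c1^-1 * (lam * rho nu.+1) by rewrite ler_pdivlMl.
  have l0 : 0 <= lam * rho nu.+1 by rewrite mulr_ge0// Hrho.
  by move: (lam * _) (x `^ p) l0 (c1^-1) i0 => l y l0 c c0; nra.
rewrite big_ord_recl /=.
apply: (@le_trans _ _ (C2 + (nu0%:R + q * ((p - 1) * h)^-1))).
  apply: lerD => //; apply: (@le_trans _ _ (\sum_(nu < N) ((nu.+1 < nu0)%:R + q * (1 + h * nu.+1%:R) `^ (- p)))).
    by apply: ler_sum => nu _; exact: gS.
  rewrite big_split /= -mulr_sumr; apply: lerD; last by rewrite ler_wpM2l// powR_sum_le.
  rewrite -natr_sum ler_nat.
  have cnt : (\sum_(nu < N) (nu.+1 < nu0)%N <= minn N nu0)%N.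
    elim: (N) => [|N' IH]; first by rewrite big_ord0.
    rewrite big_ord_recr /=; have [lt0|ge0] := ltnP N'.+1 nu0.
      by rewrite addn1 ltnS; apply: (leq_trans IH); exact: geq_minl.
    by rewrite addn0; apply: (leq_trans IH); exact: geq_minr.
  exact: leq_trans cnt (geq_minr _ _).
rewrite [leRHS]mulrDl addrA; apply: lerD; last first.
  by rewrite le_eqVlt; apply/orP; left; apply/eqP; rewrite /q; field; rewrite !gt_eqF.
by rewrite ler_pdivlMr// ger_pMr// ltr_wpDr.
Qed.

Section FirstOrder.
Variables (ell : R -> R -> R) (n : nat) (ys : 'I_n -> R) (xs : 'I_n -> R -> R).
Hypothesis dell1 : forall i u, derivable (ell (ys i)) u 1.
Hypothesis lxs : forall i, L2I (xs i).

Let crit theta := n%:R^-1 * (\sum_(i < n) ell (ys i) (lin (xs i) theta)) -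
  lam / 2 * Jform m theta.2 theta.2.

(** Along the line theta + t eta the criterion is the function [phi0], differentiable with an
    interior maximum at t = 0. *)
Lemma first_order_condition theta eta : Hm m theta.2 -> Hm m eta.2 ->
  (forall theta', Hm m theta'.2 -> crit theta' <= crit theta) ->
  n%:R^-1 * (\sum_(i < n) (ell (ys i))^`()%classic (lin (xs i) theta) * lin (xs i) eta) =
  lam * Jform m theta.2 eta.2.
Proof.
move=> ht he Hmax.
pose u i := lin (xs i) theta; pose v i := lin (xs i) eta.
pose j0 := Jform m theta.2 theta.2; pose j1 := Jform m theta.2 eta.2.
pose j2 := Jform m eta.2 eta.2.
pose F i (t : R) := ell (ys i) (t * v i + u i).
pose phi0 (t : R) := n%:R^-1 * (\sum_(i < n) F i t) - lam / 2 * (j0 + 2 * t * j1 + t ^+ 2 * j2).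
have E t : crit (hcomb t eta theta) = phi0 t.
  rewrite /crit /phi0; congr (_ * _ - _ * _).
    apply: eq_bigr => i _; rewrite lin_hcomb//; exact: Hm_L2I m0 _.
  have hh : Hm m (hcomb t eta theta).2 by exact: Hm_lin.
  rewrite [LHS](Jform_linl t m0 he ht hh) !(JformC _ _ (hcomb t eta theta).2).
  rewrite (Jform_linl t m0 he ht he) (Jform_linl t m0 he ht ht) (JformC _ eta.2).
  by rewrite /j0 /j1 /j2; ring.
have dF i (t : R) : is_derive t 1 (F i) ((ell (ys i))^`()%classic (t * v i + u i) * v i).
  rewrite /F (_ : (fun t => _) = ell (ys i) \o (fun t => t * v i + u i))//.
  apply: is_derive1_comp; first exact: derivable_is_derive1.
  rewrite (_ : (fun t => _) = (fun t => t) * cst (v i) + cst (u i))//.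
  apply: is_derive_eq; rewrite /GRing.scale /= /cst; ring.
pose df (t : R) := n%:R^-1 * (\sum_(i < n) (ell (ys i))^`()%classic (t * v i + u i) * v i)
   - lam / 2 * (2 * j1 + 2 * t * j2).
have dphi (t : R) : is_derive t 1 phi0 (df t).
  have dS : is_derive t 1 (\sum_(i < n) F i) (\sum_(i < n) (ell (ys i))^`()%classic (t * v i + u i) * v i).
    exact: is_derive_sum.
  rewrite (_ : phi0 = n%:R^-1 *: (\sum_(i < n) F i) - (lam / 2) *: (cst j0 +
     (2 * j1) *: id + j2 *: (id ^+ 2))); last first.
    by apply/funext => z; rewrite /phi0 !fctE /= fct_sumE /GRing.scale /=; ring.
  have d2 : is_derive t 1 (cst j0 + (2 * j1) *: id + j2 *: id ^+ 2) (2 * j1 + 2 * t * j2).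
    rewrite (_ : 2 * j1 + 2 * t * j2 = 0 + (2 * j1) *: (1 : R) + j2 *: ((2%:R * t ^+ 1) *: (1 : R))).
      have di : is_derive t 1 (id : R -> R) (1 : R) by exact: is_derive_id.
      have dc : is_derive t 1 (cst j0 : R -> R) (0 : R) by exact: is_derive_cst.
      exact: is_deriveD (is_deriveD dc (is_deriveZ _ di)) (is_deriveZ _ (is_deriveX 2 di)).
    by rewrite add0r /GRing.scale /= expr1 !mulr1 [j2 * _]mulrC.
  exact: is_deriveB (is_deriveZ _ dS) (is_deriveZ _ d2).
have h0 : hcomb 0 eta theta = theta.
  by case: theta {ht Hmax u v j0 j1 j2 F phi0 E dF df dphi} => a b; rewrite /hcomb mul0r add0r; congr pair;
    apply/funext => z; rewrite mul0r add0r.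
have [|t _||t _|d0 d1] := @derive1_at_max _ phi0 (-1) 1 0.
- by rewrite (@le_trans _ _ 0)// lerN10.
- by have [] := dphi t.
- by rewrite in_itv /= ltrN10 ltr01.
- by rewrite -!E h0; apply: Hmax; exact: Hm_lin.
have := dphi 0 => -[_ D0]; move: d1; rewrite D0 /df mulr0 mul0r addr0 => H.
have {H} : n%:R^-1 * (\sum_(i < n) (ell (ys i))^`()%classic (0 * v i + u i) * v i) = lam * j1 by lra.
by move=> <-; congr (_ * _); apply: eq_bigr => i _; rewrite mul0r add0r.
Qed.

End FirstOrder.

Section ScoreIdentity.
Variables (ell : R -> R -> R) (Ys : nat -> Omega -> R) (Xs : nat -> Omega -> L2path R).
Variables (tau W : (R -> R) -> (R -> R)) (w : Omega) (n : nat).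
Hypothesis htau : is_tau P X B m lam tau.
Hypothesis hW : is_W P X B m lam W.
Hypothesis dell1 : forall i u, derivable (ell (Ys i w)) u 1.
Hypothesis lXs : forall i, L2I (Xs i w).
Variables theta0 thetah : R * (R -> R).
Hypotheses (h0 : Hm m theta0.2) (hh : Hm m thetah.2).
Hypothesis Hmax : forall theta, Hm m theta.2 ->
  criterion m ell Ys Xs lam n w theta <= criterion m ell Ys Xs lam n w thetah.

Lemma representer_sum (a : nat -> R) k :
  let S : R * (R -> R) := \sum_(i < k) a i *: (Rep P X B tau (Xs i w) : R^o * (R -> R^o)) in
  Hm m S.2 /\ forall eta, Hm m eta.2 ->
    ip lam S eta = \sum_(i < k) a i * lin (Xs i w) eta.
Proof.
elim: k => [|k [IH1 IH2]] /=.
  rewrite !big_ord0; split; first exact: Hm0.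
  by move=> eta he; rewrite big_ord0 [LHS](ip_0l 0 he) mulr0 mul0r.
have hr : Hm m (Rep P X B tau (Xs k w)).2 by have [] := htau (lXs k).
set S := \sum_(i < k.+1) _.
have -> : S = hcomb (a k) (Rep P X B tau (Xs k w))
    (\sum_(i < k) a i *: (Rep P X B tau (Xs i w) : R^o * (R -> R^o))).
  by rewrite /S big_ord_recr /= addrC.
split; first exact: Hm_lin.
move=> eta he; rewrite (ipH_linl _ _ hr IH1 he) IH2// big_ord_recr /= addrC.
by rewrite (Rep_reproducing htau (lXs k) he).
Qed.

Let g := hcomb (-1) theta0 thetah.
Let D := thetah - theta0 - Score P X B m ell Ys Xs lam tau W n w theta0.

Let S : R * (R -> R) := \sum_(i < n) (ell (Ys i w))^`()%classic (lin (Xs i w) theta0) *: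
  (Rep P X B tau (Xs i w) : R^o * (R -> R^o)).

Let hS : Hm m S.2 := (representer_sum (fun i => (ell (Ys i w))^`()%classic (lin (Xs i w) theta0)) n).1.

Let hPen : Hm m (Pen W theta0).2.
Proof. by have [] := hW h0. Qed.

Let DE : D = hcomb 1 (Pen W theta0) (hcomb (- n%:R^-1) S g).
Proof.
have SE : \sum_(i < n) (ell (Ys i w))^`()%classic (ip lam (Rep P X B tau (Xs i w)) theta0) *:
    (Rep P X B tau (Xs i w) : R^o * (R -> R^o)) = S.
  by apply: eq_bigr => i _; rewrite (Rep_reproducing htau (lXs i) h0).
rewrite /D /Score SE.
rewrite /hcomb /g; case: thetah => t1 t2; case: theta0 => u1 u2; case: S => s1 s2.
congr pair => /=.
  by rewrite /GRing.scale /=; ring.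
by apply/funext => t; rewrite !fctE /GRing.scale /=; ring.
Qed.

Lemma error_Hm : Hm m D.2.
Proof. by rewrite DE; apply: Hm_lin => //; apply: Hm_lin => //; exact: Hm_lin. Qed.

(** The penalties recombine: P theta0 contributes lam J(theta0, D) and the penalized product of g
    with D contributes lam J(thetah - theta0, D). Their sum lam J(thetah, D) is an empirical average
    by the first-order condition. *)
Lemma estimation_error_identity :
  ip lam D D = ip 0 g D +
    n%:R^-1 * (\sum_(i < n) ((ell (Ys i w))^`()%classic (lin (Xs i w) thetah) -
       (ell (Ys i w))^`()%classic (lin (Xs i w) theta0)) * lin (Xs i w) D).
Proof.
have hD := error_Hm; have hg : Hm m g.2 by exact: Hm_lin.
have hSg : Hm m (hcomb (- n%:R^-1) S g).2 by exact: Hm_lin.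
rewrite [X in ipH _ _ _ _ _ X _]DE (ipH_linl _ _ hPen hSg hD) (ipH_linl _ _ hS hg hD).
have ipS := (representer_sum (fun i => (ell (Ys i w))^`()%classic (lin (Xs i w) theta0)) n).2 D hD.
rewrite (Pen_E hW h0 hD) [ipH _ _ _ _ _ S D]ipS.
have lg := Hm_L2I m0 hg; have lD := Hm_L2I m0 hD.
have -> : ip lam g D = ip 0 g D + lam * Jform m g.2 D.2.
  by rewrite !(ipH_E _ lg lD) /ip1; ring.
rewrite [Jform m g.2 D.2](Jform_linl (-1) m0 h0 hh hD).
have := @first_order_condition ell n (fun i => Ys i w) (fun i => Xs i w)
  (fun i => @dell1 i) (fun i => lXs i) thetah D hh hD Hmax.
move=> F1; under [X in _ = _ + _ * X]eq_bigr do rewrite mulrBl.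
rewrite sumrB mulrBr F1; ring.
Qed.

End ScoreIdentity.

(** * Moments of the basis functionals *)

Section Concentration.
Variable M0 : R.
Hypotheses (M00 : 0 < M0) (HM0 : forall b, Hm m b ->
     ('E_P[fun w => (`|dotI (X w) b| ^+ 4)%R] <=
      M0%:E * ('E_P[fun w => (`|dotI (X w) b| ^+ 2)%R]) ^+ 2)%E).
Variables (Y : Omega -> R) (Ys : nat -> Omega -> R) (Xs : nat -> Omega -> L2path R).
Hypotheses (mY : measurable_fun setT Y) (mYs : forall i, measurable_fun setT (Ys i)).
Hypothesis pXs : forall i, L2process (Xs i).
Hypothesis indep : mutually_independent P (fun i w => (Ys i w, Xs i w)).
Hypothesis ident : identically_distributed P (fun i w => (Ys i w, Xs i w)) (fun w => (Y w, X w)).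
(** In the application, om is ell'' at the true parameter, G is 1 + sup |ell''| + sup |ell'''|, and
    Gam is of order 1 / h. *)
Variables (om : R * L2path R -> R) (G : R -> R) (CG Gam : R).
Hypotheses (mom : measurable_fun setT om) (mG : measurable_fun setT G).
Hypothesis G1 : forall y, 1 <= G y.
Hypothesis omG : {ae P, forall w, `|om (Y w, X w)| <= G (Y w)}.
Hypothesis HG : forall f : L2path R -> R, measurable_fun setT f -> (forall x, 0 <= f x) ->
  (\int[P]_w (G (Y w) ^+ 2 * f (X w))%:E <= CG%:E * \int[P]_w (f (X w))%:E)%E.
Hypothesis Hcurv : forall f : L2path R -> R, measurable_fun setT f -> (forall x, 0 <= f x) ->
  (\int[P]_w ((- om (Y w, X w)) * f (X w))%:E = \int[P]_w (B (X w) * f (X w))%:E)%E.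
Hypothesis HGam : forall N, \sum_(nu < N.+1) (gam nu)^-1 <= Gam.

Let kap := 1 + kappa4 M0.

Let kap1 : 1 <= kap.
Proof. by rewrite lerDl; exact: kappa4_ge0. Qed.

Let mX : measurable_fun setT X := measurable_L2path pX.
Let mXs i : measurable_fun setT (Xs i) := measurable_L2path (pXs i).
Let lX w : L2I (X w) := pX.2 w.

Let mZ i : measurable_fun setT (fun w => (Ys i w, Xs i w)).
Proof. exact: measurable_fun_pair. Qed.

Let mZ0 : measurable_fun setT (fun w => (Y w, X w)).
Proof. exact: measurable_fun_pair. Qed.

Lemma CG_ge1 : 1 <= CG.
Proof.
have := HG (f := fun=> 1) (measurable_cst _) (fun _ => ler01).
rewrite integral_cst// [X in (_ * (_ * X))%E](probability_setT P) !mule1 -lee_fin; apply: le_trans.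
apply: (@le_trans _ _ (\int[P]_w 1)%E).
  by rewrite integral_cst// [X in (_ * X)%E](probability_setT P) mule1.
apply: ge0_le_integral => //.
- by apply/measurable_EFinP/measurable_funM => //; apply/measurable_funX/measurableT_comp.
- by move=> w _; rewrite lee_fin mulr1 exprn_ege1.
Qed.

Let CG0 : 0 <= CG. Proof. exact: le_trans ler01 CG_ge1. Qed.

Lemma measurable_xi nu : measurable_fun setT (xi nu : L2path R -> R).
Proof.
case: nu => [|nu] /=; first exact: measurable_cst.
by apply: measurable_dotI_path; exact: Hm_L2I m0 (Hphi _).
Qed.

Let mxiX nu : measurable_fun setT (fun w => xi nu (X w)).
Proof. exact: (measurableT_comp (measurable_xi nu) mX). Qed.

Lemma xi_moment4 nu : (\int[P]_w ((xi nu (X w)) ^+ 4)%:E <= kap%:E)%E.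
Proof.
case: nu => [|nu] /=.
  rewrite expr1n integral_cst// [X in (_ * X)%E](probability_setT P) mule1 lee_fin.
  exact: kap1.
have hp : Hm m (0 : R, phi nu.+1).2 by exact: Hphi.
have lp := Hm_L2I m0 hp.
have := lin_moment4 M00 HM0 hp; rewrite (ipH_E _ lp lp) /ip1 /= mulr0 mul0r add0r addr0.
have [-> _] := HVJ (ltn0Sn nu) (ltn0Sn nu); rewrite eqxx expr1n mulr1 => H.
apply: (@le_trans _ _ (kappa4 M0)%:E); last by rewrite lee_fin lerDr.
by apply: le_trans H; under [leRHS]eq_integral do rewrite /lin /= add0r.
Qed.

Lemma xi_moment22 nu mu :
  (\int[P]_w ((xi nu (X w)) ^+ 2 * (xi mu (X w)) ^+ 2)%:E <= kap%:E)%E.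
Proof.
have m4 eta : measurable_fun setT (fun w => ((xi eta (X w)) ^+ 4)%:E).
  by apply/measurable_EFinP/measurable_funX.
have p4 eta w : (0 <= ((xi eta (X w)) ^+ 4)%:E)%E by rewrite lee_fin exprn_even_ge0.
apply: (@le_trans _ _ (\int[P]_w ((2^-1)%:E * (((xi nu (X w)) ^+ 4)%:E + ((xi mu (X w)) ^+ 4)%:E)))%E).
  apply: ge0_le_integral => //.
  - by move=> w _; rewrite lee_fin mulr_ge0// sqr_ge0.
  - by apply/measurable_EFinP/measurable_funM; apply: measurable_funX.
  - by apply/measurable_funeM/emeasurable_funD.
  - move=> w _; rewrite -EFinD -EFinM lee_fin.
    move: (xi _ _) (xi _ _) => a b.
    have e4 (z : R) : z ^+ 4 = (z ^+ 2) ^+ 2 by rewrite -exprM.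
    by rewrite !e4; have := sqr_ge0 (a ^+ 2 - b ^+ 2); move: (a ^+ 2) (b ^+ 2) => x y; nra.
rewrite ge0_integralZl//; last 2 first.
- exact: emeasurable_funD.
- by move=> w _; rewrite adde_ge0.
rewrite ge0_integralD//.
apply: (@le_trans _ _ ((2^-1)%:E * (kap%:E + kap%:E))%E).
  by apply: lee_wpmul2l; [rewrite lee_fin|apply: leeD; exact: xi_moment4].
by rewrite -EFinD -EFinM lee_fin; lra.
Qed.

(** Any weight dominated by G is allowed, since the lemma serves both om and the damped weights. *)
Lemma weighted_moment (om' : R * L2path R -> R) : measurable_fun setT om' ->
  {ae P, forall w, `|om' (Y w, X w)| <= G (Y w)} -> forall nu mu,
  (\int[P]_w ((om' (Y w, X w) * xi nu (X w) * xi mu (X w)) ^+ 2)%:E <= (CG * kap)%:E)%E.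
Proof.
move=> mo oG nu mu.
pose f (x : L2path R) := (xi nu x) ^+ 2 * (xi mu x) ^+ 2.
have mf : measurable_fun setT f.
  by apply: measurable_funM; apply: measurable_funX; exact: measurable_xi.
have f0 x : 0 <= f x by rewrite mulr_ge0// sqr_ge0.
apply: (@le_trans _ _ (\int[P]_w (G (Y w) ^+ 2 * f (X w))%:E)%E).
  apply: ae_ge0_le_integral => //.
  - by move=> w _; rewrite lee_fin sqr_ge0.
  - apply/measurable_EFinP/measurable_funX; apply: measurable_funM => //.
    by apply: measurable_funM => //; exact: (measurableT_comp mo mZ0).
  - by move=> w _; rewrite lee_fin mulr_ge0// sqr_ge0.
  - apply/measurable_EFinP/measurable_funM; last exact: (measurableT_comp mf mX).
    by apply/measurable_funX/measurableT_comp.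
  apply: filterS oG => w ow _; rewrite lee_fin -mulrA !exprMn ler_wpM2r//.
    by rewrite mulr_ge0// sqr_ge0.
  rewrite -real_normK ?num_real// ler_sqr ?nnegrE//.
  exact: le_trans ler01 (G1 _).
apply: (le_trans (HG mf f0)); rewrite EFinM; apply: lee_wpmul2l; first by rewrite lee_fin.
exact: xi_moment22.
Qed.

(** The s_N of the overview, which is the squared norm of the functional [lin x] on the span of the
    first N.+1 basis elements. *)
Definition envelope N (x : L2path R) : R := \sum_(nu < N.+1) (xi nu x) ^+ 2 / gam nu.

Let gam0 nu : 0 < gam nu := gam_gt0 nu.

Lemma envelope_ge0 N x : 0 <= envelope N x.
Proof. by apply: sumr_ge0 => nu _; rewrite divr_ge0 ?sqr_ge0// ltW. Qed.

Lemma measurable_envelope N : measurable_fun setT (envelope N).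
Proof.
apply: measurable_sum => nu; apply: measurable_funM => //.
by apply: measurable_funX; exact: measurable_xi.
Qed.

Lemma envelope_moment N : (\int[P]_w (envelope N (X w))%:E <= (kap * Gam)%:E)%E.
Proof.
have m2 nu : measurable_fun setT (fun w => ((xi nu (X w)) ^+ 2)%:E).
  by apply/measurable_EFinP/measurable_funX.
have mt nu : measurable_fun setT (fun w => ((gam nu)^-1%:E * ((xi nu (X w)) ^+ 2)%:E)%E).
  exact: measurable_funeM.
have i0 nu : 0 <= (gam nu)^-1 by rewrite invr_ge0 ltW.
have pt nu w : (0 <= (gam nu)^-1%:E * ((xi nu (X w)) ^+ 2)%:E)%E.
  by rewrite mule_ge0// lee_fin// sqr_ge0.
have -> : (\int[P]_w (envelope N (X w))%:E =
    \sum_(nu < N.+1) \int[P]_w ((gam nu)^-1%:E * ((xi nu (X w)) ^+ 2)%:E))%E.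
  rewrite -(ge0_integral_sum _ measurableT (f := fun (nu : 'I_N.+1) w =>
      ((gam nu)^-1%:E * ((xi nu (X w)) ^+ 2)%:E)%E))//.
  apply: eq_integral => w _; rewrite /envelope -sumEFin; apply: eq_bigr => nu _.
  by rewrite mulrC EFinM.
apply: (@le_trans _ _ (\sum_(nu < N.+1) (kap * (gam nu)^-1)%:E)%E); last first.
  by rewrite sumEFin -mulr_sumr lee_fin ler_wpM2l// (le_trans ler01 kap1).
apply: lee_sum => nu _; rewrite ge0_integralZl//; last 2 first.
- by move=> w _; rewrite lee_fin sqr_ge0.
- by rewrite lee_fin.
rewrite mulrC EFinM; apply: lee_wpmul2l; first by rewrite lee_fin.
have := xi_moment22 nu 0; rewrite /=.
by under eq_integral do rewrite expr1n mulr1.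
Qed.

(* On the ball |theta| <= M r, a combination of xi_0, ..., xi_N of norm |theta|
   is at most M r sqrt (envelope N x), so min (2, |.|) there is at most
   (2 + M) min (1, r sqrt (envelope N x)): the random direction is replaced by
   a weight that depends on (y, x) only. *)
Definition damped (r : R) N (z : R * L2path R) : R :=
  G z.1 * Num.min 1 (r * Num.sqrt (envelope N z.2)).

Lemma measurable_damped r N : measurable_fun setT (damped r N).
Proof.
apply: measurable_funM; first exact: (measurableT_comp mG measurable_fst).
apply: measurable_minr; first exact: measurable_cst.
apply: measurable_funM; first exact: measurable_cst.
apply: (measurableT_comp (continuous_measurable_fun (@sqrt_continuous R))).
exact: (measurableT_comp (measurable_envelope N) measurable_snd).
Qed.

Lemma damped_ge0 r N z : 0 <= r -> 0 <= damped r N z.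
Proof.
move=> r0; rewrite mulr_ge0 ?(le_trans ler01 (G1 _))// le_min ler01/=.
by rewrite mulr_ge0// sqrtr_ge0.
Qed.

Lemma damped_le r N z : 0 <= r -> `|damped r N z| <= G z.1.
Proof.
move=> r0; rewrite ger0_norm ?damped_ge0// ler_piMr ?(le_trans ler01 (G1 _))//.
by rewrite ge_min lexx.
Qed.

Let sc N (c : nat -> R) := \sum_(nu < N.+1) gam nu * (c nu) ^+ 2.
Let ev N (c : nat -> R) x := \sum_(nu < N.+1) c nu * xi nu x.

Let sc0 N c : 0 <= sc N c.
Proof. by apply: sumr_ge0 => nu _; rewrite mulr_ge0 ?sqr_ge0// ltW. Qed.

Lemma measurable_comb_eval N c : measurable_fun setT (ev N c : L2path R -> R).
Proof. by apply: measurable_sum => nu; apply: measurable_funM => //; exact: measurable_xi. Qed.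

Lemma comb_eval_le N c x : (ev N c x) ^+ 2 <= envelope N x * sc N c.
Proof.
rewrite /ev; under eq_bigr do rewrite mulrC.
exact: (@weighted_cauchy_schwarz _ _ (fun nu : 'I_N.+1 => gam nu)
  (fun nu => xi nu x) (fun nu => c nu) (fun nu => gam0 nu)).
Qed.

Lemma comb_eval_moment4 N c : (\int[P]_w ((ev N c (X w)) ^+ 4)%:E <= (kap * (sc N c) ^+ 2)%:E)%E.
Proof.
have hc := comb_Hm N c; have lc := Hm_L2I m0 hc.
have := lin_moment4 M00 HM0 hc => H.
under eq_integral do rewrite /ev -(lin_comb N c (lX _)).
apply: (le_trans H); rewrite lee_fin.
have k0 : 0 <= kappa4 M0 by exact: kappa4_ge0.
have q0 := ipH_ge0 (lexx 0) hc.
have q1 : ip 0 (comb N c) (comb N c) <= sc N c.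
  rewrite [leRHS](_ : _ = ip lam (comb N c) (comb N c)).
    by rewrite !(ipH_E _ lc lc) /ip1 mul0r addr0 addrA lerDl mulr_ge0//; exact: Jform_ge0.
  by rewrite ip_comb; apply: eq_bigr => nu _; ring.
apply: ler_pM => //; first exact: sqr_ge0.
  by rewrite lerDr.
by rewrite ler_sqr ?nnegrE.
Qed.

(** The minimum is bounded by r sqrt s and G by G^2, which conditioning on X turns into CG. Then
    sqrt s v^2 is split by a weighted arithmetic-geometric inequality, so that only E s and E v^4
    are needed. *)
Lemma damped_second_moment r N c : 0 < r ->
  (\int[P]_w (damped r N (Y w, X w) * (ev N c (X w)) ^+ 2)%:E <=
   (CG * kap * Num.sqrt Gam * r * sc N c)%:E)%E.
Proof.
move=> r0; have kap0 : 0 < kap by apply: lt_le_trans kap1.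
have Gam0 : 0 < Gam.
  by apply: lt_le_trans (HGam 0); rewrite big_ord1 invr_gt0.
have sG0 : 0 < Num.sqrt Gam by rewrite sqrtr_gt0.
have mev := measurable_comb_eval N c.
have [c0|cn0] := eqVneq (sc N c) 0.
  rewrite c0 mulr0 integral0_eq// => w _.
  have := comb_eval_le N c (X w); rewrite c0 mulr0 => h.
  by rewrite (_ : (ev N c (X w)) ^+ 2 = 0) ?mulr0//; apply/eqP; rewrite eq_le h sqr_ge0.
have cp : 0 < sc N c by rewrite lt_neqAle eq_sym cn0 sc0.
(* This t makes the bounds t kap Gam and kap (sc N c)^2 / t equal. It must be positive, hence the
   separate case sc N c = 0. *)
pose t := sc N c / Num.sqrt Gam; have t0 : 0 < t by rewrite divr_gt0.
pose f (x : L2path R) := r * (2^-1 * (t * envelope N x + t^-1 * (ev N c x) ^+ 4)).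
have f0 x : 0 <= f x.
  rewrite !mulr_ge0 ?(ltW r0)// addr_ge0// mulr_ge0 ?(ltW t0) ?invr_ge0 ?envelope_ge0 ?(ltW t0)//.
  exact: exprn_even_ge0.
have mE := measurable_envelope N.
have mf : measurable_fun setT f.
  do 2 (apply: measurable_funM => //); apply: measurable_funD; apply: measurable_funM => //.
  exact: measurable_funX.
apply: (@le_trans _ _ (\int[P]_w (G (Y w) ^+ 2 * f (X w))%:E)%E).
  apply: ge0_le_integral => //.
  - by move=> w _; rewrite lee_fin mulr_ge0 ?sqr_ge0// damped_ge0// ltW.
  - apply/measurable_EFinP/measurable_funM; first exact: (measurableT_comp (measurable_damped r N) mZ0).
    by apply: measurable_funX; exact: (measurableT_comp mev mX).
  - apply/measurable_EFinP/measurable_funM; last exact: (measurableT_comp mf mX).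
    by apply/measurable_funX/measurableT_comp.
  - move=> w _; rewrite lee_fin /damped /=.
    have G0 := le_trans ler01 (G1 (Y w)).
    rewrite -mulrA expr2 -mulrA ler_wpM2l//.
    apply: (@le_trans _ _ (f (X w))); last by rewrite ler_peMl.
    rewrite /f; move: (envelope_ge0 N (X w)) (ev N c (X w)); set e := envelope _ _ => e0 v.
    apply: (@le_trans _ _ (r * Num.sqrt e * v ^+ 2)).
      by rewrite ler_wpM2r ?sqr_ge0// ge_min lexx orbT.
    rewrite -mulrA ler_pM2l//.
    have -> : v ^+ 4 = (v ^+ 2) ^+ 2 by rewrite -exprM.
    rewrite -[X in t * X](sqr_sqrtr e0); move: (Num.sqrt e) (v ^+ 2) => a b.
    have ti : t * t^-1 = 1 by rewrite mulfV// gt_eqF.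
    have ti0 : 0 < t^-1 by rewrite invr_gt0.
    have : 0 <= t^-1 * (t * a - b) ^+ 2 by rewrite mulr_ge0 ?sqr_ge0// ltW.
    rewrite (_ : t^-1 * _ = t * a ^+ 2 - 2 * (a * b) + t^-1 * b ^+ 2); first by lra.
    by field; rewrite gt_eqF.
apply: (le_trans (HG mf f0)).
have mEX : measurable_fun setT (fun w => (envelope N (X w))%:E).
  by apply/measurable_EFinP; exact: (measurableT_comp mE mX).
have m4 : measurable_fun setT (fun w => ((ev N c (X w)) ^+ 4)%:E).
  by apply/measurable_EFinP/measurable_funX; exact: (measurableT_comp mev mX).
have pE w : (0 <= (envelope N (X w))%:E)%E by rewrite lee_fin envelope_ge0.
have p4 w : (0 <= ((ev N c (X w)) ^+ 4)%:E)%E by rewrite lee_fin exprn_even_ge0.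
have ti : 0 <= t^-1 by rewrite invr_ge0 ltW.
have -> : (\int[P]_w (f (X w))%:E = (r * 2^-1)%:E * (t%:E * \int[P]_w (envelope N (X w))%:E +
    t^-1%:E * \int[P]_w ((ev N c (X w)) ^+ 4)%:E))%E.
  rewrite -(ge0_integralZl _ measurableT mEX)//; last by rewrite lee_fin ltW.
  rewrite -(ge0_integralZl _ measurableT m4)//.
  rewrite -ge0_integralD//; last 4 first.
  - by move=> w _; rewrite mule_ge0// lee_fin ltW.
  - exact: measurable_funeM.
  - by move=> w _; rewrite mule_ge0.
  - exact: measurable_funeM.
  rewrite -ge0_integralZl//; last 3 first.
  - by apply: emeasurable_funD; exact: measurable_funeM.
  - by move=> w _; rewrite adde_ge0// mule_ge0// lee_fin ltW.
  - by rewrite lee_fin mulr_ge0// ltW.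
  by apply: eq_integral => w _; rewrite /f mulrA EFinM EFinD !EFinM.
apply: (@le_trans _ _ (CG%:E * ((r * 2^-1)%:E * (t%:E * (kap * Gam)%:E + t^-1%:E * (kap * (sc N c) ^+ 2)%:E)))%E).
  apply: lee_wpmul2l; first by rewrite lee_fin.
  apply: lee_wpmul2l; first by rewrite lee_fin mulr_ge0// ltW.
  apply: leeD; apply: lee_wpmul2l; rewrite ?lee_fin ?(ltW t0)//.
    exact: envelope_moment.
  exact: comb_eval_moment4.
rewrite [leLHS](_ : _ = (CG * (r * 2^-1 * (t * (kap * Gam) + t^-1 * (kap * (sc N c) ^+ 2))))%:E); last first.
  by rewrite !(EFinM, EFinD).
rewrite lee_fin /t le_eqVlt; apply/orP; left; apply/eqP.
rewrite -[Gam in LHS](sqr_sqrtr (ltW Gam0)) sqrtr_sqr (ger0_norm (ltW sG0)).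
by field; rewrite cn0 gt_eqF.
Qed.

Lemma L2_om : L2on P setT (fun w => om (Y w, X w)).
Proof.
split; first exact: (measurableT_comp mom mZ0).
have := weighted_moment mom omG 0 0; rewrite /=.
under eq_integral do rewrite !mulr1.
by move=> h; apply: le_lt_trans h _; exact: ltry.
Qed.

Lemma L2_lin_sqr theta : Hm m theta.2 -> L2on P setT (fun w => (lin (X w) theta) ^+ 2).
Proof.
move=> h; have [ml _] := L2_lin (Hm_L2I m0 h); split; first exact: measurable_funX.
under eq_integral do rewrite -exprM.
by apply: le_lt_trans (lin_moment4 M00 HM0 h) _; exact: ltry.
Qed.

(** The curvature identity holds against nonnegative functions of X, hence for the squares of linear
    functionals; polarization gives the products. *)
Lemma curvature_ip theta eta : Hm m theta.2 -> Hm m eta.2 ->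
  \int[P]_w (om (Y w, X w) * (lin (X w) theta * lin (X w) eta)) = - ip 0 theta eta.
Proof.
move=> ht he; have lt := Hm_L2I m0 ht; have le := Hm_L2I m0 he.
pose o w := om (Y w, X w).
have intl theta' : Hm m theta'.2 ->
    P.-integrable setT (EFin \o (fun w => o w * (lin (X w) theta') ^+ 2)).
  by move=> h; exact: (L2on_mul measurableT L2_om (L2_lin_sqr h)).
have sq theta' : Hm m theta'.2 ->
    \int[P]_w (o w * (lin (X w) theta') ^+ 2) = - ip 0 theta' theta'.
  move=> h; have l := Hm_L2I m0 h.
  have mf : measurable_fun setT (fun x : L2path R => (lin x theta') ^+ 2).
    by apply: measurable_funX; apply: measurable_funD => //; exact: measurable_dotI_path.
  have := Hcurv mf (fun x => sqr_ge0 _).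
  rewrite /ipH mul0r addr0 fine_expectation => H.
  apply: oppr_inj; rewrite opprK -mulN1r -RintegralZl//; last exact: intl.
  transitivity (fine (\int[P]_w (- o w * (lin (X w) theta') ^+ 2)%:E)).
    by apply: eq_Rintegral => w _; rewrite mulN1r mulNr.
  by rewrite H; apply: eq_Rintegral => w _; rewrite expr2 mulrA.
have hs : Hm m (hcomb 1 theta eta).2 by exact: Hm_lin.
have E := sq _ hs; rewrite (ipH_linl _ _ ht he hs) !(ipH_linr _ _ ht he)// in E.
rewrite (ipHC _ he ht) in E.
have i3 : P.-integrable setT (EFin \o (fun w => o w * (lin (X w) theta * lin (X w) eta))).
  have hh : (fun w => 2^-1 * (o w * (lin (X w) (hcomb 1 theta eta)) ^+ 2 +
     - (o w * (lin (X w) theta) ^+ 2 + o w * (lin (X w) eta) ^+ 2))) =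
     (fun w => o w * (lin (X w) theta * lin (X w) eta)).
    by apply/funext => w; rewrite (lin_hcomb 1 (lX w) lt le); field.
  have i1 := integrableD measurableT (intl _ hs)
    (integrableN (integrableD measurableT (intl _ ht) (intl _ he))).
  rewrite -hh; exact: (integrableZl measurableT 2^-1 i1).
move: E; have -> : \int[P]_w (o w * (lin (X w) (hcomb 1 theta eta)) ^+ 2) =
   (\int[P]_w (o w * (lin (X w) theta) ^+ 2) + \int[P]_w (o w * (lin (X w) eta) ^+ 2)) +
   2 * \int[P]_w (o w * (lin (X w) theta * lin (X w) eta)).
  have it := intl _ ht; have ie := intl _ he.
  rewrite -RintegralD// -RintegralZl// -RintegralD//.
  - by apply: eq_Rintegral => w _; rewrite (lin_hcomb 1 (lX w) lt le); ring.
  - exact: (integrableD measurableT it ie).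
  - exact: (integrableZl measurableT 2 i3).
rewrite (sq _ ht) (sq _ he) -/o => E; rewrite /o in E *; lra.
Qed.

(** * The deviation event *)

Let Z i w : R * L2path R := (Ys i w, Xs i w).
Let Z0 w : R * L2path R := (Y w, X w).
Let xiZ nu (z : R * L2path R) := xi nu z.2.

Let mxiZ nu : measurable_fun setT (xiZ nu).
Proof. exact: (measurableT_comp (measurable_xi nu) measurable_snd). Qed.

Definition deviation (om' : R * L2path R -> R) n N w :=
  total_dev P Z Z0 om' xiZ gam n N w.

Let damped_ae r N : 0 <= r -> {ae P, forall w, `|damped r N (Y w, X w)| <= G (Y w)}.
Proof. by move=> r0; apply: nearW => w; apply: (le_trans (damped_le _ _ r0)). Qed.

Let dev_prop (om' : R * L2path R -> R) n N : (0 < n)%N -> measurable_fun setT om' ->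
  {ae P, forall w, `|om' (Y w, X w)| <= G (Y w)} ->
  measurable_fun setT (deviation om' n N) /\ 
  (\int[P]_w (deviation om' n N w)%:E <= (n%:R^-1 * (CG * kap) * Gam ^+ 2)%:E)%E.
Proof.
move=> n0 mo oG; split.
  by apply: measurable_total_dev => //; exact: mZ.
apply: (le_trans (total_dev_moment mZ mZ0 indep ident mo mxiZ gam0 (weighted_moment mo oG) N n0)).
rewrite lee_fin ler_wpM2l//.
  by rewrite mulr_ge0 ?invr_ge0// mulr_ge0// (le_trans ler01 kap1).
rewrite ler_sqr ?nnegrE//; last by apply: le_trans (HGam 0); rewrite sumr_ge0// => nu _; rewrite invr_ge0 ltW.
by apply: sumr_ge0 => nu _; rewrite invr_ge0 ltW.
Qed.

(* The bound on the deviations is uniform in N, and the event that it fails for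
   all large N is an increasing union; a bound along infinitely many N is all
   that the passage to the limit N -> oo needs. *)
Lemma good_event n (r t : R) : (0 < n)%N -> 0 < r -> 0 < t ->
  exists bad : set Omega, [/\ measurable bad,
    (P bad <= (2 * (n%:R^-1 * (CG * kap) * Gam ^+ 2) / t ^+ 2)%:E)%E &
    forall w, ~ bad w -> forall M, exists2 N, (M <= N)%N &
      deviation om n N w + deviation (damped r N) n N w <= t ^+ 2].
Proof.
move=> n0 r0 t0; set b := n%:R^-1 * (CG * kap) * Gam ^+ 2.
pose E N := [set w | t ^+ 2 < deviation om n N w + deviation (damped r N) n N w].
have p1 N := dev_prop N n0 mom omG.
have p2 N := dev_prop N n0 (measurable_damped r N) (damped_ae N (ltW r0)).
have ms N : measurable_fun setT (fun w => deviation om n N w + deviation (damped r N) n N w).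
  by apply: measurable_funD; [have [] := p1 N|have [] := p2 N].
have d0 om' N w : 0 <= deviation om' n N w by exact: total_dev_ge0.
have mE N : measurable (E N) by exact: measurable_layer.
have PE N : (P (E N) <= (2 * b / t ^+ 2)%:E)%E.
  apply: markov_ge0 => //; first by rewrite exprn_gt0.
    by move=> w; rewrite addr_ge0.
  under eq_integral do rewrite EFinD.
  rewrite ge0_integralD//; last 4 first.
  - by move=> w _; rewrite lee_fin.
  - by apply/measurable_EFinP; have [] := p1 N.
  - by move=> w _; rewrite lee_fin.
  - by apply/measurable_EFinP; have [] := p2 N.
  by rewrite mulr_natl mulr2n EFinD; apply: leeD; [have [] := p1 N|have [] := p2 N].
have [mb Pb] := eventually_event_le mE PE.
exists (\bigcup_M \bigcap_(N in [set N | (M <= N)%N]) E N); split => //.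
move=> w nb M; apply: contrapT => H; apply: nb; exists M => // N /= MN.
by rewrite /E /= ltNge; apply/negP => le; apply: H; exists N.
Qed.

Lemma sc_norm N c : sc N c = nH (comb N c) ^+ 2.
Proof.
rewrite (normH_sqr lam0 (comb_Hm N c)) ip_comb.
by apply: eq_bigr => nu _; ring.
Qed.

Section FixedSample.
Variables (n : nat) (w : Omega) (r t M : R).
Hypotheses (r0 : 0 < r) (t0 : 0 < t) (MM : 0 < M).
Let lXs i : L2I (Xs i w) := (pXs i).2 w.

Let dev0 om' N : 0 <= deviation om' n N w.
Proof. exact: total_dev_ge0. Qed.

Lemma curvature_deviation N c c' : deviation om n N w <= t ^+ 2 ->
  `|n%:R^-1 * (\sum_(i < n) om (Z i w) * lin (Xs i w) (comb N c) * lin (Xs i w) (comb N c')) +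
    ip 0 (comb N c) (comb N c')| <=
  t * (nH (comb N c) * nH (comb N c')).
Proof.
move=> dt; have := deviation_form Z mZ0 mom mxiZ gam0 (weighted_moment mom omG) n N w c c'.
have -> : \int[P]_w0 (om (Z0 w0) * (\sum_(nu < N.+1) c nu * xiZ nu (Z0 w0)) *
     (\sum_(nu < N.+1) c' nu * xiZ nu (Z0 w0))) = - ip 0 (comb N c) (comb N c').
  rewrite -(curvature_ip (comb_Hm N c) (comb_Hm N c')); apply: eq_Rintegral => w' _.
  by rewrite !lin_comb// mulrA.
rewrite opprK; under [X in n%:R^-1 * X]eq_bigr do rewrite -/(ev N c _).
have -> : \sum_(i < n) om (Z i w) * (\sum_(nu < N.+1) c nu * xiZ nu (Z i w)) *
    (\sum_(nu < N.+1) c' nu * xiZ nu (Z i w)) =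
    \sum_(i < n) om (Z i w) * lin (Xs i w) (comb N c) * lin (Xs i w) (comb N c').
  by apply: eq_bigr => i _; rewrite !lin_comb.
rewrite -/(sc N c) -/(sc N c') !sc_norm -exprMn => h.
have q0 : 0 <= nH (comb N c) * nH (comb N c').
  by rewrite mulr_ge0 ?normH_ge0.
have s0 := mulr_ge0 (ltW t0) q0.
rewrite -ler_sqr ?nnegrE// real_normK ?num_real//.
by apply: (le_trans h); rewrite [leRHS]exprMn ler_wpM2r ?sqr_ge0.
Qed.

Let C3 := CG * kap * Num.sqrt Gam * r + t.

Let C30 : 0 <= C3.
Proof.
rewrite addr_ge0 ?(ltW t0)// mulr_ge0 ?(ltW r0)// mulr_ge0 ?sqrtr_ge0// mulr_ge0//.
exact: le_trans ler01 kap1.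
Qed.

Lemma damped_deviation N c : deviation (damped r N) n N w <= t ^+ 2 ->
  n%:R^-1 * (\sum_(i < n) damped r N (Z i w) * (lin (Xs i w) (comb N c)) ^+ 2) <=
  C3 * nH (comb N c) ^+ 2.
Proof.
move=> dt; have mo := measurable_damped r N.
have := deviation_form Z mZ0 mo mxiZ gam0 (weighted_moment mo (damped_ae N (ltW r0))) n N w c c.
set I := \int[P]_w0 _; set A := n%:R^-1 * _.
have AE : A = n%:R^-1 * (\sum_(i < n) damped r N (Z i w) * (lin (Xs i w) (comb N c)) ^+ 2).
  by rewrite /A; congr (_ * _); apply: eq_bigr => i _; rewrite !lin_comb// expr2 mulrA.
have I1 : I <= CG * kap * Num.sqrt Gam * r * sc N c.
  have := damped_second_moment N c r0.
  set J := (\int[P]_w0 _)%E => HJ.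
  have -> : I = fine J.
    by apply: eq_Rintegral => w' _; rewrite /ev expr2 mulrA.
  have J0 : (0 <= J)%E.
    by apply: integral_ge0 => w' _; rewrite lee_fin mulr_ge0 ?sqr_ge0// damped_ge0// ltW.
  by rewrite -lee_fin fineK// ge0_fin_numE//; apply: le_lt_trans HJ _; exact: ltry.
rewrite -/(sc N c) -expr2 -AE => h.
have : `|A - I| <= t * sc N c.
  rewrite -ler_sqr ?nnegrE ?mulr_ge0 ?(ltW t0)// real_normK ?num_real//.
  by apply: (le_trans h); rewrite exprMn ler_wpM2r ?sqr_ge0.
rewrite ler_norml => /andP[_ h2]; rewrite -sc_norm /C3 mulrDl.
by move: h2 I1; lra.
Qed.

Lemma min_scale (x y : R) : 0 <= x -> x <= M * y -> Num.min 2 x <= (2 + M) * Num.min 1 y.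
Proof.
move=> x0 xy; have y0 : 0 <= y by rewrite -(pmulr_rge0 _ MM) (le_trans x0).
have [y1|y1] := leP 1 y.
  by rewrite mulr1 ge_min; apply/orP; left; rewrite lerDl ltW.
by rewrite ge_min; apply/orP; right; apply: (le_trans xy); rewrite ler_wpM2r// lerDr.
Qed.

(** After the truncated factor is replaced by the damped weight, Cauchy-Schwarz with that weight
    separates the two directions, and [damped_deviation] bounds each square. *)
Lemma remainder_deviation N c c' : deviation (damped r N) n N w <= t ^+ 2 ->
  nH (comb N c) <= M * r ->
  n%:R^-1 * (\sum_(i < n) G (Ys i w) * (`|lin (Xs i w) (comb N c)| *
     Num.min 2 `|lin (Xs i w) (comb N c)| * `|lin (Xs i w) (comb N c')|)) <=
  (2 + M) * C3 * (nH (comb N c) * nH (comb N c')).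
Proof.
move=> dt cM; have d1 := damped_deviation c dt; have d2 := damped_deviation c' dt.
have n1 : 0 <= n%:R^-1 :> R by rewrite invr_ge0.
have M2 : 0 <= 2 + M by rewrite addr_ge0// ltW.
pose a i := `|lin (Xs i w) (comb N c)|; pose b i := `|lin (Xs i w) (comb N c')|.
have st : n%:R^-1 * (\sum_(i < n) G (Ys i w) * (a i * Num.min 2 (a i) * b i)) <=
    (2 + M) * (n%:R^-1 * (\sum_(i < n) damped r N (Z i w) * a i * b i)).
  rewrite mulrCA ler_wpM2l// mulr_sumr; apply: ler_sum => i _.
  have ae : a i <= M * (r * Num.sqrt (envelope N (Xs i w))).
    rewrite /a -sqrtr_sqr lin_comb//; apply: (@le_trans _ _ (Num.sqrt (envelope N (Xs i w) * sc N c))).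
      by rewrite ler_wsqrtr// comb_eval_le.
    rewrite sqrtrM ?envelope_ge0// sc_norm sqrtr_sqr ger0_norm ?normH_ge0// mulrA mulrC.
    by rewrite ler_wpM2r ?sqrtr_ge0.
  have := min_scale (normr_ge0 _) ae => h; rewrite /damped /=.
  have G0 := le_trans ler01 (G1 (Ys i w)).
  rewrite (_ : (2 + M) * _ = G (Ys i w) * (a i * b i) * ((2 + M) * Num.min 1 (r * Num.sqrt (envelope N (Xs i w))))); last by ring.
  rewrite (_ : G (Ys i w) * _ = G (Ys i w) * (a i * b i) * Num.min 2 (a i)); last by ring.
  by rewrite ler_wpM2l// mulr_ge0// mulr_ge0 /a /b.
apply: (le_trans st); rewrite -[leRHS]mulrA ler_wpM2l//.
have dm0 i : 0 <= damped r N (Z i w) by rewrite damped_ge0// ltW.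
have cs := sum_weighted_cauchy_schwarz (fun i : 'I_n => a i) (fun i : 'I_n => b i) (fun i : 'I_n => dm0 i).
have e1 : \sum_(i < n) damped r N (Z i w) * (a i) ^+ 2 =
   \sum_(i < n) damped r N (Z i w) * (lin (Xs i w) (comb N c)) ^+ 2.
  by apply: eq_bigr => i _; rewrite /a real_normK ?num_real.
have e2 : \sum_(i < n) damped r N (Z i w) * (b i) ^+ 2 =
   \sum_(i < n) damped r N (Z i w) * (lin (Xs i w) (comb N c')) ^+ 2.
  by apply: eq_bigr => i _; rewrite /b real_normK ?num_real.
rewrite e1 e2 in cs.
have q0 : 0 <= \sum_(i < n) damped r N (Z i w) * a i * b i.
  by apply: sumr_ge0 => i _; rewrite mulr_ge0 /b// mulr_ge0 /a.
rewrite -ler_sqr ?nnegrE; first last.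
- by rewrite mulr_ge0// mulr_ge0 ?normH_ge0.
- by rewrite mulr_ge0.
rewrite exprMn; apply: (@le_trans _ _ ((n%:R^-1 * (\sum_(i < n) damped r N (Z i w) * (lin (Xs i w) (comb N c)) ^+ 2)) *
  (n%:R^-1 * (\sum_(i < n) damped r N (Z i w) * (lin (Xs i w) (comb N c')) ^+ 2)))).
  by rewrite [leRHS]mulrACA -expr2 ler_wpM2l ?sqr_ge0.
rewrite !exprMn expr2 mulrACA; apply: ler_pM => //.
- by rewrite mulr_ge0// sumr_ge0// => i _; rewrite mulr_ge0 ?sqr_ge0.
- by rewrite mulr_ge0// sumr_ge0// => i _; rewrite mulr_ge0 ?sqr_ge0.
Qed.

Variable tau : (R -> R) -> (R -> R).
Hypothesis htau : is_tau P X B m lam tau.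
Hypothesis good : forall M, exists2 N, (M <= N)%N &
      deviation om n N w + deviation (damped r N) n N w <= t ^+ 2.
Variables g D : R * (R -> R).
Hypotheses (hg : Hm m g.2) (hD : Hm m D.2).

Let linc theta : Hm m theta.2 -> forall i, lin (Xs i w) (proj N theta) @[N --> \oo] --> lin (Xs i w) theta.
Proof. by move=> h i; exact: lin_proj_cvg htau (lXs i) h. Qed.

Let pg N := norm_proj_le N hg.
Let pD N := norm_proj_le N hD.

Lemma curvature_estimate :
  ip 0 g D + n%:R^-1 * (\sum_(i < n) om (Z i w) * lin (Xs i w) g * lin (Xs i w) D) <=
  t * (nH g * nH D).
Proof.
apply: (frequently_le (u := fun N => ip 0 (proj N g) (proj N D) +
  n%:R^-1 * (\sum_(i < n) om (Z i w) * lin (Xs i w) (proj N g) * lin (Xs i w) (proj N D)))).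
  apply: cvgD; first exact: ip0_proj_cvg.
  apply: cvgMr; apply: (cvg_ord_sum (u := fun i N => om (Z i w) * lin (Xs i w) (proj N g) * lin (Xs i w) (proj N D))) => i.
  by apply: cvgM; [apply: cvgMr; exact: linc|exact: linc].
move=> K; have [N KN h] := good K; exists N => //.
have d1 : deviation om n N w <= t ^+ 2 by apply: le_trans h; rewrite lerDl dev0.
have := curvature_deviation (coef g) (coef D) d1.
rewrite addrC => /(le_trans (ler_norm _))/le_trans; apply.
by rewrite ler_pM2l//; apply: ler_pM; rewrite ?normH_ge0//; [exact: pg|exact: pD].
Qed.

Lemma remainder_estimate : nH g <= M * r ->
  n%:R^-1 * (\sum_(i < n) G (Ys i w) * (`|lin (Xs i w) g| *
     Num.min 2 `|lin (Xs i w) g| * `|lin (Xs i w) D|)) <=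
  (2 + M) * (CG * kap * Num.sqrt Gam * r + t) * (nH g * nH D).
Proof.
move=> gM; have M2 : 0 <= 2 + M by rewrite addr_ge0// ltW.
apply: (frequently_le (u := fun N => n%:R^-1 * (\sum_(i < n) G (Ys i w) * (`|lin (Xs i w) (proj N g)| *
     Num.min 2 `|lin (Xs i w) (proj N g)| * `|lin (Xs i w) (proj N D)|)))).
  apply: cvgMr; apply: (cvg_ord_sum (u := fun i N => G (Ys i w) * (`|lin (Xs i w) (proj N g)| *
     Num.min 2 `|lin (Xs i w) (proj N g)| * `|lin (Xs i w) (proj N D)|))) => i.
  apply: cvgMr; have ag : `|lin (Xs i w) (proj N g)| @[N --> \oo] --> `|lin (Xs i w) g|.
    by apply: cvg_norm; exact: linc.
  have aD : `|lin (Xs i w) (proj N D)| @[N --> \oo] --> `|lin (Xs i w) D|.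
    by apply: cvg_norm; exact: linc.
  apply: (cvgM (cvgM ag _) aD).
  (* The minimum is expressed through sums and absolute values to take the limit. *)
  rewrite minr_absE; under eq_fun do rewrite minr_absE.
  apply: cvgMl; apply: cvgB; first by apply: cvgD => //; exact: cvg_cst.
  by apply: cvg_norm; apply: cvgB => //; exact: cvg_cst.
move=> K; have [N KN h] := good K; exists N => //.
have d2 : deviation (damped r N) n N w <= t ^+ 2 by apply: le_trans h; rewrite lerDr dev0.
apply: (le_trans (remainder_deviation (coef D) d2 (le_trans (pg N) gM))).
by rewrite ler_wpM2l ?mulr_ge0//; apply: ler_pM; rewrite ?normH_ge0//; [exact: pg|exact: pD].
Qed.

(* chi is 1 in general, and 0 when the third derivative of the loss vanishes. *)
Lemma estimation_error_le (ell : R -> R -> R) (W : (R -> R) -> (R -> R))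
    (theta0 thetah : R * (R -> R)) (chi : R) :
  is_W P X B m lam W -> Hm m theta0.2 -> Hm m thetah.2 -> 0 <= chi ->
  (forall i u, derivable (ell (Ys i w)) u 1) ->
  (forall theta, Hm m theta.2 ->
    criterion m ell Ys Xs lam n w theta <= criterion m ell Ys Xs lam n w thetah) ->
  g = hcomb (-1) theta0 thetah ->
  D = thetah - theta0 - Score P X B m ell Ys Xs lam tau W n w theta0 ->
  (forall i, `|(ell (Ys i w))^`()%classic (lin (Xs i w) thetah) -
      (ell (Ys i w))^`()%classic (lin (Xs i w) theta0) - om (Z i w) * lin (Xs i w) g| <=
     chi * (G (Ys i w) * (`|lin (Xs i w) g| * Num.min 2 `|lin (Xs i w) g|))) ->
  nH g <= M * r ->
  nH D <=
    (t + chi * ((2 + M) * (CG * kap * Num.sqrt Gam * r + t))) * nH g.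
Proof.
move=> hW h0 hh chi0 dell Hmax gE DE Hrem gM.
have M2 : 0 <= 2 + M by rewrite addr_ge0// ltW.
have b0 : 0 <= t + chi * ((2 + M) * (CG * kap * Num.sqrt Gam * r + t)).
  by rewrite addr_ge0 ?(ltW t0)// mulr_ge0// mulr_ge0.
have [D0|Dn0] := eqVneq (nH D) 0.
  by rewrite D0 mulr_ge0// normH_ge0.
have Dp : 0 < nH D by rewrite lt_neqAle eq_sym Dn0 normH_ge0.
rewrite -(ler_pM2r Dp) -expr2 (normH_sqr lam0 hD) -[leRHS]mulrA.
have := estimation_error_identity (n := n) htau hW dell lXs h0 hh Hmax.
rewrite -DE -gE => ->.
pose v i := lin (Xs i w) D; pose u i := lin (Xs i w) g.
have n1 : 0 <= n%:R^-1 :> R by rewrite invr_ge0.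
rewrite [leRHS]mulrDl; apply: (@le_trans _ _
  ((ip 0 g D + n%:R^-1 * (\sum_(i < n) om (Z i w) * u i * v i)) +
   chi * (n%:R^-1 * (\sum_(i < n) G (Ys i w) * (`|u i| * Num.min 2 `|u i| * `|v i|))))).
  rewrite -[leRHS]addrA lerD2l [chi * _]mulrCA -mulrDr ler_wpM2l// mulr_sumr -big_split /=.
  apply: ler_sum => i _; rewrite -/(v i).
  have h1 := Hrem i; rewrite -/(u i) in h1.
  have h2 := ler_wpM2r (normr_ge0 (v i)) h1; rewrite -normrM in h2.
  have h3 := le_trans (ler_norm _) h2; rewrite mulrBl in h3.
  rewrite -lerBlDl; apply: (le_trans h3).
  by rewrite le_eqVlt; apply/orP; left; apply/eqP; ring.
apply: lerD; first exact: curvature_estimate.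
rewrite -[leRHS]mulrA ler_wpM2l//; exact: remainder_estimate.
Qed.

End FixedSample.

(** The exceptional event is fixed before the estimator enters, so it is measurable however thetah
    depends on w. *)
Lemma estimation_error_event n (r t M chi : R) (ell : R -> R -> R)
    (tau W : (R -> R) -> (R -> R)) (theta0 : R * (R -> R)) :
  (0 < n)%N -> 0 < r -> 0 < t -> 0 < M -> 0 <= chi ->
  is_tau P X B m lam tau -> is_W P X B m lam W -> Hm m theta0.2 ->
  exists bad : set Omega, [/\ measurable bad,
    (P bad <= (2 * (n%:R^-1 * (CG * kap) * Gam ^+ 2) / t ^+ 2)%:E)%E &
    forall w (thetah : R * (R -> R)), ~ bad w -> Hm m thetah.2 ->
      (forall i u, derivable (ell (Ys i w)) u 1) ->
      (forall theta, Hm m theta.2 ->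
        criterion m ell Ys Xs lam n w theta <= criterion m ell Ys Xs lam n w thetah) ->
      (forall i, `|(ell (Ys i w))^`()%classic (lin (Xs i w) thetah) -
          (ell (Ys i w))^`()%classic (lin (Xs i w) theta0) -
          om (Ys i w, Xs i w) * (lin (Xs i w) thetah - lin (Xs i w) theta0)| <=
        chi * (G (Ys i w) * (`|lin (Xs i w) thetah - lin (Xs i w) theta0| *
           Num.min 2 `|lin (Xs i w) thetah - lin (Xs i w) theta0|))) ->
      nH (thetah - theta0) <= M * r ->
      nH
        (thetah - theta0 - Score P X B m ell Ys Xs lam tau W n w theta0) <=
      (t + chi * ((2 + M) * (CG * kap * Num.sqrt Gam * r + t))) * (M * r)].
Proof.
move=> n0 r0 t0 MM chi0 htau hW h0.
have [bad [mb Pb Hb]] := good_event n0 r0 t0; exists bad; split => //.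
move=> w thetah nb hh dell Hmax Hrem gM; have good := Hb w nb.
have lXs i : L2I (Xs i w) := (pXs i).2 w.
have gE : thetah - theta0 = hcomb (-1) theta0 thetah.
  case: thetah theta0 {hh Hmax Hrem gM h0} => a1 a2 [b1 b2].
  by rewrite /hcomb; congr pair => /=; [ring|apply/funext => z; rewrite !fctE /=; ring].
have linE i : lin (Xs i w) thetah - lin (Xs i w) theta0 = lin (Xs i w) (hcomb (-1) theta0 thetah).
  by rewrite lin_hcomb//; [ring|exact: Hm_L2I m0 h0|exact: Hm_L2I m0 hh].
have hg : Hm m (hcomb (-1) theta0 thetah).2 by exact: Hm_lin.
have hD := error_Hm ell Ys n htau hW lXs h0 hh.
apply: (@le_trans _ _ ((t + chi * ((2 + M) * (CG * kap * Num.sqrt Gam * r + t))) *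
  nH (hcomb (-1) theta0 thetah))).
  have := estimation_error_le r0 t0 MM htau good hg hD hW h0 hh chi0 (fun i => @dell i) Hmax erefl erefl.
  apply => //.
    by move=> i; rewrite -linE; exact: Hrem.
  by rewrite -gE.
rewrite -gE; apply: ler_wpM2l => //.
rewrite addr_ge0 ?(ltW t0)// mulr_ge0// mulr_ge0 ?addr_ge0 ?(ltW MM) ?(ltW t0)//.
rewrite mulr_ge0 ?(ltW r0)// mulr_ge0 ?sqrtr_ge0// mulr_ge0//.
exact: le_trans ler01 kap1.
Qed.

End Concentration.

End Expansion.

End Geometry.

(** * Rates *)

Section RemainderWeights.
Context {R : realType} {d : measure_display} {Omega : measurableType d}.
Variable P : probability Omega R.

Lemma ident_ae d' (T : measurableType d') (Z : nat -> Omega -> T) (Z0 : Omega -> T)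
    (Q : set T) : (forall i, measurable_fun setT (Z i)) -> measurable_fun setT Z0 ->
  identically_distributed P Z Z0 -> measurable Q ->
  {ae P, forall w, Q (Z0 w)} -> {ae P, forall w, forall i, Q (Z i w)}.
Proof.
move=> mZ mZ0 ide mQ Q0; apply: ae_foralln => i.
have mpre (Y : Omega -> T) : measurable_fun setT Y -> measurable (Y @^-1` (~` Q)).
  by move=> mY; rewrite -[X in measurable X]setTI; apply: mY => //; exact: measurableC.
apply/(negligibleP _ (mpre _ (mZ i))).
transitivity (P (Z0 @^-1` (~` Q))); first exact: ide i _ (measurableC mQ).
by apply/(negligibleP _ (mpre _ mZ0)).
Qed.

Lemma ae_nonempty (Q : Omega -> Prop) : {ae P, forall w, Q w} -> exists w, Q w.
Proof.
move=> aQ; apply: contrapT => nQ.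
have [N [mN N0 QN]] := aQ.
have NT : N = setT by apply/seteqP; split=> // w _; apply: QN => Qw; apply: nQ; exists w.
by move: N0; rewrite NT probability_setT => /eqP; rewrite onee_eq0.
Qed.

(** If the supremum is not positive, then g(X) <= 0, so E S <= 0 and S = 0 almost surely; g(X) = 0
    at some point then excludes a negative supremum. In the other case C_ell may be +oo, and a
    finite c below it is all that the comparison of rates takes. *)
Lemma C_ell_dichotomy (X : Omega -> L2path R) (S : Omega -> \bar R) (g : L2path R -> \bar R) :
  (forall w, L2I (X w)) -> measurable_fun setT X -> measurable_fun setT S ->
  (forall w, (0 <= S w)%E) -> cond_exp P X S g ->
  (exists2 c : R, 0 < c & (c%:E <= C_ell g)%E) \/
  (C_ell g = 0%E /\ {ae P, forall w, S w = 0%E}).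
Proof.
move=> lX mX mS S0 [_ mg H].
have [Cpos|Cle] := ltP 0%E (C_ell g).
  left; case: (C_ell g) Cpos => [c| |]//; first by rewrite lte_fin => c0; exists c.
  by exists 1 => //; rewrite leey.
right; have gle w : (g (X w) <= 0)%E.
  by apply: le_trans Cle; apply: ereal_sup_ubound; exists (X w) => //; exact: lX.
have mgX : measurable_fun setT (fun w => g (X w)) by exact: measurableT_comp.
have E : (\int[P]_w S w = - \int[P]_w (- g (X w)))%E.
  have := H setT measurableT; rewrite preimage_setT => ->.
  rewrite -integral_ge0N; last by move=> w _; rewrite oppe_ge0.
  by apply: eq_integral => w _; rewrite oppeK.
have I0 : (\int[P]_w S w = 0)%E.
  apply/eqP; rewrite eq_le integral_ge0// andbT E oppe_le0.
  by apply: integral_ge0 => w _; rewrite oppe_ge0.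
have aS : {ae P, forall w, S w = 0%E}.
  have : (\int[P]_w `|S w| = 0)%E.
    by rewrite -[RHS]I0; apply: eq_integral => w _; rewrite gee0_abs.
  by move=> /(ae_eq_integral_abs P measurableT mS); apply: filterS => w; apply.
split=> //; apply/eqP; rewrite eq_le Cle /=.
have : (\int[P]_w `|g (X w)| = 0)%E.
  under eq_integral do rewrite lee0_abs//.
  by apply: oppe_inj; rewrite -E I0 oppe0.
move=> /(ae_eq_integral_abs P measurableT mgX) /ae_nonempty [w /(_ I) gw].
have {gw} <- : g (X w) = 0%E := gw.
by apply: ereal_sup_ubound; exists (X w) => //; exact: lX.
Qed.

End RemainderWeights.

Section RateComparison.
Context {R : realType}.
Variables (lam : nat -> R) (k a : R) (m n : nat).
Hypotheses (m0 : (0 < m)%N) (a0 : 0 <= a) (k0 : 0 < k) (lam0 : 0 < lam n).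
Let h := bandwidth lam k n.
Let r := rate_r lam k n.

Lemma bandwidth_gt0 : 0 < h.
Proof. exact: powR_gt0. Qed.

Lemma lam_bandwidth : lam n = h `^ (2 * k).
Proof.
rewrite /h /bandwidth -powRrM mulVf ?powRr1 ?(ltW lam0)//.
by rewrite gt_eqF// mulr_gt0.
Qed.

Lemma rate_r_gt0 : 0 < r.
Proof. by rewrite /r /rate_r ltr_wpDl ?powR_ge0// powR_gt0// bandwidth_gt0. Qed.

(* The exponent of h^-1 in rate_a is a + 3/2 - 1/(4m) >= 5/4, and both
   logarithmic factors are at least 1 once n >= e^e. *)
Lemma rate_a_ge (Cl : \bar R) (c : R) : h <= 1 -> expR (expR 1) <= n%:R :> R ->
  (c%:E <= Cl)%E ->
  ((n%:R `^ (- 2^-1) * h^-1 * r + c * (h `^ (- 2^-1) * r ^+ 2))%:E <= rate_a m lam k a Cl n)%E.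
Proof.
move=> h1 n1 cC; have h0 := bandwidth_gt0; have r0 := rate_r_gt0.
rewrite /rate_a -/h -/r EFinD; apply: leeD; last first.
  rewrite EFinM; apply: lee_wpmul2r => //.
  by rewrite lee_fin mulr_ge0 ?powR_ge0 ?sqr_ge0.
rewrite lee_fin.
have n0 : 0 < n%:R :> R by apply: lt_le_trans n1; exact: expR_gt0.
have ln1 : expR 1 <= ln n%:R :> R.
  by rewrite -[X in X <= _]expRK ler_ln ?posrE ?expR_gt0.
have e1 : 1 <= expR 1 :> R by rewrite -expR0 ler_expR.
have ln0 : 0 < ln n%:R :> R by apply: lt_le_trans ln1; exact: expR_gt0.
have lnln : 1 <= ln (ln n%:R) :> R.
  by rewrite -[X in X <= _]expRK ler_ln ?posrE ?expR_gt0.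
set E := (4 * m%:R * a + 6 * m%:R - 1) / (4 * m%:R).
have m1 : 1 <= m%:R :> R by rewrite ler1n.
have E1 : 1 <= E.
  rewrite /E ler_pdivlMr; last by rewrite mulr_gt0// ltr0n.
  have : 0 <= 4 * m%:R * a by rewrite mulr_ge0// mulr_ge0.
  by lra.
have hE : h^-1 <= h `^ (- E).
  rewrite powRN lef_pV2 ?posrE ?powR_gt0//.
  rewrite -[leRHS](powRr1 (ltW h0)).
  by apply: ger_powR => //; rewrite h0.
have l2 : 1 <= (ln n%:R) ^+ 2 :> R by rewrite exprn_ege1// (le_trans e1).
have l3 : 1 <= Num.sqrt (ln (ln n%:R)) :> R by rewrite -[X in X <= _]sqrtr1 ler_wsqrtr.
have p0 : 0 <= n%:R `^ (- 2^-1) :> R by exact: powR_ge0.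
apply: (@le_trans _ _ (n%:R `^ (- 2^-1) * h `^ (- E) * r)).
  by rewrite ler_wpM2r ?(ltW r0)// ler_wpM2l.
have q0 : 0 <= n%:R `^ (- 2^-1) * h `^ (- E) * r.
  by rewrite mulr_ge0 ?(ltW r0)// mulr_ge0// powR_ge0.
rewrite -[X in X <= _]mulr1 -[X in X <= _]mulr1.
apply: ler_pM => //; first by rewrite mulr1.
by rewrite mulr1 ler_peMr.
Qed.

End RateComparison.

Section WeightEnvelope.
Context {R : realType} {d : measure_display} {Omega : measurableType d}.
Variable P : probability Omega R.
Variables (X : Omega -> L2path R) (S2 S3 : Omega -> \bar R) (K : R).
Hypotheses (mX : measurable_fun setT X) (K0 : 0 <= K).
Hypotheses (mS2 : measurable_fun setT S2) (mS3 : measurable_fun setT S3).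
Hypothesis H2 : forall f : L2path R -> R, measurable_fun setT f -> (forall x, 0 <= f x) ->
  (\int[P]_w ((fine (S2 w)) ^+ 2 * f (X w))%:E <= K%:E * \int[P]_w (f (X w))%:E)%E.
Hypothesis H3 : forall f : L2path R -> R, measurable_fun setT f -> (forall x, 0 <= f x) ->
  (\int[P]_w ((fine (S3 w)) ^+ 2 * f (X w))%:E <= K%:E * \int[P]_w (f (X w))%:E)%E.

Lemma envelope_weight_moment (f : L2path R -> R) : measurable_fun setT f -> (forall x, 0 <= f x) ->
  (\int[P]_w ((1 + fine (S2 w) + fine (S3 w)) ^+ 2 * f (X w))%:E <=
   (3 * (1 + 2 * K))%:E * \int[P]_w (f (X w))%:E)%E.
Proof.
move=> mf f0; have mfX : measurable_fun setT (fun w => f (X w)) by exact: measurableT_comp.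
have ms2 : measurable_fun setT (fun w => fine (S2 w)) by apply: (measurable_comp (F := setT)).
have ms3 : measurable_fun setT (fun w => fine (S3 w)) by apply: (measurable_comp (F := setT)).
have m2 : measurable_fun setT (fun w => ((fine (S2 w)) ^+ 2 * f (X w))%:E).
  by apply/measurable_EFinP/measurable_funM => //; exact: measurable_funX.
have m3 : measurable_fun setT (fun w => ((fine (S3 w)) ^+ 2 * f (X w))%:E).
  by apply/measurable_EFinP/measurable_funM => //; exact: measurable_funX.
have m1 : measurable_fun setT (fun w => (f (X w))%:E) by exact/measurable_EFinP.
have p1 w : (0 <= (f (X w))%:E)%E by rewrite lee_fin.
have p2 w : (0 <= ((fine (S2 w)) ^+ 2 * f (X w))%:E)%E by rewrite lee_fin mulr_ge0 ?sqr_ge0.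
have p3 w : (0 <= ((fine (S3 w)) ^+ 2 * f (X w))%:E)%E by rewrite lee_fin mulr_ge0 ?sqr_ge0.
apply: (@le_trans _ _ (\int[P]_w (3%:E * ((f (X w))%:E + (((fine (S2 w)) ^+ 2 * f (X w))%:E +
   ((fine (S3 w)) ^+ 2 * f (X w))%:E))))%E).
  apply: ge0_le_integral => //.
  - by move=> w _; rewrite lee_fin mulr_ge0 ?sqr_ge0.
  - apply/measurable_EFinP/measurable_funM => //; apply: measurable_funX.
    by apply: measurable_funD => //; apply: measurable_funD.
  - by apply/measurable_funeM/emeasurable_funD => //; exact: emeasurable_funD.
  - move=> w _; rewrite -!EFinD -EFinM lee_fin; move: (f0 (X w)).
    move: (fine (S2 w)) (fine (S3 w)) (f (X w)) => x y z z0.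
    rewrite (_ : 3 * _ = 3 * (1 + (x ^+ 2 + y ^+ 2)) * z); last by ring.
    rewrite ler_wpM2r//.
    by have := sqr_ge0 (x - y); have := sqr_ge0 (x - 1); have := sqr_ge0 (y - 1); nra.
rewrite ge0_integralZl//; last 2 first.
- by apply: emeasurable_funD => //; exact: emeasurable_funD.
- by move=> w _; rewrite adde_ge0// adde_ge0.
rewrite [in leRHS]EFinM -[leRHS]muleA; apply: lee_wpmul2l => //.
rewrite ge0_integralD//; last 2 first.
- by move=> w _; rewrite adde_ge0.
- exact: emeasurable_funD.
rewrite ge0_integralD//.
have I0 : (0 <= \int[P]_w (f (X w))%:E)%E by apply: integral_ge0.
rewrite EFinD ge0_muleDl ?lee_fin ?mulr_ge0// mul1e.
apply: leeD => //; rewrite mulr_natl mulr2n EFinD ge0_muleDl ?lee_fin//.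
by apply: leeD; [exact: H2|exact: H3].
Qed.

End WeightEnvelope.

(** * The theorem *)

(** The condition chi <= L c expresses that the second error term is present only if the second rate
    term has a positive constant. *)
Lemma rates_combine (R : realDomainType) (U V L c chi x y : R) :
  0 <= U -> 0 <= V -> 0 <= L -> 0 <= c -> 0 <= x -> 0 <= y -> chi <= L * c ->
  U * x + chi * (V * y) <= (U + V * L) * (x + c * y).
Proof.
move=> U0 V0 L0 c0 x0 y0 chiL.
have h : chi * (V * y) <= L * c * (V * y) by rewrite ler_wpM2r// mulr_ge0.
have := mulr_ge0 U0 (mulr_ge0 c0 y0); have := mulr_ge0 (mulr_ge0 V0 L0) x0.
by move: h; lra.
Qed.

Lemma sqr_powR_half (R : realType) (x : R) : 0 < x -> (x `^ (- 2^-1)) ^+ 2 = x^-1.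
Proof.
move=> x0; rewrite -powR_mulrn ?powR_ge0// -powRrM (_ : - 2^-1 * 2%:R = - 1) ?powR_inv1 ?(ltW x0)//.
by field.
Qed.

Lemma truncated_remainder_le (R : realType) (chi x s2 s3 z : R) :
  0 <= x -> 0 <= s2 -> 0 <= s3 -> z <= x * (2 * s2) -> z <= x * (s3 * x) ->
  chi = 1 \/ chi = 0 /\ s3 = 0 ->
  z <= chi * ((1 + s2 + s3) * (x * Num.min 2 x)).
Proof.
move=> x0 s20 s30 b2 b3 [->|[-> s3E]]; last first.
  by rewrite mul0r; apply: (le_trans b3); rewrite s3E mul0r mulr0.
rewrite mul1r; have [h|h] := leP 2 x.
  apply: (le_trans b2); rewrite [leRHS]mulrCA ler_wpM2l// [leLHS]mulrC ler_wpM2r//.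
  by rewrite addrAC lerDr addr_ge0.
apply: (le_trans b3); rewrite [leRHS]mulrCA ler_wpM2l// ler_wpM2r//.
by rewrite lerDr addr_ge0.
Qed.

Section LossWeights.
Context {R : realType}.
Variables (Yset : set R) (mYset : measurable Yset) (ell : R -> R -> R).
Hypothesis mell : forall u : R, measurable_fun Yset (fun y => ell y u).
Hypothesis Hell : forall y, Yset y ->
        [/\ forall j, (j < 3)%N -> forall u : R, derivable ((ell y)^`(j)%classic) u 1,
            continuous ((ell y)^`(3)%classic)
          & forall u v t : R, u != v -> 0 < t -> t < 1 ->
              t * ell y u + (1 - t) * ell y v < ell y (t * u + (1 - t) * v)].

Definition loss_weight (y : R) : R :=
  1 + fine (supell Yset ell 2 y) + fine (supell Yset ell 3 y).

Let sup0 j y : 0 <= fine (supell Yset ell j y).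
Proof. by rewrite fine_ge0// supell_ge0. Qed.

Lemma loss_weight_ge1 y : 1 <= loss_weight y.
Proof. by rewrite /loss_weight -addrA lerDl addr_ge0. Qed.

Lemma measurable_loss_weight : measurable_fun setT loss_weight.
Proof.
have m j : (j <= 3)%N -> measurable_fun setT (fun y => fine (supell Yset ell j y)).
  by move=> j3; apply: (measurable_comp (F := setT)) => //; exact: measurable_supell.
by apply: measurable_funD; [apply: measurable_funD|]; rewrite //; exact: m.
Qed.

Lemma remainder_le (chi y u v : R) : Yset y ->
  (supell Yset ell 2 y < +oo)%E -> (supell Yset ell 3 y < +oo)%E ->
  chi = 1 \/ chi = 0 /\ supell Yset ell 3 y = 0%E ->
  `|(ell y)^`()%classic v - (ell y)^`()%classic u - dell Yset ell 2 y u * (v - u)| <=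
  chi * (loss_weight y * (`|v - u| * Num.min 2 `|v - u|)).
Proof.
move=> yY; rewrite dellE// => f2 f3 Hchi.
have e2 := @supellE R Yset ell 2 y yY; have e3 := @supellE R Yset ell 3 y yY.
have b2 := taylor_bound2 Hell u v yY; have b3 := taylor_bound3 Hell u v yY.
rewrite -e2 in b2; rewrite -e3 in b3.
apply: (truncated_remainder_le (normr_ge0 (v - u)) (sup0 2 y) (sup0 3 y) (b2 f2) (b3 f3)).
by case: Hchi => [|[-> ->]]; [left|right].
Qed.

End LossWeights.

Theorem theorem3p6 (R : realType) (d : measure_display)
  (Omega : measurableType d) (P : probability Omega R)
  (m : nat) (hm : (1 <= m)%N)
  (Yset : set R) (mYset : measurable Yset)
  (ell : R -> R -> R)
  (mell : forall u : R, measurable_fun Yset (fun y => ell y u))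
  (F : R -> R)
  (Y : Omega -> R) (X : Omega -> L2path R)
  (Ys : nat -> Omega -> R) (Xs : nat -> Omega -> L2path R)
  (mY : measurable_fun setT Y) (YY : forall w, Yset (Y w))
  (mX : L2process X)
  (mYs : forall i, measurable_fun setT (Ys i))
  (YsY : forall i w, Yset (Ys i w))
  (mXs : forall i, L2process (Xs i))
  (indep : mutually_independent P (fun i w => (Ys i w, Xs i w)))
  (ident : identically_distributed P (fun i w => (Ys i w, Xs i w))
                                     (fun w => (Y w, X w)))
  (theta0 : R * (R -> R)) (Htheta0 : Hm m theta0.2)
  (link : cond_exp P X (fun w => (Y w)%:E) (fun x => (F (lin x theta0))%:E))
  (B : L2path R -> R) (hB : is_B P ell Y X theta0 B)
  (g3 : L2path R -> \bar R)
  (hg3 : cond_exp P X (fun w => supderiv ell 3 (Y w)) g3)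
  (lam : nat -> R) (lam_gt0 : forall n, 0 < lam n)
  (tau W : nat -> (R -> R) -> (R -> R))
  (htau : forall n, is_tau P X B m (lam n) (tau n))
  (hW : forall n, is_W P X B m (lam n) (W n))
  (thetahat : nat -> Omega -> R * (R -> R))
  (hthetahat : forall n, (1 <= n)%N -> {ae P, forall w,
     Hm m (thetahat n w).2 /\
     forall theta : R * (R -> R), Hm m theta.2 ->
       criterion m ell Ys Xs (lam n) n w theta <=
       criterion m ell Ys Xs (lam n) n w (thetahat n w)})
  (k a : R)
  (A1 : assumption_A1 P Yset ell Y X theta0 B)
  (A2 : assumption_A2 P X B)
  (A3 : assumption_A3 P m X B lam k a)
  (A4 : assumption_A4 P m X)
  (A5 : bounded_in_prob P
          (fun n w => normH P X B m (lam n) (thetahat n w - theta0))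
          (fun n => (rate_r lam k n)%:E))
  (h_to0 : bandwidth lam k n @[n --> \oo] --> (0 : R))
  (h_log : (fun n => ln (bandwidth lam k n)^-1 : R) =O_\oo
           (fun n => ln n%:R : R)) :
  bounded_in_prob P
    (fun n w => normH P X B m (lam n)
       (thetahat n w - theta0
        - Score P X B m ell Ys Xs (lam n) (tau n) (W n) n w theta0))
    (rate_a m lam k a (C_ell g3)).
Proof.
have [Hell [C0 [C1 [C00 C10 Hexp]]] [C2 C20 BC] BX0 _] := A1.
have [g2 Hg2 g2C] := Hexp 2%N isT; have [g4 Hg4 g4C] := Hexp 3%N isT.
have [BXX Cc _] := A2; have [a0 ak [phi [rho [Cphi [_ [Hphi' HVJ [Hrho _] HA Hbasis]]]]]] := A3.
have [c1 [c2 [c10 _ [nu0 _ Hasym]]]] := HA.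
have Hphi nu : (1 <= nu)%N -> Hm m (phi nu) by move=> /Hphi'[].
have [_ [M0 M00 HM0]] := A4.
have lX := mX.2; have mXp := measurable_L2path mX.
have mB : measurable_fun setT B.
  have [_ mNB _] := hB; have /measurable_EFinP/measurable_funN := mNB.
  by apply: eq_measurable_fun => x _ /=; rewrite opprK.
have k0 : 0 < k by apply: lt_trans ak; rewrite ltr_wpDl// invr_gt0.
have k1 : 1 < 2 * k by lra.
pose S j w := supell Yset ell j (Y w).
have SE j w : S j w = supderiv ell j (Y w) by exact: supellE.
have mS j : (j <= 3)%N -> measurable_fun setT (S j).
  by move=> j3; apply: (measurable_comp (F := setT)) => //; exact: (measurable_supell mYset mell Hell).
have S0 j w : (0 <= S j w)%E by exact: supell_ge0.
have HS2 : cond_exp P X (fun w => expeR (S 2%N w * (C0^-1)%:E)%E) g2.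
  by rewrite (_ : (fun w => _) = (fun w => expeR (supderiv ell 2 (Y w) * (C0^-1)%:E)%E))//;
    apply/funext => w; rewrite SE.
have HS3 : cond_exp P X (fun w => expeR (S 3%N w * (C0^-1)%:E)%E) g4.
  by rewrite (_ : (fun w => _) = (fun w => expeR (supderiv ell 3 (Y w) * (C0^-1)%:E)%E))//;
    apply/funext => w; rewrite SE.
(* K is the constant of [moment_square_le], and CG that of [envelope_weight_moment], whose 3 comes
   from (1 + x + y)^2 <= 3 (1 + x^2 + y^2). *)
pose K := 2 * C0 ^+ 2 * C1; have K0 : 0 <= K by rewrite mulr_ge0 ?(ltW C10)// mulr_ge0// sqr_ge0.
pose CG := 3 * (1 + 2 * K); pose G := loss_weight Yset ell.
have HG (f : L2path R -> R) : measurable_fun setT f -> (forall x, 0 <= f x) ->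
  (\int[P]_w (G (Y w) ^+ 2 * f (X w))%:E <= CG%:E * \int[P]_w (f (X w))%:E)%E.
  move=> mf f0; have := @envelope_weight_moment _ _ _ P X (S 2%N) (S 3%N) K mXp K0 (mS 2 isT) (mS 3 isT)
    (fun f mf f0 => moment_square_le mXp (mS 2 isT) (S0 2) C00 C10 HS2 g2C mf f0)
    (fun f mf f0 => moment_square_le mXp (mS 3 isT) (S0 3) C00 C10 HS3 g4C mf f0) f mf f0.
  exact.
have S2lt := ae_lty mXp (S0 2%N) C00 C10 HS2 g2C.
have S3lt := ae_lty mXp (S0 3%N) C00 C10 HS3 g4C.
pose om (z : R * L2path R) := dell Yset ell 2 z.1 (lin z.2 theta0).
have l0 := Hm_L2I hm Htheta0.
have mom : measurable_fun setT om.
  apply: (caratheodory_measurable (psi := dell Yset ell 2) (q := fun x : L2path R => lin x theta0)).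
  - by move=> u; exact: (measurable_dell mYset mell Hell).
  - by move=> y; exact: (continuous_dell Hell).
  - by apply: measurable_funD => //; exact: measurable_dotI_path.
have omE w : om (Y w, X w) = (ell (Y w))^`(2)%classic (lin (X w) theta0).
  by rewrite /om dellE//; exact: YY.
have omG : {ae P, forall w, `|om (Y w, X w)| <= G (Y w)}.
  apply: filterS S2lt => w; rewrite omE SE => f2.
  apply: (le_trans (le_fine_supderiv _ f2)); rewrite -SE /S /G /loss_weight.
  by rewrite addrAC lerDr addr_ge0// fine_ge0// supell_ge0.
pose o w := om (Y w, X w).
have mo : measurable_fun setT o by apply: (measurableT_comp mom); exact: measurable_fun_pair.
have o0 w : o w <= 0 by rewrite /o omE; exact: (ell2_le0 Hell).
have HBo : cond_exp P X (fun w => (o w)%:E) (fun x => (- B x)%:E).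
  rewrite (_ : (fun w => (o w)%:E) = (fun w => ((ell (Y w))^`(2)%classic (lin (X w) theta0))%:E))//.
  by apply/funext => w; rewrite /o omE.
have BX : {ae P, forall w, 0 <= B (X w)}.
  by apply: filterS BC => w [h _]; apply: le_trans h; rewrite invr_ge0 ltW.
have Hcurv (f : L2path R -> R) (mf : measurable_fun setT f) (f0 : forall x, 0 <= f x) :
  (\int[P]_w ((- om (Y w, X w)) * f (X w))%:E = \int[P]_w (B (X w) * f (X w))%:E)%E :=
  curvature_eq mXp mB mo o0 HBo BX mf f0.
have HS3g : cond_exp P X (S 3%N) g3.
  by rewrite (_ : S 3%N = (fun w => supderiv ell 3 (Y w)))//; apply/funext => w; rewrite SE.
(* chi switches the Taylor remainder on or off: chi = 1 and L = 1 / c if C_ell has a positive lower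
   bound c, all three 0 if C_ell = 0. *)
have [chi [c [L [[chi0 c0 L0 chiL cC] Hchi]]]] : exists chi c L : R,
    [/\ 0 <= chi, 0 <= c, 0 <= L, chi <= L * c & (c%:E <= C_ell g3)%E] /\
    {ae P, forall w, chi = 1 \/ chi = 0 /\ S 3%N w = 0%E}.
  have [[c c0 cC]|[C0' S30]] := C_ell_dichotomy lX mXp (mS 3 isT) (S0 3%N) HS3g.
    exists 1, c, c^-1; split; last by apply: nearW => w; left.
    by split => //; rewrite ?invr_ge0 ?(ltW c0)// mulVf// gt_eqF.
  exists 0, 0, 0; split; first by split => //; rewrite ?mulr0// C0'.
  by apply: filterS S30 => w h; right.
have neqy (x : \bar R) : x <> +oo%E -> (x < +oo)%E by move=> h; rewrite ltey; apply/eqP.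
(* The almost sure properties used in the Taylor bounds form a measurable set of values of Y, so
   that equality in law transfers them to the whole sample. *)
pose Q := [set y | [/\ supell Yset ell 2 y <> +oo%E, supell Yset ell 3 y <> +oo%E &
   chi = 1 \/ chi = 0 /\ supell Yset ell 3 y = 0%E]].
have mQ : measurable Q.
  have msup j (A : set (\bar R)) : (j <= 3)%N -> measurable A ->
      measurable [set y | A (supell Yset ell j y)].
    move=> j3 mA; have := measurable_supell mYset mell Hell j3 measurableT mA.
    by rewrite setTI.
  have -> : Q = [set y | (~` [set +oo%E]) (supell Yset ell 2 y)] `&`
      ([set y | (~` [set +oo%E]) (supell Yset ell 3 y)] `&`
       [set y | (if chi == 1 then setT else if chi == 0 then [set 0%E] else set0) (supell Yset ell 3 y)]).
    apply/seteqP; split => y /=.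
      move=> [h1 h2 h3]; split => //; split => //.
      case: h3 => [->|[-> ->]]; first by rewrite eqxx.
      by rewrite eqxx; case: eqP.
    move=> [h1 [h2 h3]]; split => //; move: h3; case: eqP => [->|_]; first by left.
    by case: eqP => [-> h|//]; right.
  apply: measurableI; first by apply: msup => //; apply: measurableC; exact: emeasurable_set1.
  apply: measurableI; first by apply: msup => //; apply: measurableC; exact: emeasurable_set1.
  apply: msup => //; case: ifP => // _; case: ifP => // _; exact: emeasurable_set1.
have QY : {ae P, forall w, Q (Y w)}.
  apply: filterS3 S2lt S3lt Hchi => w h2 h3 h4; split => //.
    by move=> e; move: h2; rewrite /S e ltxx.
  by move=> e; move: h3; rewrite /S e ltxx.
have identY : identically_distributed P Ys Y.
  move=> i A mA.
  have mA1 : measurable (fst @^-1` A : set (R * L2path R)).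
    by rewrite -[E in measurable E]setTI; exact: measurable_fst.
  exact: (ident i _ mA1).
have QYs := ident_ae mYs mY identY mQ QY.
(* The constant of [gam_sum_le] for p = 2 k; the bound Gam will be CGam / h. *)
pose CGam := C2 + nu0%:R + 2 `^ (2 * k) * (1 + c1^-1) / (2 * k - 1).
have CGam0 : 0 < CGam.
  rewrite /CGam -addrA ltr_wpDr//; apply: addr_ge0 => //.
  apply: divr_ge0; last by rewrite subr_ge0 ltW.
  by rewrite mulr_ge0 ?powR_ge0// addr_ge0// invr_ge0 ltW.
pose kap := 1 + kappa4 C2 M0.
have kap1 : 1 <= kap by rewrite lerDl; exact: kappa4_ge0.
have CG1 : 1 <= CG by rewrite /CG; lra.
have CG0 : 0 < CG := lt_le_trans ltr01 CG1; have kap0 : 0 < kap := lt_le_trans ltr01 kap1.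
have CGk0 : 0 < CG * kap := mulr_gt0 CG0 kap0.
move=> e e0; have e20 : 0 < e / 2 by rewrite divr_gt0.
have [M MM HM] := A5 _ e20.
(* With t = A n^(-1/2) h^(-1), this A makes the bound on the probability of the bad event, 2 n^-1 CG
   kap (CGam / h)^2 / t^2, equal to e / 2. *)
pose A := Num.sqrt (4 * (CG * kap) * CGam ^+ 2 / e).
have A2e : A ^+ 2 = 4 * (CG * kap) * CGam ^+ 2 / e.
  by rewrite sqr_sqrtr// divr_ge0 ?(ltW e0)// mulr_ge0 ?sqr_ge0// mulr_ge0// ltW.
have A0 : 0 < A.
  by rewrite sqrtr_gt0 divr_gt0// mulr_gt0 ?exprn_gt0// mulr_gt0.
(* The error factor t + chi (2 + M) (CG kap sqrt(CGam / h) r + t) is U n^(-1/2) h^(-1) + chi V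
   h^(-1/2) r. *)
pose U := (1 + chi * (2 + M)) * A; pose V := (2 + M) * (CG * kap * Num.sqrt CGam).
have V0 : 0 <= V.
  by rewrite mulr_ge0 ?addr_ge0 ?(ltW MM)// mulr_ge0 ?sqrtr_ge0// ltW.
have U0 : 0 < U.
  by rewrite mulr_gt0// ltr_wpDr// mulr_ge0// addr_ge0// ltW.
exists (M * (U + V * L)); first by rewrite mulr_gt0// ltr_wpDr// mulr_ge0.
have hle1 : \forall n \near \oo, bandwidth lam k n <= 1.
  have /cvgrPdist_lt /(_ 1 ltr01) := h_to0; apply: filterS => n.
  by rewrite sub0r normrN => h; apply: ltW; apply: le_lt_trans h; exact: ler_norm.
have nbig : \forall n \near \oo, expR (expR 1) <= n%:R :> R by exact: nbhs_infty_ger.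
have npos : \forall n \near \oo, (1 <= n)%N by exact: nbhs_infty_ge.
near=> n.
have h1 : bandwidth lam k n <= 1 by near: n.
have nb : expR (expR 1) <= n%:R :> R by near: n.
have n1 : (1 <= n)%N by near: n.
have HMn : (mu_ext P [set w | (M%:E * (rate_r lam k n)%:E <
   `|normH P X B m (lam n) (thetahat n w - theta0)|%:E)%E] <= (e / 2)%:E)%E by near: n.
set h := bandwidth lam k n in h1; set r := rate_r lam k n in HMn.
have h0 : 0 < h := bandwidth_gt0 k (lam_gt0 n).
have r0 : 0 < r := rate_r_gt0 k (lam_gt0 n).
have nR0 : 0 < n%:R :> R by rewrite ltr0n.
pose q := n%:R `^ (- 2^-1) * h^-1.
have q0 : 0 < q by rewrite mulr_gt0 ?powR_gt0// invr_gt0.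
pose t := A * q; have t0 : 0 < t by rewrite mulr_gt0.
have lamE := lam_bandwidth k0 (lam_gt0 n).
have HGam N : \sum_(nu < N.+1) (gam P X B rho (lam n) nu)^-1 <= CGam / h.
  apply: (gam_sum_le mX mB C20 BC (ltW (lam_gt0 n)) Hrho N h0 h1 k1 c10 lamE).
  by move=> nu /Hasym[].
have [bad [mbad Pbad Hbad]] := estimation_error_event hm mX mB C20 BC BX0 BXX Cc
  (ltW (lam_gt0 n)) Hphi HVJ (Hbasis n) Hrho M00 HM0 mY mYs mXs indep ident mom
  (measurable_loss_weight mYset mell Hell) (loss_weight_ge1 Yset ell) omG HG Hcurv HGam ell
  n1 r0 t0 MM chi0 (htau n) (hW n) Htheta0.
have [N [mN PN HN]] := filterI (hthetahat n n1) QYs.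
have PNb : (P (bad `|` N) <= (e / 2)%:E)%E.
  apply: le_trans (measureU2 _ _ _) _ => //.
  rewrite [X in (_ + X)%E]PN adde0; apply: (le_trans Pbad); rewrite lee_fin.
  rewrite le_eqVlt; apply/orP; left; apply/eqP; rewrite [t ^+ 2]exprMn A2e [q ^+ 2]exprMn.
  rewrite (sqr_powR_half nR0).
  rewrite -/kap; field; rewrite ?gt_eqF//.
apply: (@le_trans _ _ (mu_ext P ([set w | (M%:E * r%:E <
   `|normH P X B m (lam n) (thetahat n w - theta0)|%:E)%E] `|` (bad `|` N)))).
  (* Outside the event of a large |thetahat - theta0|, the bad event and the null set N, the bound
     on the error contradicts [Hw]. Only the first of these may fail to be measurable, and it enters
     through the outer probability. *)
  apply: le_mu_ext => w /= Hw; apply: contrapT => /not_orP[nM /not_orP[nbad nN]].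
  have : (~` N) w by [].
  have /(_ w) := subsetC HN; rewrite setCK => /[apply] -[[hh Hmax] Qi].
  have gM : normH P X B m (lam n) (thetahat n w - theta0) <= M * r.
    rewrite leNgt; apply/negP => h3; apply: nM; rewrite -EFinM lte_fin.
    by apply: (lt_le_trans h3); exact: ler_norm.
  have Hrem i : `|(ell (Ys i w))^`()%classic (lin (Xs i w) (thetahat n w)) -
        (ell (Ys i w))^`()%classic (lin (Xs i w) theta0) -
        om (Ys i w, Xs i w) * (lin (Xs i w) (thetahat n w) - lin (Xs i w) theta0)| <=
      chi * (G (Ys i w) * (`|lin (Xs i w) (thetahat n w) - lin (Xs i w) theta0| *
         Num.min 2 `|lin (Xs i w) (thetahat n w) - lin (Xs i w) theta0|)).
    have [q2 q3 qc] := Qi i.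
    by apply: (remainder_le Hell); [exact: YsY|exact: neqy q2|exact: neqy q3|exact: qc].
  have dell i u : derivable (ell (Ys i w)) u 1.
    by have [D _ _] := Hell _ (YsY i w); exact: (D 0%N).
  have := Hbad w _ nbad hh (fun i => @dell i) Hmax Hrem gM.
  rewrite leNgt => /negP; apply.
  have := rate_a_ge hm a0 (lam_gt0 n) h1 nb cC; rewrite -/h -/r => Ra.
  have MUV : 0 <= M * (U + V * L) by rewrite mulr_ge0 ?(ltW MM)// addr_ge0 ?(ltW U0)// mulr_ge0.
  have := le_lt_trans (lee_wpmul2l _ Ra) Hw; rewrite lee_fin => /(_ MUV).
  rewrite -EFinM lte_fin ger0_norm ?normH_ge0//; apply: le_lt_trans.
  pose p := h `^ (- 2^-1) * r ^+ 2; rewrite -/p.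
  have p0 : 0 <= p by rewrite mulr_ge0 ?powR_ge0 ?sqr_ge0.
  have pE : Num.sqrt (CGam / h) * r * r = Num.sqrt CGam * p.
    rewrite /p powRN powR12_sqrt ?(ltW h0)// sqrtrM ?(ltW CGam0)// sqrtrV ?(ltW h0)//.
    by ring.
  rewrite (_ : _ * (M * r) = M * (U * (q * r) + chi * (V * p))); last first.
    rewrite /U /V /t -/kap; have := pE; move: (Num.sqrt _) (Num.sqrt _) => x y E.
    transitivity (M * ((1 + chi * (2 + M)) * A * (q * r) + chi * ((2 + M) * (CG * kap * (y * r * r))))).
      by ring.
    by rewrite E; ring.
  rewrite -[leRHS]mulrA ler_pM2l// -/q.
  have qr0 : 0 <= q * r by rewrite mulr_ge0 ?ltW.
  by apply: rates_combine => //; exact: ltW.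
apply: le_trans (outer_measureU2 (mu_ext P) _ _) _.
apply: (@le_trans _ _ ((e / 2)%:E + (e / 2)%:E)%E); last by rewrite -EFinD -splitr.
apply: leeD; first exact: HMn.
by apply: le_trans PNb; rewrite -(measurable_mu_extE P (measurableU _ _ mbad mN)).
Unshelve. all: by end_near.
Qed.
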